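(* Let $d\ge2$, $\varrho\ge0$, and let $\mathsf{w}$ be a doubling weight on $\mathbb{X}_0^{d+1}$ such that $\mathsf{w}(x,t)=\mathsf{w}(x,-t)$ for all $(x,t)\in\mathbb{X}_0^{d+1}$. Then there is a constant $c>0$ such that for all integers $n\ge1$ and all $(x,t)\in\mathbb{X}_0^{d+1}$, $$\lambda_n^E(\mathsf{w};(x,t))\le c\,\mathsf{w}\big(\mathsf{c}_\varrho((x,t),\tfrac1n)\big).$$ Moreover, for $\gamma\ge0$ there is a constant $c'>0$ such that for all $n\ge1$ and all $(x,t)\in\mathbb{X}_0^{d+1}$, $$\lambda_n^E(\mathsf{w}_{0,\gamma}^\varrho;(x,t))\ge c'\,\mathsf{w}_{0,\gamma}^\varrho\big(\mathsf{c}_\varrho((x,t),\tfrac1n)\big)\sim n^{-d}\,\mathsf{w}_{0,\gamma}^\varrho(n;t).$$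
   Context: For $\varrho\ge0$, $\mathbb{X}_0^{d+1}=\{(x,t)\in\mathbb{R}^d\times\mathbb{R}:\|x\|^2=t^2-\varrho^2,\ \varrho\le|t|\le\sqrt{\varrho^2+1}\}$, with parts $\mathbb{X}_{0,+}^{d+1}=\{t\ge0\}$ and $\mathbb{X}_{0,-}^{d+1}=\{t\le0\}$. For two points in the same part, $\mathsf{d}_{\mathbb{X}_0}^\varrho((x,t),(y,s))=\arccos\big(\langle x,y\rangle+\sqrt{1+\varrho^2-t^2}\sqrt{1+\varrho^2-s^2}\big)$; the ball $\mathsf{c}_\varrho((x,t),r)$ is the set of points $(y,s)$ in the same part as $(x,t)$ with $\mathsf{d}_{\mathbb{X}_0}^\varrho((x,t),(y,s))\le r$. The measure $\sigma_\varrho$ is given by $d\sigma_\varrho(x,t)=d\omega_{\sqrt{t^2-\varrho^2}}(x)\,dt$, where $d\omega_\rho$ is the surface measure on the sphere of radius $\rho$ in $\mathbb{R}^d$. For a weight $\mathsf{w}$, $\mathsf{w}(E)=\int_E\mathsf{w}\,d\sigma_\varrho$. A nonnegative integrable $\mathsf{w}$ (not a.e. zero) is a doubling weight if there is $L>0$ with $\mathsf{w}(\mathsf{c}_\varrho(z,2r))\le L\,\mathsf{w}(\mathsf{c}_\varrho(z,r))$ for all $z\in\mathbb{X}_0^{d+1}$, $r>0$. $\mathsf{w}_{0,\gamma}^\varrho(t)=|t|(t^2-\varrho^2)^{-1/2}(\varrho^2+1-t^2)^{\gamma-1/2}$ and $\mathsf{w}_{0,\gamma}^\varrho(n;t)=(1+\varrho^2-t^2+n^{-2})^\gamma$.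 $\Pi_n^E(\mathbb{X}_0^{d+1})$ is the space of restrictions $p$ to $\mathbb{X}_0^{d+1}$ of polynomials of degree at most $n$ with $p(x,t)=p(x,-t)$ on $\mathbb{X}_0^{d+1}$. The Christoffel function is $$\lambda_n^E(\mathsf{w};(x,t))=\inf\Big\{\int_{\mathbb{X}_0^{d+1}}|g|^2\,\mathsf{w}\,d\sigma_\varrho:\ g\in\Pi_n^E(\mathbb{X}_0^{d+1}),\ g(x,t)=1\Big\}.$$ $A\sim B$ means $c_1A\le B\le c_2A$ with positive constants independent of $n$ and $(x,t)$. *)

(* Defs.v *)
From HB Require Import structures.
From mathcomp Require Import all_boot all_order all_algebra.
From mathcomp Require Import all_classical all_reals all_analysis.
From mathcomp Require Import measurable_realfun.
From mathcomp Require mpoly.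

Set Implicit Arguments.
Unset Strict Implicit.
Unset Printing Implicit Defensive.
Import Order.TTheory GRing.Theory Num.Theory.
Import numFieldNormedType.Exports.

Local Open Scope classical_set_scope.
Local Open Scope ring_scope.

(* R^d x R; the canonical product structure is the Borel sigma-algebra. *)
Notation ambient R d := (d.-tuple (measurableTypeR R) * measurableTypeR R)%type.

(* Lebesgue measure on R^n, as an iterated product. *)
Section lebesgue_cons.
Context {R : realType} {n : nat}.
Local Notation RT := (measurableTypeR R).
Variable m : {sigma_finite_measure set (n.-tuple RT) -> \bar R}.

Definition cons_pair (p : RT * n.-tuple RT) : n.+1.-tuple RT :=
  [tuple of p.1 :: p.2].

Lemma measurable_cons_pair : measurable_fun [set: RT * n.-tuple RT] cons_pair.
Proof. exact: measurable_cons. Qed.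

Definition lebesgue_cons : set (n.+1.-tuple RT) -> \bar R :=
  pushforward (lebesgue_measure \x m)%E cons_pair.

Lemma lebesgue_cons0 : lebesgue_cons set0 = 0%E.
Proof. by have mf := measurable_cons_pair; exact: measure0. Qed.

Lemma lebesgue_cons_ge0 A : (0 <= lebesgue_cons A)%E.
Proof. by have mf := measurable_cons_pair; exact: measure_ge0. Qed.

Lemma lebesgue_cons_sigma_additive : semi_sigma_additive lebesgue_cons.
Proof. by have mf := measurable_cons_pair; exact: measure_semi_sigma_additive. Qed.

HB.instance Definition _ := isMeasure.Build _ _ _ lebesgue_cons
  lebesgue_cons0 lebesgue_cons_ge0 lebesgue_cons_sigma_additive.

Lemma lebesgue_cons_sigma_finite : sigma_finite setT lebesgue_cons.
Proof.
pose mu := (lebesgue_measure \x m)%E.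
have [F FT mF] : sigma_finite [set: RT * n.-tuple RT] mu.
  have /sigma_finiteP[F [TF ndF Foo]] := sigma_finiteT (@lebesgue_measure R).
  have /sigma_finiteP[G [TG ndG Goo]] := sigma_finiteT m.
  exists (fun k => F k `*` G k).
    rewrite -setXTT TF TG predeqE => -[x y]; split.
      move=> [/= [i _ Fix] [j _ Gjy]]; exists (maxn i j) => //; split.
      - by move: x Fix; exact/subsetPset/ndF/leq_maxl.
      - by move: y Gjy; exact/subsetPset/ndG/leq_maxr.
    by move=> [i _ []/= ? ?]; split; exists i.
  move=> k; have [? ?] := Foo k; have [? ?] := Goo k.
  split; first exact: measurableX.
  by rewrite /mu product_measure1E// lte_mul_pinfty// ge0_fin_numE.
pose g (x : n.+1.-tuple RT) : RT * n.-tuple RT := (thead x, [tuple of behead x]).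
have mg : measurable_fun [set: n.+1.-tuple RT] g.
  apply: measurable_fun_pair; last exact: measurable_behead.
  exact: measurable_tnth.
have gK : cancel cons_pair g.
  by move=> [x y]; rewrite /g /cons_pair/=; congr pair; apply/val_inj.
exists (fun i => g @^-1` F i).
  by rewrite -preimage_bigcup -FT.
move=> i; have [mFi Foo] := mF i; split.
  by rewrite -[X in measurable X]setTI; exact: mg.
rewrite /lebesgue_cons /pushforward -comp_preimage.
by have -> : g \o cons_pair = id by apply/funext.
Qed.

HB.instance Definition _ := Measure_isSigmaFinite.Build _ _ _
  lebesgue_cons lebesgue_cons_sigma_finite.

End lebesgue_cons.

Fixpoint lebesgue_tuple (R : realType) (n : nat) :
    {sigma_finite_measure set (n.-tuple (measurableTypeR R)) -> \bar R} :=
  match n with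
  | 0 => \d_([tuple])
  | n'.+1 => lebesgue_cons (lebesgue_tuple R n')
  end.

Section euclidean.
Context {R : realType} {d : nat}.

Definition dotprod (x y : d.-tuple R) : R := \sum_(i < d) tnth x i * tnth y i.

Definition enorm (x : d.-tuple R) : R := Num.sqrt (dotprod x x).

Definition to_sphere (r : R) (x : d.-tuple R) : d.-tuple R :=
  [tuple r * (tnth x i / enorm x) | i < d].

End euclidean.

Section surface_measure.
Context {R : realType} {d : nat}.
Local Notation RT := (measurableTypeR R).
Local Notation space := (ambient R d).

Lemma measurable_coord i : measurable_fun [set: d.-tuple RT]
  (fun x => tnth x i : R).
Proof. exact: measurable_tnth. Qed.

Lemma measurable_enorm : measurable_fun [set: d.-tuple RT] (@enorm R d).
Proof.
apply: measurableT_comp.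
  exact: (continuous_measurable_fun (@sqrt_continuous R)).
by apply: measurable_sum => i; apply: measurable_funM; exact: measurable_coord.
Qed.

Definition unit_ball : set (d.-tuple RT) := [set x | enorm x <= 1].

Lemma measurable_unit_ball : measurable unit_ball.
Proof.
have -> : unit_ball = @enorm R d @^-1` `]-oo, 1]%classic.
  by apply/seteqP; split => x /=; rewrite in_itv.
by rewrite -[X in measurable X]setTI; exact: measurable_enorm.
Qed.

(* Radial projection onto the section of the surface at the same height. *)
Definition cylinder_map (rho : R) (p : space) : space :=
  (to_sphere (Num.sqrt (p.2 ^+ 2 - rho ^+ 2)) p.1, p.2).

Lemma measurable_cylinder_map rho :
  measurable_fun [set: space] (cylinder_map rho).
Proof.
have m2 : measurable_fun [set: space] (fun p => p.2 : R).
  exact: measurable_snd.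
apply: measurable_fun_pair; last exact: measurable_snd.
apply/measurable_fun_tnthP => i /=.
rewrite (_ : _ \o _ = fun p : space => Num.sqrt (p.2 ^+ 2 - rho ^+ 2) *
    (tnth p.1 i * (enorm p.1 `^ (-1)))); last first.
  by apply/funext => p /=; rewrite tnth_mktuple powR_inv1// sqrtr_ge0.
apply: measurable_funM.
  apply: (@measurableT_comp _ _ _ _ _ _ (@Num.sqrt R)).
    exact: (continuous_measurable_fun (@sqrt_continuous R)).
  by apply: measurable_funB => //; exact: measurable_funX.
apply: measurable_funM.
  by apply: (measurableT_comp (measurable_coord i)); exact: measurable_fst.
apply: (@measurableT_comp _ _ _ _ _ _ (@powR R ^~ (-1))).
  exact: measurable_powR.
by apply: (measurableT_comp measurable_enorm); exact: measurable_fst.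
Qed.

Lemma measurable_to_sphere (r : R) :
  measurable_fun [set: d.-tuple RT] (@to_sphere R d r : d.-tuple RT -> d.-tuple RT).
Proof.
apply/measurable_fun_tnthP => i /=.
rewrite (_ : _ \o _ = fun x : d.-tuple RT => r *
    (tnth x i * (enorm x `^ (-1)))); last first.
  by apply/funext => x /=; rewrite tnth_mktuple powR_inv1// sqrtr_ge0.
apply: measurable_funM => //; apply: measurable_funM.
  exact: measurable_coord.
apply: (@measurableT_comp _ _ _ _ _ _ (@powR R ^~ (-1))).
  exact: measurable_powR.
exact: measurable_enorm.
Qed.

(* Surface measure on the sphere of radius r, in polar-coordinate form: with x
   uniform on the unit ball B of R^d, r x / |x| is uniform on the sphere, and
   the total mass is d r^(d-1) vol(B), the area of the sphere. *)
Section sphere_measure.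
Variable r : {nonneg R}.

Definition cone_measure : set (d.-tuple RT) -> \bar R :=
  pushforward (mrestr (lebesgue_tuple R d) measurable_unit_ball)
    (to_sphere r%:num).

Lemma cone_measure0 : cone_measure set0 = 0%E.
Proof. by have mf := measurable_to_sphere r%:num; exact: measure0. Qed.

Lemma cone_measure_ge0 A : (0 <= cone_measure A)%E.
Proof. by have mf := measurable_to_sphere r%:num; exact: measure_ge0. Qed.

Lemma cone_measure_sigma_additive : semi_sigma_additive cone_measure.
Proof.
have mf := measurable_to_sphere r%:num.
by move=> *; apply: measure_semi_sigma_additive.
Qed.

HB.instance Definition _ := isMeasure.Build _ _ _ cone_measure
  cone_measure0 cone_measure_ge0 cone_measure_sigma_additive.

Definition sphere_measure : set (d.-tuple RT) -> \bar R :=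
  mscale (d%:R * r%:num ^+ d.-1)%:nng cone_measure.

HB.instance Definition _ := Measure.on sphere_measure.

End sphere_measure.

(* The measure d(omega_(sqrt(t^2 - rho^2)))(x) dt on the two-sided surface. *)
Section hyperboloid_measure.
Variable rho : R.

Definition height_range : set RT :=
  [set t : R | (rho <= `|t| <= Num.sqrt (rho ^+ 2 + 1))%R].

Definition slice_measure (A : set space) (t : RT) : \bar R :=
  sphere_measure (NngNum (sqrtr_ge0 ((t : R) ^+ 2 - rho ^+ 2))) (ysection A t).

Definition hyperboloid_measure (A : set space) : \bar R :=
  (\int[lebesgue_measure]_(t in height_range) slice_measure A t)%E.

Lemma measurable_height_range : measurable height_range.
Proof.
have -> : height_range = (fun t : R => `|t|) @^-1` `[rho, Num.sqrt (rho ^+ 2 + 1)]%classic.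
  by apply/seteqP; split => x /=; rewrite in_itv.
rewrite -[X in measurable X]setTI.
by apply: (@measurableT_comp _ _ _ _ _ _ (fun t : R => `|t|)) => //.
Qed.

Lemma slice_measure_ge0 A t : (0 <= slice_measure A t)%E.
Proof. exact: measure_ge0. Qed.

Lemma measurable_slice_measure A :
  measurable A -> measurable_fun [set: RT] (slice_measure A).
Proof.
move=> mA.
pose B := cylinder_map rho @^-1` A `&` (unit_ball `*` [set: RT]).
have mB : measurable B.
  apply: measurableI.
    by rewrite -[X in measurable X]setTI; exact: measurable_cylinder_map.
  by apply: measurableX => //; exact: measurable_unit_ball.
have -> : slice_measure A = fun t : RT =>
  ((d%:R * Num.sqrt ((t : R) ^+ 2 - rho ^+ 2) ^+ d.-1)%:E *
    lebesgue_tuple R d (ysection B t))%E.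
  apply/funext => t; rewrite /slice_measure /sphere_measure /mscale/=; congr (_ * _)%E.
  rewrite /pushforward /mrestr; congr (lebesgue_tuple R d _).
  by apply/seteqP; split => x /=; rewrite /ysection/= !inE /B /cylinder_map/=;
    tauto.
apply: emeasurable_funM.
  apply/measurable_EFinP; apply: measurable_funM => //.
  apply: measurable_funX; apply: (@measurableT_comp _ _ _ _ _ _ (@Num.sqrt R)).
    exact: (continuous_measurable_fun (@sqrt_continuous R)).
  by apply: measurable_funB => //; exact: measurable_funX.
exact: measurable_fun_ysection.
Qed.

Lemma hyperboloid_measure0 : hyperboloid_measure set0 = 0%E.
Proof.
by apply: integral0_eq => t _; rewrite /slice_measure ysection0 measure0.
Qed.

Lemma hyperboloid_measure_ge0 A : (0 <= hyperboloid_measure A)%E.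
Proof. by apply: integral_ge0 => t _; exact: slice_measure_ge0. Qed.

Lemma hyperboloid_measure_sigma_additive : semi_sigma_additive hyperboloid_measure.
Proof.
move=> A mA tA mUA.
rewrite [X in _ --> X](_ : _ = (\sum_(n <oo) hyperboloid_measure (A n))%E).
  apply/cvg_closeP; split; last by rewrite closeE.
  by apply: is_cvg_nneseries => n _ _; exact: hyperboloid_measure_ge0.
rewrite /hyperboloid_measure.
rewrite -(@integral_nneseries _ _ _ _ _ measurable_height_range 
  (fun n => slice_measure (A n)))//; last first.
- by move=> n; apply: measurable_funTS; exact: measurable_slice_measure.
apply: eq_integral => t _.
rewrite /slice_measure ysection_bigcup measure_semi_bigcup//.
- by move=> n; exact: measurable_ysection.
- exact: trivIset_ysection.
- by rewrite -ysection_bigcup; exact: measurable_ysection.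
Qed.

HB.instance Definition _ := isMeasure.Build _ _ _ hyperboloid_measure
  hyperboloid_measure0 hyperboloid_measure_ge0 hyperboloid_measure_sigma_additive.

End hyperboloid_measure.
End surface_measure.

Import -(notations) mpoly.

Section christoffel.
Context {R : realType} {d : nat}.
Local Notation space := (ambient R d).
Implicit Types (rho gamma r t : R) (w : space -> R) (z : space) (n : nat).

Definition hyperboloid rho : set space :=
  [set z | enorm z.1 ^+ 2 = z.2 ^+ 2 - rho ^+ 2 /\
           rho <= `|z.2 : R| <= Num.sqrt (rho ^+ 2 + 1)].

(* When rho = 0 the apex (0, 0) lies in both parts. *)
Definition same_part z z' : Prop :=
  (0 <= (z.2 : R) /\ 0 <= (z'.2 : R)) \/ ((z.2 : R) <= 0 /\ (z'.2 : R) <= 0).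

Definition hdist rho z z' : R :=
  acos (dotprod z.1 z'.1 + Num.sqrt (1 + rho ^+ 2 - z.2 ^+ 2) *
                           Num.sqrt (1 + rho ^+ 2 - z'.2 ^+ 2)).

Definition hball rho z r : set space :=
  [set z' | [/\ hyperboloid rho z', same_part z z' & hdist rho z z' <= r]].

Definition weighted rho w (E : set space) : \bar R :=
  (\int[hyperboloid_measure rho]_(z in E) (w z)%:E)%E.

Definition doubling_weight rho w : Prop :=
  [/\ forall z, hyperboloid rho z -> 0 <= w z,
      (hyperboloid_measure rho).-integrable (hyperboloid rho) (EFin \o w),
      ~ {ae hyperboloid_measure rho, forall z, hyperboloid rho z -> w z = 0} &
      exists2 L : R, 0 < L & forall z r, hyperboloid rho z -> 0 < r ->
        (weighted rho w (hball rho z (2 * r)) <=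
           L%:E * weighted rho w (hball rho z r))%E].

Definition eval_poly (p : mpoly d.+1 R) z : R :=
  meval (tnth [tuple of rcons z.1 z.2]) p.

(* Functions are considered through their restriction to the surface only. *)
Definition even_polys rho n : set (space -> R) :=
  [set g | (exists2 p : mpoly d.+1 R, (msize p <= n.+1)%N &
              forall z, hyperboloid rho z -> g z = eval_poly p z) /\
           forall (x : d.-tuple R) t, hyperboloid rho (x, t) ->
              g (x, t) = g (x, - t)].

Definition christoffel rho w n z : \bar R :=
  ereal_inf [set (\int[hyperboloid_measure rho]_(y in hyperboloid rho)
                    (`|g y| ^+ 2 * w y)%:E)%E
            | g in [set g | even_polys rho n g /\ g z = 1]].

(* powR sends 0 to 0 for a nonzero exponent; this affects only a null set. *)
Definition weight0 rho gamma z : R :=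
  `|z.2 : R| * (z.2 ^+ 2 - rho ^+ 2) `^ (- 2^-1) *
    (rho ^+ 2 + 1 - z.2 ^+ 2) `^ (gamma - 2^-1).

Definition weight0n rho gamma n t : R :=
  (1 + rho ^+ 2 - t ^+ 2 + n%:R ^- 2) `^ gamma.

End christoffel.

(* Main.v *)
Require Import Defs.
From mathcomp Require Import all_boot all_order all_algebra.
From mathcomp Require Import all_classical all_reals all_analysis.
From mathcomp Require Import measurable_realfun ring lra zify.
From mathcomp Require mpoly.

(* Projecting each part of the surface onto x identifies it with the unit ball
   and then with a hemisphere of the unit sphere of R^(d+1); the distance becomes
   the geodesic distance, even polynomials become polynomials in x, and
   weight0 dsigma becomes (1 - |x|^2)^(gamma - 1/2) dx.

   Upper bound: a power of the Jackson kernel in the cosine of the distance to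
   z, symmetrised under reflection of the hemisphere in its equator, is an even
   polynomial peaked at z; cutting the surface into dyadic shells around z and
   its mirror image and using the doubling property gives the estimate.

   Size of balls: in polar coordinates a ball of radius delta is an interval of
   latitudes of length about delta times spherical caps, whose volumes are
   estimated by covering and packing the corresponding cones with cubes.

   Lower bound: take a near-maximiser y of g^2 weight0n. Along a great circle
   through y, g is a trigonometric polynomial that grows at most polynomially in
   n times the distance from y; multiplied by a power of the Jackson kernel it is
   bounded by a multiple of |g y|, so by Bernstein's inequality |g| stays above
   |g y| / 2 on a ball of radius comparable to 1 / n, over which one integrates. *)

Set Implicit Arguments.
Unset Strict Implicit.
Unset Printing Implicit Defensive.
Import Order.TTheory GRing.Theory Num.Theory.
Import numFieldNormedType.Exports.
Import -(notations) mpoly.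
Local Open Scope classical_set_scope.
Local Open Scope ring_scope.

(** * The Jackson kernel *)

Section trigonometry.
Context {R : realType}.
Implicit Types (u x y r c : R) (m k : nat).

(** On the unit hemisphere the last coordinate [hcos] is not a polynomial, so a kernel in the cosine
    of the distance is not admissible; expressions even in [hcos] are, since its square is 1 -
    |x|^2. That symmetrisation in the equator differs from [hflip], the map t -> -t, which exchanges
    the two parts and leaves the cosine of the distance unchanged.

    In the lower bound [weight0n] belongs to the maximised quantity because a ball of radius 1/n has
    measure n^-d [weight0n] up to constants, with the same n^-d everywhere. The integral over a
    small ball at the near-maximiser therefore controls the value at z, however far away z is, and
    no localisation at z is required. Between two points [weight0n] changes by at most a constant
    times the power 2 gamma of 1 + n times their distance; this is the only growth the kernel has to
    absorb, so the exponent depends on gamma alone. In the upper bound the exponent is dictated by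
    the doubling constant: each shell must lose more in the kernel than it gains in weight. *)

Lemma ler_cos x y : 0 <= x <= pi -> 0 <= y <= pi -> (cos y <= cos x) = (x <= y).
Proof. by move=> x0 y0; rewrite !leNgt ltr_cos// in_itv. Qed.

Lemma sin2_le1 u : sin u ^+ 2 <= 1.
Proof. by have := cos2Dsin2 u; have := sqr_ge0 (cos u); lra. Qed.

Lemma sin_le_id u : 0 <= u -> sin u <= u.
Proof.
move=> u0.
have [c _] := @MVT_segment R sin cos 0 u u0 (fun x _ => is_derive_sin x)
  (continuous_subspaceT (@continuous_sin R)).
rewrite sin0 !subr0 => ->; rewrite -[leRHS]mul1r.
by rewrite ler_wpM2r// cos_le1.
Qed.

Lemma cos_half u : cos u = 2 * cos (u / 2) ^+ 2 - 1.
Proof.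
rewrite {1}(_ : u = u / 2 + u / 2) ?cosD; last lra.
by have := cos2Dsin2 (u / 2); rewrite !expr2; lra.
Qed.

(** The mean value theorem gives [sin (u / 2) = cos c * (u / 2)] with [cos c >= cos (u / 2)], so
    [sin u >= 2 * cos (u / 2) ^+ 2 * (u / 2)], and [2 * cos (u / 2) ^+ 2 = 1 + cos u >= 1] in the
    first quadrant. *)
Lemma half_le_sin u : 0 <= u <= pi / 2 -> u / 2 <= sin u.
Proof.
move=> /andP[u0 u2]; have pi0 := pi_gt0 R.
have sqrt2 : cos (u / 2) ^+ 2 >= 1 / 2.
  have : 0 <= cos u by apply: cos_ge0_pihalf; lra.
  by rewrite cos_half; lra.
have [c] := @MVT_segment R sin cos 0 (u / 2) ltac:(lra) (fun x _ => is_derive_sin x)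
  (continuous_subspaceT (@continuous_sin R)).
rewrite in_itv/= sin0 !subr0 => /andP[c0 cu] sE.
have cge : cos (u / 2) <= cos c.
  by rewrite ler_cos; lra.
have cu0 : 0 <= cos (u / 2) by apply: cos_ge0_pihalf; lra.
have : sin u = 2 * cos (u / 2) * sin (u / 2).
  by rewrite {1}(_ : u = u / 2 + u / 2) ?sinD; [ring|lra].
rewrite sE => ->.
apply: (@le_trans _ _ (2 * (cos (u / 2) ^+ 2) * (u / 2))).
  by rewrite ler_peMl//; lra.
rewrite [leRHS]mulrA expr2 [2 * (_ * _)]mulrA; apply: ler_wpM2r; first lra.
by apply: ler_wpM2l => //; rewrite mulr_ge0.
Qed.

Lemma one_sub_cosE r : 1 - cos r = 2 * sin (r / 2) ^+ 2.
Proof.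
by rewrite cos_half; have := cos2Dsin2 (r / 2); lra.
Qed.

Lemma one_sub_cos_ge r : 0 <= r <= pi -> r ^+ 2 / 8 <= 1 - cos r.
Proof.
move=> r0; rewrite one_sub_cosE.
have h := @half_le_sin (r / 2) ltac:(lra).
have : (r / 2 / 2) ^+ 2 <= sin (r / 2) ^+ 2.
  by rewrite lerXn2r// nnegrE; lra.
by lra.
Qed.

Lemma one_sub_cos_le r : 1 - cos r <= r ^+ 2 / 2.
Proof.
rewrite one_sub_cosE.
have : sin (r / 2) ^+ 2 <= (r / 2) ^+ 2.
  wlog r0 : r / 0 <= r.
    case: (leP 0 r) => [r0 /(_ r r0)//|r0 /(_ (- r))].
    by rewrite mulNr sinN !sqrrN; apply; lra.
  (* Up to 2 the half-angle is at most 1 <= pi / 2, so its sine is nonnegative and [sin_le_id] may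
     be squared; beyond 2 the right-hand side exceeds 1. *)
  have [rpi|rpi] := leP r 2.
    have := pihalf_ge1 R => pi1.
    rewrite lerXn2r// ?nnegrE; last 2 first.
    - by lra.
    - by apply: sin_le_id; lra.
    by apply: sin_ge0_pi; lra.
  apply: (@le_trans _ _ 1).
    exact: sin2_le1.
  by nra.
by lra.
Qed.

Lemma sin_nat_le k u : `|sin (k%:R * u)| <= k%:R * `|sin u|.
Proof.
elim: k => [|k IH]; first by rewrite !mul0r sin0 normr0.
rewrite -natr1 mulrDl mul1r sinD mulrDl mul1r.
apply: le_trans (ler_normD _ _) _; rewrite !normrM; apply: lerD.
  by rewrite (le_trans _ IH)// ler_piMr// cos_max.
by rewrite ler_piMl// cos_max.
Qed.

(* [dirichlet m] is the Dirichlet kernel written as a polynomial in cos: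
   dirichlet m (cos u) sin (u / 2) = sin ((m + 1/2) u). *)
Fixpoint dirichlet_pair m : {poly R} * {poly R} :=
  if m is k.+1 then
    let: (p, q) := dirichlet_pair k in (q, 2 *: 'X * q - p)
  else (1, 2 *: 'X + 1).

Definition dirichlet m : {poly R} := (dirichlet_pair m).1.

Lemma dirichlet0 : dirichlet 0 = 1. Proof. by []. Qed.

Lemma dirichlet1 : dirichlet 1 = 2 *: 'X + 1. Proof. by []. Qed.

Lemma dirichletS m : dirichlet m.+2 = 2 *: 'X * dirichlet m.+1 - dirichlet m.
Proof. by rewrite /dirichlet/=; case: (dirichlet_pair m). Qed.

(** The induction that fits recurrences of order two: the one of [dirichlet] and, later, Newton's
    recursion for power sums. *)
Lemma dirichlet_ind (P : nat -> Prop) : P 0%N -> P 1%N ->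
  (forall m, P m -> P m.+1 -> P m.+2) -> forall m, P m.
Proof.
move=> P0 P1 PS m; suff [] : P m /\ P m.+1 by [].
by elim: m => // m [Pm Pm1]; split => //; exact: PS.
Qed.

Lemma size_dirichlet m : (size (dirichlet m) <= m.+1)%N.
Proof.
elim/dirichlet_ind: m => [||m IH0 IH1].
- by rewrite dirichlet0 size_poly1.
- rewrite dirichlet1 (leq_trans (size_polyD _ _))// geq_max size_poly1 andbT.
  by rewrite (leq_trans (size_scale_leq _ _))// size_polyX.
rewrite dirichletS (leq_trans (size_polyD _ _))// geq_max size_polyN.
rewrite [X in _ && X](leq_trans IH0) ?andbT; last by rewrite leqW.
rewrite -scalerAl (leq_trans (size_scale_leq _ _))//.
have [->|w0] := eqVneq (dirichlet m.+1) 0; first by rewrite mulr0 size_poly0.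
by rewrite mulrC size_mulX.
Qed.

Lemma dirichlet_horner1 m : (dirichlet m).[1] = 2 * m%:R + 1.
Proof.
elim/dirichlet_ind: m => [||m IH0 IH1].
- by rewrite dirichlet0 hornerE; ring.
- by rewrite dirichlet1 !hornerE.
by rewrite dirichletS !hornerE IH0 IH1 -!natr1; ring.
Qed.

Lemma dirichlet_cos m u :
  (dirichlet m).[cos u] * sin (u / 2) = sin ((2 * m%:R + 1) * (u / 2)).
Proof.
have E : u = u / 2 + u / 2 by lra.
elim/dirichlet_ind: m => [||m IH0 IH1].
- by rewrite dirichlet0 hornerE mulr0 add0r !mul1r.
- rewrite dirichlet1 !hornerE {1}E.
  rewrite [RHS](_ : _ = sin ((u / 2 + u / 2) + u / 2)); last by congr sin; rewrite /=; field.
  by rewrite sinD [cos (u/2+u/2)]cosD [sin (u/2+u/2)]sinD -[X in 2 * _ + X](cos2Dsin2 (u / 2)); ring.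
rewrite dirichletS hornerD hornerN hornerM hornerZ hornerX.
rewrite mulrBl -[_ * (dirichlet m.+1).[_] * _]mulrA IH0 IH1.
have -> : (2 * m.+2%:R + 1) * (u / 2) = (2 * m.+1%:R + 1) * (u / 2) + u.
  by rewrite -!natr1; field.
have -> : (2 * m%:R + 1) * (u / 2) = (2 * m.+1%:R + 1) * (u / 2) - u.
  by rewrite -!natr1; field.
by rewrite sinB [sin (_ + u)]sinD; ring.
Qed.

Definition jackson m : {poly R} := (2 * m%:R + 1)^-1 *: dirichlet m.

Lemma odd_natr_gt0 m : 0 < 2 * m%:R + 1 :> R.
Proof. by have : 0 <= m%:R :> R by []; lra. Qed.

Lemma size_jackson m : (size (jackson m) <= m.+1)%N.
Proof. exact: leq_trans (size_scale_leq _ _) (size_dirichlet m). Qed.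

Lemma jackson1 m : (jackson m).[1] = 1.
Proof. by rewrite hornerZ dirichlet_horner1 mulVf// gt_eqF// odd_natr_gt0. Qed.

(** At c = cos u the kernel is sin (N u / 2) / (N sin (u / 2)) with N = 2 m + 1, which [sin_nat_le]
    bounds; at c = 1 this quotient is 0 / 0 and the value is known directly. *)
Lemma jackson_le1 m c : -1 <= c <= 1 -> (jackson m).[c] ^+ 2 <= 1.
Proof.
move=> c1; have [->|cN1] := eqVneq c 1; first by rewrite jackson1 expr1n.
rewrite -(@acosK _ c) ?in_itv//; set u := acos c.
have u0 : 0 < u by rewrite acos_gt0// lt_neqAle cN1; lra.
have upi : u <= pi by rewrite acos_lepi.
have s0 : 0 < sin (u / 2) by apply: sin_gt0_pi; lra.
rewrite -real_normK ?num_real// expr_le1//.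
have d0 := odd_natr_gt0 m.
rewrite hornerZ normrM gtr0_norm ?invr_gt0// ler_pdivrMl// mulr1.
rewrite -(ler_pM2r s0) -{1}(gtr0_norm s0) -normrM dirichlet_cos.
rewrite (_ : 2 * m%:R + 1 = (2 * m + 1)%:R); last by rewrite natrD natrM.
by have := sin_nat_le (2 * m + 1) (u / 2); rewrite (gtr0_norm s0).
Qed.

(** The factor [1 - c] is twice the squared sine of the half-angle and cancels the denominator of
    the kernel. Keeping it as a product rather than a quotient includes c = 1. *)
Lemma jackson_decay m c : -1 <= c <= 1 ->
  (jackson m).[c] ^+ 2 * ((2 * m%:R + 1) ^+ 2 * (1 - c)) <= 2.
Proof.
move=> c1; rewrite -(@acosK _ c) ?in_itv//; set u := acos c.
rewrite one_sub_cosE hornerZ.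
have E := dirichlet_cos m u.
rewrite [leLHS](_ : _ = 2 * sin ((2 * m%:R + 1) * (u / 2)) ^+ 2); last first.
  have := odd_natr_gt0 m; rewrite -E; move: (2 * m%:R + 1) (dirichlet m).[_] (sin _).
  by move=> n p s n0; field; rewrite gt_eqF.
by rewrite -[leRHS]mulr1 ler_wpM2l// sin2_le1.
Qed.

End trigonometry.

(** * Bernstein's inequality *)

Section trigonometric_polynomials.
Context {R : realType}.
Implicit Types (u x y c phi : R) (m k n : nat) (T S : R -> R).

(* A trigonometric polynomial of degree at most n as a list of harmonics
   (amplitude, frequency, phase). *)
Definition trigpoly n T := exists2 s : seq (R * nat * R),
  all (fun p => p.1.2 <= n)%N s &
  forall u, T u = \sum_(p <- s) p.1.1 * cos (p.1.2%:R * u + p.2).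

Lemma trigpoly_ext n T S : T =1 S -> trigpoly n T -> trigpoly n S.
Proof. by move=> TS [s sn sT]; exists s => // u; rewrite -TS. Qed.

Lemma trigpoly_le m n T : (m <= n)%N -> trigpoly m T -> trigpoly n T.
Proof.
move=> mn [s sm sT]; exists s => //.
by apply/allP => p /(allP sm) /leq_trans; apply.
Qed.

Lemma trigpoly0 n : trigpoly n (fun=> 0).
Proof. by exists [::] => // u; rewrite big_nil. Qed.

Lemma trigpoly_harmonic n c k phi : (k <= n)%N ->
  trigpoly n (fun u => c * cos (k%:R * u + phi)).
Proof.
by move=> kn; exists [:: (c, k, phi)]; rewrite /= ?kn// => u; rewrite big_seq1.
Qed.

Lemma trigpoly_cst n c : trigpoly n (fun=> c).
Proof.
apply: trigpoly_ext (trigpoly_harmonic c 0 (leq0n n)) => u.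
by rewrite mul0r addr0 cos0 mulr1.
Qed.

Lemma trigpolyD n T S :
  trigpoly n T -> trigpoly n S -> trigpoly n (fun u => T u + S u).
Proof.
move=> [s sn sT] [r rn rS]; exists (s ++ r); first by rewrite all_cat sn.
by move=> u; rewrite big_cat sT rS.
Qed.

Lemma trigpoly_sum (I : eqType) (r : seq I) n (T : I -> R -> R) :
  (forall i, i \in r -> trigpoly n (T i)) ->
  trigpoly n (fun u => \sum_(i <- r) T i u).
Proof.
elim: r => [|i r IH] Tn.
  by apply: trigpoly_ext (trigpoly0 n) => u; rewrite big_nil.
apply: (@trigpoly_ext _ (fun u => T i u + \sum_(i <- r) T i u)).
  by move=> u; rewrite big_cons.
apply: trigpolyD; first by apply: Tn; rewrite mem_head.
by apply: IH => j jr; apply: Tn; rewrite inE jr orbT.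
Qed.

Lemma trigpoly_linear n a b : (0 < n)%N ->
  trigpoly n (fun u => a * cos u + b * sin u).
Proof.
move=> n0; apply: trigpolyD.
  apply: trigpoly_ext (trigpoly_harmonic a 0 n0) => u.
  by rewrite mul1r addr0.
apply: trigpoly_ext (trigpoly_harmonic b (- (pi / 2)) n0) => u.
by rewrite mul1r cosBpihalf.
Qed.

Lemma cosMcos x y : cos x * cos y = 2^-1 * cos (x + y) + 2^-1 * cos (x - y).
Proof. by rewrite cosD cosB; field. Qed.

Lemma trigpolyM m n T S :
  trigpoly m T -> trigpoly n S -> trigpoly (m + n) (fun u => T u * S u).
Proof.
move=> [s sm sT] [r rn rS].
apply: (@trigpoly_ext _ (fun u => \sum_(p <- s) \sum_(q <- r)
  (p.1.1 * cos (p.1.2%:R * u + p.2)) * (q.1.1 * cos (q.1.2%:R * u + q.2)))).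
  by move=> u; rewrite sT rS big_distrlr.
apply: trigpoly_sum => p /(allP sm) pm; apply: trigpoly_sum => q /(allP rn) qn.
case: p pm => -[a k] f /= km; case: q qn => -[b l] g /= ln.
apply: (@trigpoly_ext _ (fun u =>
  a * b / 2 * cos ((k + l)%:R * u + (f + g)) +
  a * b / 2 * cos ((k%:R - l%:R) * u + (f - g)))).
  move=> u; rewrite natrD mulrACA cosMcos.
  rewrite (_ : _ + f + _ = (k%:R + l%:R) * u + (f + g)); last by ring.
  by rewrite (_ : _ + f - _ = (k%:R - l%:R) * u + (f - g)); ring.
apply: trigpolyD; first by apply: trigpoly_harmonic; rewrite leq_add.
(* Frequencies are natural numbers, so a negative difference is turned around by the evenness of
   cosine, phase included. *)
have [kl|/ltnW lk] := leqP l k.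
  rewrite -natrB//; apply: trigpoly_harmonic; lia.
apply: (@trigpoly_ext _ (fun u => a * b / 2 * cos ((l - k)%:R * u + (g - f)))).
  by move=> u; rewrite natrB// -[in RHS]cosN; congr (_ * cos _); ring.
by apply: trigpoly_harmonic; lia.
Qed.

Lemma trigpolyX m k T : trigpoly m T -> trigpoly (m * k) (fun u => T u ^+ k).
Proof.
move=> Tm; elim: k => [|k IH].
  by apply: trigpoly_ext (trigpoly_cst _ 1) => u; rewrite expr0.
by rewrite mulnS; apply: trigpoly_ext (trigpolyM Tm IH) => u; rewrite exprS.
Qed.

Lemma trigpoly_horner (p : {poly R}) n : (size p <= n.+1)%N ->
  trigpoly n (fun u => p.[cos u]).
Proof.
move=> pn; apply: (@trigpoly_ext _ (fun u => \sum_(i < n.+1) p`_i * cos u ^+ i)).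
  by move=> u; rewrite (horner_coef_wide _ pn).
apply: trigpoly_sum => i _; have i1 : (i <= n)%N by rewrite -ltnS.
apply: (trigpoly_le i1); rewrite -{1}[nat_of_ord i]add0n.
apply: trigpolyM; first exact: trigpoly_cst.
rewrite -{1}[nat_of_ord i]mul1n; apply: trigpolyX.
by apply: trigpoly_ext (trigpoly_linear 1 0 (ltnSn 0)) => u; rewrite mul1r mul0r addr0.
Qed.


(** Multiplication by 2 sin (m pi / N), nonzero because 0 < m < N, makes the sum telescope; the two
    end terms have arguments that differ by 2 pi m. *)
Lemma sum_cos_roots N m phi : (0 < m < N)%N ->
  \sum_(0 <= j < N) cos (phi + m%:R * (2 * pi * j%:R / N%:R)) = 0.
Proof.
move=> /andP[m0 mN]; have N0 : N%:R != 0 :> R by rewrite pnatr_eq0; lia.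
pose s : R := sin (m%:R * pi / N%:R).
have s0 : 2 * s != 0.
  rewrite mulf_neq0// gt_eqF// sin_gt0_pi// divr_gt0 ?mulr_gt0 ?pi_gt0 ?ltr0n//=; last lia.
  by rewrite ltr_pdivrMr ?ltr0n; [rewrite mulrC ltr_pM2l ?pi_gt0// ltr_nat|lia].
apply: (mulfI s0); rewrite mulr0 big_distrr/=.
pose G j : R := sin (phi + (2 * j%:R - 1) * (m%:R * pi / N%:R)).
rewrite (@telescope_sumr_eq _ 0 N G)//; last first.
  move=> j _; rewrite /G -[j.+1%:R]natr1.
  rewrite (_ : phi + (2 * (j%:R + 1) - 1) * _ =
    (phi + m%:R * (2 * pi * j%:R / N%:R)) + m%:R * pi / N%:R); last by field.
  rewrite (_ : phi + (2 * j%:R - 1) * _ =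
    (phi + m%:R * (2 * pi * j%:R / N%:R)) - m%:R * pi / N%:R); last by field.
  by rewrite sinB sinD -/s; ring.
rewrite /G (_ : phi + (2 * N%:R - 1) * _ =
  phi + (2 * 0%:R - 1) * (m%:R * pi / N%:R) + pi *+ 2 *+ m); last first.
  by rewrite -(mulr_natr (pi *+ 2)) -(mulr_natr pi); field.
by rewrite (periodicn (@sinD2pi R)) subrr.
Qed.

(** The hypotheses say |m - k| < N without subtraction, so N divides the difference only when it is
    zero. *)
Lemma sum_cos_rootsB N m k phi : (m < N + k)%N -> (k < N + m)%N ->
  \sum_(0 <= j < N) cos (phi + (m%:R - k%:R) * (2 * pi * j%:R / N%:R)) =
  if m == k then N%:R * cos phi else 0.
Proof.
move=> mN kN; case: ifPn => [/eqP->|mk].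
  under eq_bigr do rewrite subrr mul0r addr0.
  by rewrite sumr_const_nat subn0 mulr_natl.
have [km|km] := ltnP k m.
  by rewrite -natrB ?(ltnW km)// sum_cos_roots//; lia.
under eq_bigr do rewrite -cosN opprD -mulNr opprB -natrB//.
by rewrite sum_cos_roots//; lia.
Qed.

Lemma sum_sin_rootsB N m k phi : (m < N + k)%N -> (k < N + m)%N ->
  \sum_(0 <= j < N) sin (phi + (m%:R - k%:R) * (2 * pi * j%:R / N%:R)) =
  if m == k then N%:R * sin phi else 0.
Proof.
move=> mN kN; rewrite -[sin phi]cosBpihalf -(sum_cos_rootsB (phi - pi / 2) mN kN).
by apply: eq_bigr => j _; rewrite -cosBpihalf; congr cos; ring.
Qed.

(* n sin(n u) times the Fejer kernel, up to normalisation. *)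
Definition bernstein_kernel n u : R :=
  \sum_(p < n) \sum_(q < n) 2 * sin (((n + p)%:R - q%:R) * u).

Definition fejer n u : R :=
  (\sum_(p < n) cos (p%:R * u)) ^+ 2 + (\sum_(p < n) sin (p%:R * u)) ^+ 2.

Lemma fejerE n u : fejer n u = \sum_(p < n) \sum_(q < n) cos ((p%:R - q%:R) * u).
Proof.
rewrite /fejer !expr2 !big_distrlr -big_split; apply: eq_bigr => p _ /=.
by rewrite -big_split; apply: eq_bigr => q _ /=; rewrite mulrBl cosB.
Qed.

Lemma bernstein_kernelE n u : bernstein_kernel n u = 2 * sin (n%:R * u) * fejer n u.
Proof.
(* Expanding sin (n u + (p - q) u) leaves the Fejer sum times sin (n u) and this sum times cos (n
   u); exchanging p and q shows that the latter is its own opposite. *)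
have antisym : \sum_(p < n) \sum_(q < n) sin ((p%:R - q%:R) * u) = 0.
  set A := LHS; have : A = - A.
    rewrite {1}/A exchange_big -sumrN; apply: eq_bigr => p _ /=.
    by rewrite -sumrN; apply: eq_bigr => q _ /=; rewrite -sinN -mulNr opprB.
  by lra.
rewrite -[RHS]addr0 -[X in _ + X](mulr0 (2 * cos (n%:R * u))) -antisym fejerE.
rewrite !big_distrr -big_split; apply: eq_bigr => p _ /=.
rewrite !big_distrr -big_split; apply: eq_bigr => q _ /=.
rewrite natrD (_ : (_ + _ - _) * u = n%:R * u + (p%:R - q%:R) * u); last by ring.
by rewrite sinD; ring.
Qed.

Lemma fejer_ge0 n u : 0 <= fejer n u.
Proof. by rewrite addr_ge0 ?sqr_ge0. Qed.

(** Only the n diagonal cosines survive the summation, because indices below n <= N differ by less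
    than N. *)
Lemma sum_fejer N n : (n <= N)%N ->
  \sum_(0 <= j < N) fejer n (2 * pi * j%:R / N%:R) = N%:R * n%:R.
Proof.
move=> nN; under eq_bigr do rewrite fejerE; rewrite exchange_big/=.
rewrite (eq_bigr (fun=> N%:R)) ?sumr_const ?card_ord ?mulr_natr// => p _.
have pn := ltn_ord p.
rewrite exchange_big/= (bigD1 p)//= [X in _ + X]big1 ?addr0.
  have E := @sum_cos_rootsB N p p 0 ltac:(lia) ltac:(lia).
  rewrite eqxx cos0 mulr1 in E; rewrite -[RHS]E.
  by apply: eq_bigr => j _; rewrite add0r.
move=> q qp; have qn := ltn_ord q.
have E := @sum_cos_rootsB N p q 0 ltac:(lia) ltac:(lia).
rewrite (_ : (_ == _ :> nat) = false) in E; last first.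
  by apply/negbTE; rewrite (inj_eq val_inj) eq_sym.
by rewrite -[RHS]E; apply: eq_bigr => j _; rewrite add0r.
Qed.

Definition trig_diff (s : seq (R * nat * R)) x : R :=
  \sum_(p <- s) - (p.1.1 * p.1.2%:R * sin (p.1.2%:R * x + p.2)).

(* Convolution with the kernel differentiates trigonometric polynomials of degree
   at most n; quadrature over more than 3n equidistant points is exact for it. *)
Lemma bernstein_formula n s x : let N := (3 * n).+1 in
  all (fun p => p.1.2 <= n)%N s ->
  N%:R * trig_diff s x = \sum_(0 <= j < N)
    (\sum_(p <- s) p.1.1 * cos (p.1.2%:R * (x + 2 * pi * j%:R / N%:R) + p.2)) *
    bernstein_kernel n (2 * pi * j%:R / N%:R).
Proof.
move=> N sn; under eq_bigr do rewrite big_distrl/=.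
rewrite exchange_big/= big_distrr/=; apply: eq_big_seq => p /(allP sn).
case: p => -[a k] f /= kn; rewrite /bernstein_kernel.
under eq_bigr do rewrite -mulrA; rewrite -big_distrr/=.
rewrite -mulrA -mulrN mulrCA; congr (_ * _).
under eq_bigr do rewrite big_distrr/=; rewrite exchange_big/=.
under eq_bigr => p _ do (under eq_bigr do rewrite big_distrr/=; rewrite exchange_big/=).
(* Product-to-sum leaves the frequencies n + p + k - q > 0 and n + p - k - q, both below N = 3 n + 1
   in absolute value; only the second can vanish. *)
have E p q : (p < n)%N -> (q < n)%N ->
  \sum_(0 <= j < N) cos (k%:R * (x + 2 * pi * j%:R / N%:R) + f) *
    (2 * sin (((n + p)%:R - q%:R) * (2 * pi * j%:R / N%:R))) =
  if (q == n + p - k)%N then - (N%:R * sin (k%:R * x + f)) else 0.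
  move=> pn qn; set y := k%:R * x + f.
  transitivity (\sum_(0 <= j < N) sin (y + ((n + p + k)%:R - q%:R) * (2 * pi * j%:R / N%:R))
      + \sum_(0 <= j < N) sin (- y + ((n + p)%:R - (q + k)%:R) * (2 * pi * j%:R / N%:R))).
    rewrite -big_split; apply: eq_bigr => j _ /=.
    move: (2 * pi * j%:R / N%:R) => t.
    rewrite (_ : k%:R * (x + t) + f = y + k%:R * t); last by rewrite /y; ring.
    rewrite (_ : y + ((n + p + k)%:R - _) * t =
      ((n + p)%:R - q%:R) * t + (y + k%:R * t)); last first.
      by rewrite [in LHS]natrD; ring.
    rewrite (_ : - y + (_ - (q + k)%:R) * t =
      ((n + p)%:R - q%:R) * t - (y + k%:R * t)); last first.
      by rewrite [(q + k)%:R]natrD; ring.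
    by rewrite [sin (_ - (_ + _))]sinB [sin (_ + (_ + _))]sinD; ring.
  rewrite !sum_sin_rootsB; try lia.
  rewrite ifF ?add0r; last by lia.
  rewrite (_ : (n + p == q + k)%N = (q == n + p - k)%N); last by lia.
  by case: ifP => // _; rewrite sinN mulrN.
(* The index q = n + p - k is below n exactly when p < k, so k rows contribute: this is the factor k
   that differentiating a harmonic of frequency k produces. *)
rewrite (eq_bigr (fun p : 'I_n => if (p < k)%N then - (N%:R * sin (k%:R * x + f)) else 0)).
  rewrite -big_mkcond/= sumr_const -mulr_natl.
  rewrite (_ : #|_| = k); first by ring.
  rewrite -sum1_card; under eq_bigl do rewrite unfold_in/=.
  by rewrite -(big_ord_widen _ (fun=> 1%N) kn) sum1_card card_ord.
move=> p _; under eq_bigr => q _ do rewrite (E p q (ltn_ord p) (ltn_ord q)).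
rewrite -big_mkcond/=; case: ifPn => pk.
  have h : (n + p - k < n)%N by lia.
  by rewrite (big_pred1 (Ordinal h)).
rewrite big1// => q /eqP qE; have := ltn_ord q; lia.
Qed.

Lemma is_derive_trig s x : is_derive x 1
  (fun u => \sum_(p <- s) p.1.1 * cos (p.1.2%:R * u + p.2)) (trig_diff s x).
Proof.
elim: s => [|p s IH].
  rewrite /trig_diff big_nil; under eq_fun do rewrite big_nil.
  exact: is_derive_cst.
rewrite /trig_diff big_cons -/(trig_diff s x).
under eq_fun do rewrite big_cons.
have D : is_derive x 1 (fun u => p.1.2%:R * u + p.2) p.1.2%:R.
  by apply: is_derive_eq; rewrite addr0 /GRing.scale/= mulr1.
have D2 := is_derive1_comp (is_derive_cos _) D.
by apply: is_derive_eq; rewrite /GRing.scale/=; ring.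
Qed.

(** The kernel is at most twice the Fejer kernel, which is nonnegative and has mean n over the
    nodes; hence the derivative is at most 2 n M, and the mean value theorem gives the Lipschitz
    form. *)
Lemma bernstein n T M : trigpoly n T -> (forall u, `|T u| <= M) ->
  forall x y, `|T x - T y| <= 2 * n%:R * M * `|x - y|.
Proof.
move=> [s sn sT] TM.
have TE : T = fun u => \sum_(p <- s) p.1.1 * cos (p.1.2%:R * u + p.2) by apply/funext.
have dT x : is_derive x 1 T (trig_diff s x) by rewrite TE; exact: is_derive_trig.
have M0 : 0 <= M by apply: le_trans (TM 0).
have dM x : `|trig_diff s x| <= 2 * n%:R * M.
  pose N := (3 * n).+1; have N0 : 0 < N%:R :> R by rewrite ltr0n.
  rewrite -(ler_pM2l N0) -{1}(gtr0_norm N0) -normrM (bernstein_formula x sn).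
  apply: le_trans (ler_norm_sum _ _ _) _.
  apply: (@le_trans _ _ (\sum_(0 <= j < N) M * (2 * fejer n (2 * pi * j%:R / N%:R)))).
    apply: ler_sum => j _; rewrite normrM; apply: ler_pM => //.
      by rewrite -sT.
    rewrite bernstein_kernelE !normrM [`|fejer _ _|]ger0_norm ?fejer_ge0//.
    by rewrite ler_wpM2r ?fejer_ge0// ger0_norm// ler_piMr// sin_max.
  rewrite -!big_distrr/= sum_fejer; last by rewrite /N; lia.
  by rewrite le_eqVlt; apply/orP; left; apply/eqP; ring.
move=> x y; wlog xy : x y / y <= x => [H|].
  case: (leP y x) => [/H//|/ltW/H]; by rewrite distrC [`|y - x|]distrC.
have cT : {within `[y, x], continuous T}.
  by apply: derivable_within_continuous => z _; case: (dT z).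
have [c _ ->] := MVT_segment xy (fun z _ => dT z) cT.
by rewrite normrM ler_wpM2r.
Qed.

End trigonometric_polynomials.

(** * Volumes of spherical caps *)

Section cubes.
Context {R : realType}.
Local Notation RT := (measurableTypeR R).
Implicit Types (n : nat) (a : R).

(** The centre is read with [nth], so that passing to the tail of the tuple merely shifts the index
    when the volume is computed by induction on n. *)
Definition cube n (c : n.-tuple RT) a : set (n.-tuple RT) :=
  [set y | forall i : 'I_n, c`_i - a <= tnth y i <= c`_i + a].

Lemma measurable_cube n (c : n.-tuple RT) a : measurable (cube c a).
Proof.
have -> : cube c a = \bigcap_(i in [set: 'I_n])
    ((fun y : n.-tuple RT => tnth y i : R) @^-1` `[c`_i - a, c`_i + a]).
  apply/seteqP; split => y /= h i; first by move=> _ /=; rewrite in_itv/=.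
  by have := h i Logic.I; rewrite /= in_itv.
apply: fin_bigcap_measurable; first exact: finite_finset.
move=> i _; rewrite -[X in measurable X]setTI.
exact: measurable_coord.
Qed.

Lemma lebesgue_cube n (c : n.-tuple RT) a : 0 <= a ->
  lebesgue_tuple R n (cube c a) = ((2 * a) ^+ n)%:E.
Proof.
move=> a0; elim: n c => [|n IH] c.
  rewrite /= diracE expr0 (_ : _ \in _)// inE => i; by case: i.
rewrite /= /lebesgue_cons /pushforward.
rewrite (_ : _ @^-1` _ = `[c`_0 - a, c`_0 + a] `*` cube [tuple of behead c] a); last first.
  apply/seteqP; split => [[x y] h|[x y] [h1 h2] i].
    split => /=; first by have := h ord0; rewrite /= in_itv/= (tnth_nth 0)/=.
    move=> i; have := h (lift ord0 i).
    by rewrite !(tnth_nth 0)/= nth_behead.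
  case: (unliftP ord0 i) => [j|] ->.
    by have := h2 j; rewrite !(tnth_nth 0)/= nth_behead.
  by move: h1; rewrite (tnth_nth 0) /= in_itv.
rewrite product_measure1E//; last exact: measurable_cube.
rewrite [X in (_ * X)%E]IH [X in (X * _)%E](lebesgue_measure_itv `[c`_0 - a, c`_0 + a])/= lte_fin.
case: ifPn => [_|]; last first.
  rewrite -leNgt => h; have -> : a = 0 by lra.
  by rewrite mulr0 mul0e exprS mul0r.
by rewrite -EFinB -EFinM exprS; congr (_ * _)%:E; ring.
Qed.

End cubes.

(** * Inner product, norm and distance on R^d *)

Section dot_product.
Context {R : realType} {d : nat}.
Local Notation RT := (measurableTypeR R).
Implicit Types (x y z e : d.-tuple RT) (a b : R).

Definition comb a x b y : d.-tuple RT := [tuple a * tnth x i + b * tnth y i | i < d].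

Lemma dotprodC x y : dotprod x y = dotprod y x.
Proof. by apply: eq_bigr => i _; rewrite mulrC. Qed.

Lemma dotprod_comb a x b y z :
  dotprod (comb a x b y) z = a * dotprod x z + b * dotprod y z.
Proof.
rewrite /dotprod !big_distrr -big_split; apply: eq_bigr => i _ /=.
by rewrite tnth_mktuple mulrDl !mulrA.
Qed.

Lemma dotprod_combr a x b y z :
  dotprod z (comb a x b y) = a * dotprod z x + b * dotprod z y.
Proof. by rewrite dotprodC dotprod_comb !(dotprodC z). Qed.

Lemma dotprod_ge0 x : 0 <= dotprod x x.
Proof. by apply: sumr_ge0 => i _; rewrite -expr2 sqr_ge0. Qed.

Lemma enorm_sqr x : enorm x ^+ 2 = dotprod x x.
Proof. by rewrite sqr_sqrtr// dotprod_ge0. Qed.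

Lemma enorm_ge0 x : 0 <= enorm x. Proof. exact: sqrtr_ge0. Qed.

Lemma tnth_sqr_le x i : tnth x i ^+ 2 <= dotprod x x.
Proof.
rewrite /dotprod (bigD1 i)//= -expr2 lerDl sumr_ge0// => j _.
by rewrite -expr2 sqr_ge0.
Qed.

Lemma enorm_eq0 x i : enorm x = 0 -> tnth x i = 0.
Proof.
move=> x0; have := tnth_sqr_le x i; rewrite -enorm_sqr x0 expr0n/= => h.
by apply/eqP; rewrite -sqrf_eq0; apply/eqP/le_anti; rewrite h sqr_ge0.
Qed.

Lemma cauchy_schwarz_sqr x y : dotprod x y ^+ 2 <= dotprod x x * dotprod y y.
Proof.
have [y0|y0] := eqVneq (dotprod y y) 0.
  rewrite (_ : dotprod x y = 0) ?y0 ?expr0n ?mulr0//.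
  apply: big1 => i _; rewrite (@enorm_eq0 y i) ?mulr0//.
  by rewrite /enorm y0 sqrtr0.
have ygt0 : 0 < dotprod y y by rewrite lt_def y0 dotprod_ge0.
have := dotprod_ge0 (comb (dotprod y y) x (- dotprod x y) y).
rewrite dotprod_comb !dotprod_combr (dotprodC y x) => h.
rewrite -(ler_pM2l ygt0) -subr_ge0; apply: le_trans h _.
by rewrite le_eqVlt; apply/orP; left; apply/eqP; ring.
Qed.

Lemma cauchy_schwarz x y : `|dotprod x y| <= enorm x * enorm y.
Proof.
rewrite -ler_sqr ?nnegrE ?mulr_ge0 ?enorm_ge0// real_normK ?num_real//.
by rewrite exprMn !enorm_sqr cauchy_schwarz_sqr.
Qed.

Definition sqdist x y : R := \sum_(i < d) (tnth x i - tnth y i) ^+ 2.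

Lemma sqdistE x y : sqdist x y = enorm x ^+ 2 - 2 * dotprod x y + enorm y ^+ 2.
Proof.
rewrite !enorm_sqr /dotprod big_distrr/= -sumrN -!big_split/=.
by apply: eq_bigr => i _; ring.
Qed.

Lemma sqdist_ge x y i : (tnth x i - tnth y i) ^+ 2 <= sqdist x y.
Proof.
rewrite /sqdist (bigD1 i)//= lerDl sumr_ge0// => j _; exact: sqr_ge0.
Qed.

(** Written as x = |x| e instead of e = x / |x|, so that x = 0 is covered, with the first basis
    vector as e; this is where the dimension must be positive. *)
Lemma unit_vector_exists x : (0 < d)%N ->
  exists2 e, enorm e = 1 & forall i, tnth x i = enorm x * tnth e i.
Proof.
move=> d0; have [x0|x0] := eqVneq (enorm x) 0.
  exists [tuple (i == 0%N :> nat)%:R | i < d].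
    rewrite /enorm (_ : dotprod _ _ = 1) ?sqrtr1// /dotprod.
    rewrite (bigD1 (Ordinal d0))//= big1; first by rewrite tnth_mktuple/= mulr1 addr0.
    move=> i i0; rewrite tnth_mktuple (_ : (_ == _) = false) ?mul0r//.
    by apply/negbTE; apply: contra i0 => /eqP i0; apply/eqP/val_inj.
  by move=> i; rewrite x0 mul0r (enorm_eq0 _ x0).
exists (comb (enorm x)^-1 x 0 x).
  rewrite {1}/enorm dotprod_comb !dotprod_combr !mul0r !addr0 -enorm_sqr.
  by rewrite [X in Num.sqrt X](_ : _ = 1) ?sqrtr1//; field.
by move=> i; rewrite tnth_mktuple mul0r addr0 mulVKf.
Qed.

Lemma measurable_dotprod e : measurable_fun [set: d.-tuple RT] (dotprod ^~ e : _ -> R).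
Proof.
apply: measurable_sum => i; apply: measurable_funM => //; exact: measurable_coord.
Qed.

End dot_product.

(** * Volumes of truncated cones by covering and packing *)

Section caps.
Context {R : realType} {d : nat}.
Local Notation RT := (measurableTypeR R).
Implicit Types (y z e : d.-tuple RT) (r : R).

(* For y <> 0 the second condition says |y / |y| - e| <= r. *)
Definition cap e r : set (d.-tuple RT) :=
  [set y | enorm y <= 1 /\ enorm y - dotprod y e <= r ^+ 2 / 2 * enorm y].

Lemma measurable_cap e r : measurable (cap e r).
Proof.
have -> : cap e r = unit_ball `&`
    ((fun y : d.-tuple RT => enorm y - dotprod y e - r ^+ 2 / 2 * enorm y) @^-1` `]-oo, 0]).
  by apply/seteqP; split => y /=; rewrite in_itv/= subr_le0.
apply: measurableI; first exact: measurable_unit_ball.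
rewrite -[X in measurable X]setTI.
have mN := @measurable_enorm R d.
suff : measurable_fun [set: d.-tuple RT]
    (fun y : d.-tuple RT => enorm y - dotprod y e - r ^+ 2 / 2 * enorm y) by exact.
apply: measurable_funB; last by apply: measurable_funM.
by apply: measurable_funB => //; exact: measurable_dotprod.
Qed.

Definition axis_point e r : d.-tuple RT := [tuple r * tnth e i | i < d].

Lemma sub_cube (c y : d.-tuple RT) r : cube c r y <->
  forall i, `|tnth y i - tnth c i| <= r.
Proof.
split => h i; have := h i; rewrite (tnth_nth 0 c) ler_norml; first lra.
by lra.
Qed.

(** The distance from y to |y| e has square 2 |y| (|y| - <y, e>) <= r^2 |y|^2. Rounding |y| down to
    a multiple j / k costs at most 1 / k more in each coordinate, and |y| <= 1 leaves k + 1 values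
    of j. *)
Lemma lebesgue_cap_le_cubes e r k : enorm e = 1 -> 0 <= r -> (0 < k)%N ->
  (lebesgue_tuple R d (cap e r) <= (k.+1%:R * (2 * (r + k%:R^-1)) ^+ d)%:E)%E.
Proof.
move=> e1 r0 k0; have k0' : 0 < k%:R :> R by rewrite ltr0n.
pose F (j : nat) := cube (axis_point e (j%:R / k%:R)) (r + k%:R^-1).
have mF i : measurable (F i) by exact: measurable_cube.
have sub : cap e r `<=` \big[setU/set0]_(j < k.+1) F j.
  move=> y [y1 yr]; have y0 := enorm_ge0 y.
  pose j := Num.truncn (k%:R * enorm y).
  have /andP[j1 j2] := truncn_itv (mulr_ge0 (ltW k0') y0).
  have jk : (j < k.+1)%N.
    by rewrite ltnS -(ler_nat R) (le_trans j1)// ler_piMr// ltW.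
  rewrite -bigcup_mkord; exists j => //=; apply/sub_cube => i; rewrite tnth_mktuple.
  have : `|tnth y i - enorm y * tnth e i| <= r.
    have h := @sqdist_ge _ _ y (axis_point e (enorm y)) i.
    rewrite tnth_mktuple in h.
    rewrite -ler_sqr ?nnegrE// real_normK ?num_real//; apply: le_trans h _.
    rewrite sqdistE.
    have -> : axis_point e (enorm y) = comb (enorm y) e 0 e.
      by apply: eq_from_tnth => l; rewrite !tnth_mktuple mul0r addr0.
    rewrite !enorm_sqr dotprod_comb !dotprod_combr !mul0r !addr0 -!enorm_sqr e1.
    have h1 := ler_wpM2l y0 yr.
    have h2 : r ^+ 2 * enorm y ^+ 2 <= r ^+ 2 * 1.
      by rewrite ler_wpM2l ?sqr_ge0// expr_le1.
    by lra.
  have ei : `|tnth e i| <= 1.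
    rewrite -(@expr_le1 _ 2)// real_normK ?num_real//.
    by rewrite (le_trans (tnth_sqr_le _ _))// -enorm_sqr e1 expr1n.
  have : `|enorm y * tnth e i - j%:R / k%:R * tnth e i| <= k%:R^-1.
    rewrite -mulrBl normrM -[leRHS]mulr1 ler_pM//.
    have jky : j%:R / k%:R <= enorm y by rewrite ler_pdivrMr// mulrC.
    have : enorm y < j.+1%:R / k%:R by rewrite ltr_pdivlMr// mulrC.
    by rewrite ger0_norm ?subr_ge0// -natr1 mulrDl mul1r; lra.
  move=> h1 h2; have -> : tnth y i - j%:R / k%:R * tnth e i =
    (tnth y i - enorm y * tnth e i) + (enorm y * tnth e i - j%:R / k%:R * tnth e i) by ring.
  by apply: le_trans (ler_normD _ _) _; exact: lerD.
apply: (@le_trans _ _ (lebesgue_tuple R d (\big[setU/set0]_(j < k.+1) F j))).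
  apply: le_measure; rewrite ?inE//; first exact: measurable_cap.
  exact: bigsetU_measurable.
apply: le_trans (Boole_inequality _ _) _; first by move=> i _; exact: mF.
rewrite (eq_bigr (fun=> ((2 * (r + k%:R^-1)) ^+ d)%:E)); last first.
  by move=> i _; apply: lebesgue_cube; rewrite addr_ge0// invr_ge0 ltW.
by rewrite sumEFin sumr_const card_ord (mulr_natl _ k.+1).
Qed.

(** With 1 / k just below r, at most 3 / r cubes of side at most 4 r cover the cap; the number of
    cubes cancels one power of r. *)
Lemma lebesgue_cap_le e r : (0 < d)%N -> enorm e = 1 -> 0 < r -> r <= 1 ->
  (lebesgue_tuple R d (cap e r) <= (3 * 4 ^+ d * r ^+ d.-1)%:E)%E.
Proof.
move=> d0 e1 r0 r1; pose k := (Num.truncn r^-1).+1.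
have k0 : 0 < k%:R :> R by rewrite ltr0n.
have kr : r^-1 < k%:R by exact: truncnS_gt.
have kr2 : k%:R <= r^-1 + 1.
  by rewrite /k -natr1 lerD2r truncn_le invr_ge0 ltW.
apply: le_trans (lebesgue_cap_le_cubes e1 (ltW r0) (ltn0Sn _ : (0 < k)%N)) _.
rewrite lee_fin.
have ik : k%:R^-1 <= r by rewrite invf_ple ?posrE// ltW.
apply: (@le_trans _ _ ((3 / r) * (4 * r) ^+ d)).
  apply: ler_pM => //.
  - by rewrite exprn_ge0// mulr_ge0// addr_ge0 ?invr_ge0// ltW.
  - rewrite -natr1; have : 1 <= r^-1 by rewrite invf_ge1.
    by lra.
  have : 0 <= k%:R^-1 :> R by rewrite invr_ge0 ltW.
  by move=> ?; apply: lerXn2r; rewrite ?nnegrE; lra.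
case: d d0 => // d' _; rewrite exprMn exprSr/= le_eqVlt; apply/orP; left; apply/eqP.
by rewrite exprSr; field; rewrite gt_eqF.
Qed.

(** The half-side r / (8 d) keeps y within Euclidean distance r / 8 of tau e. The range of tau
    leaves room on both sides: |y| stays below 1 and <y, e> stays above 3 / 8. *)
Lemma cube_sub_cap e r tau : enorm e = 1 -> 0 < r -> r <= 1 ->
  1 / 2 <= tau <= 3 / 4 -> (0 < d)%N ->
  cube (axis_point e tau) (r / (8 * d%:R)) `<=` cap e r.
Proof.
move=> e1 r0 r1 t12 d0 y /sub_cube h.
have d0' : 0 < d%:R :> R by rewrite ltr0n.
pose z := comb 1 y (- tau) e.
have zi i : `|tnth z i| <= r / (8 * d%:R).
  by have := h i; rewrite !tnth_mktuple mul1r mulNr.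
have yE : y = comb 1 z tau e.
  by apply: eq_from_tnth => i; rewrite !tnth_mktuple; ring.
clearbody z.
have z2 : dotprod z z <= (r / 8) ^+ 2.
  apply: (@le_trans _ _ (\sum_(i < d) (r / (8 * d%:R)) ^+ 2)).
    apply: ler_sum => i _; rewrite -expr2 -real_normK ?num_real//.
    by rewrite lerXn2r ?nnegrE// mulr_ge0// ?invr_ge0 ?mulr_ge0 ltW.
  rewrite sumr_const card_ord -[leLHS]mulr_natl.
  rewrite [leLHS](_ : _ = (r / 8) ^+ 2 / d%:R); last by field; rewrite gt_eqF.
  by rewrite ler_pdivrMr// ler_peMr ?sqr_ge0// ler1n.
have zn : enorm z <= r / 8 by rewrite -ler_sqr ?nnegrE ?enorm_ge0 ?enorm_sqr//; lra.
have ze : `|dotprod z e| <= r / 8.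
  by rewrite (le_trans (cauchy_schwarz _ _))// e1 mulr1.

have ee : dotprod e e = 1 by rewrite -enorm_sqr e1 expr1n.
have yy : enorm y ^+ 2 = dotprod z z + 2 * tau * dotprod z e + tau ^+ 2.
  rewrite enorm_sqr {1 2}yE dotprod_comb !dotprod_combr ee (dotprodC e z); ring.
have ye : dotprod y e = dotprod z e + tau by rewrite {1}yE dotprod_comb ee; ring.
have zz0 := dotprod_ge0 z.
move: ze; rewrite ler_norml => /andP[ze1 ze2].
have N0 := enorm_ge0 y.
have yeN : dotprod y e <= enorm y.
  by apply: le_trans (ler_norm _) _; rewrite (le_trans (cauchy_schwarz _ _))// e1 mulr1.
have ye38 : 3 / 8 <= dotprod y e by lra.
split.
  rewrite /unit_ball/= -(@expr_le1 _ 2)// yy.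
  have : 2 * tau * dotprod z e <= 2 * tau * (r / 8) by rewrite ler_wpM2l//; lra.
  have : tau ^+ 2 <= (3 / 4) ^+ 2 by rewrite lerXn2r ?nnegrE; lra.
  have : tau * r <= 3 / 4 * 1 by rewrite ler_pM//; lra.
  have : r ^+ 2 <= 1 by rewrite expr_le1//; lra.
  lra.
(* The product is |y|^2 - <y, e>^2 = |z|^2 - <z, e>^2: the component along e drops out, so a
   deviation of size r costs only r^2. *)
have key : (enorm y - dotprod y e) * (enorm y + dotprod y e) <= (r / 8) ^+ 2.
  have := sqr_ge0 (dotprod z e); rewrite -subr_sqr yy ye; nra.
have D0 : 0 <= enorm y - dotprod y e by lra.
have : (enorm y - dotprod y e) * (3 / 4) <= (r / 8) ^+ 2.
  by apply: le_trans key; rewrite ler_wpM2l//; lra.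
have : r ^+ 2 * (3 / 8) <= r ^+ 2 * enorm y by rewrite ler_wpM2l ?sqr_ge0//; lra.
have := sqr_ge0 r; lra.
Qed.

(** If all coordinates were below 1 / d in absolute value, so would be their squares, with sum below
    1. The coordinate found here separates cubes stacked along e. *)
Lemma unit_vector_coord e : enorm e = 1 -> (0 < d)%N ->
  exists i, d%:R^-1 <= `|tnth e i|.
Proof.
move=> e1 d0; apply: contrapT => /forallNP h.
have d0' : 0 < d%:R :> R by rewrite ltr0n.
have : dotprod e e < \sum_(i < d) d%:R^-1.
  apply: ltr_sum; first by apply/hasP; exists (Ordinal d0); rewrite ?mem_index_enum.
  move=> i _; rewrite -expr2 -real_normK ?num_real//.
  have {h} := h i => /negP; rewrite -ltNge => h.
  apply: (@le_lt_trans _ _ (`|tnth e i| * 1)); last by rewrite mulr1.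
  rewrite expr2 ler_wpM2l// (le_trans (ltW h))// invf_le1// ler1n//.
rewrite sumr_const card_ord -[X in _ < X]mulr_natl divff ?gt_eqF//.
by rewrite -enorm_sqr e1 expr1n ltxx.
Qed.

(** About 1 / (2 r) cubes fit at steps of r / 2 along the axis between 1 / 2 and 3 / 4. In the
    coordinate of [unit_vector_coord] their centres differ by at least r / (2 d), twice the side r /
    (4 d), so they are disjoint. *)
Lemma lebesgue_cap_ge e r : (0 < d)%N -> enorm e = 1 -> 0 < r -> r <= 1 ->
  (((2 * (4 * d%:R) ^+ d)^-1 * r ^+ d.-1)%:E <= lebesgue_tuple R d (cap e r))%E.
Proof.
move=> d0 e1 r0 r1; have d0' : 0 < d%:R :> R by rewrite ltr0n.
have [i0 ei0] := unit_vector_coord e1 d0.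
pose k := (Num.truncn (2 * r)^-1).+1.
pose tau (j : nat) := 1 / 2 + j%:R * (r / 2).
have r2 : 0 < 2 * r by rewrite mulr_gt0.
have kr : (2 * r)^-1 < k%:R by exact: truncnS_gt.
have a0 : 0 <= r / (8 * d%:R) by rewrite divr_ge0 ?mulr_ge0// ltW.
pose F (j : nat) := cube (axis_point e (tau j)) (r / (8 * d%:R)).
have mF i : measurable (F i) by exact: measurable_cube.
have mUF : measurable (\big[setU/set0]_(j < k) F j) by exact: bigsetU_measurable.
have tF : trivIset `I_k F.
  apply: (sub_trivIset (@subsetT _ _)); apply: ltn_trivIset => j l lj.
  apply/seteqP; split => // y [/sub_cube/(_ i0) + /sub_cube/(_ i0)].
  rewrite !tnth_mktuple => h1 h2; exfalso.
  have : `|(tau j - tau l) * tnth e i0| <= r / (4 * d%:R).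
    rewrite (_ : (tau j - tau l) * tnth e i0 =
      (tnth y i0 - tau l * tnth e i0) - (tnth y i0 - tau j * tnth e i0)); last by ring.
    apply: le_trans (ler_normB _ _) _; rewrite (_ : r / (4 * _) = r / (8 * d%:R) + r / (8 * d%:R)).
      exact: lerD.
    by field; rewrite gt_eqF.
  apply/negP; rewrite -ltNge normrM.
  have jl : 1 <= j%:R - l%:R :> R by rewrite -natrB 1?ltnW// ler1n subn_gt0.
  apply: (@lt_le_trans _ _ ((r / 2) * d%:R^-1)).
    rewrite invfM mulrA ltr_pM2r ?invr_gt0//; lra.
  apply: ler_pM => //; [lra|].
  by rewrite (le_trans _ (ler_norm _))// /tau; have := ler_wpM2r (ltW r0) jl; lra.
apply: (@le_trans _ _ (lebesgue_tuple R d (\big[setU/set0]_(j < k) F j))); last first.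
  apply: le_measure; rewrite ?inE//; first exact: measurable_cap.
  rewrite -bigcup_mkord => y [j /= jk]; apply: cube_sub_cap => //.
  have j0 : 0 <= j%:R :> R by [].
  have : j%:R <= (2 * r)^-1.
    by apply: le_trans (_ : (Num.truncn (2 * r)^-1)%:R <= _); rewrite ?ler_nat// truncn_le invr_ge0 ltW.
  move/(ler_wpM2r (ltW r0)); rewrite (_ : _^-1 * r = 2^-1); last by field; rewrite gt_eqF.
  by move=> h; rewrite /tau; have := mulr_ge0 j0 (ltW r0); lra.
rewrite measure_semi_additive_ord_I//.
rewrite (eq_bigr (fun=> ((2 * (r / (8 * d%:R))) ^+ d)%:E)); last first.
  by move=> i _; exact: lebesgue_cube.
rewrite sumEFin sumr_const card_ord -[X in (_ <= X%:E)%E](mulr_natl _ k) lee_fin.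
apply: (@le_trans _ _ ((2 * r)^-1 * (2 * (r / (8 * d%:R))) ^+ d)); last first.
  by apply: ler_wpM2r; [rewrite exprn_ge0// mulr_ge0|exact: ltW].
rewrite (_ : 2 * (r / _) = r / (4 * d%:R)); last by field; rewrite gt_eqF.
have rd : r ^+ d = r * r ^+ d.-1 by rewrite -exprS prednK.
have D0 : 0 < (4 * d%:R) ^+ d :> R by rewrite exprn_gt0// mulr_gt0.
rewrite expr_div_n rd le_eqVlt; apply/orP; left; apply/eqP.
by move: ((4 * d%:R) ^+ d) (r ^+ d.-1) D0 => D P D0; field; rewrite !gt_eqF.
Qed.

End caps.

(** * Integration over slices *)

Section slices.
Context {R : realType} {d : nat}.
Local Notation RT := (measurableTypeR R).
Local Notation space := (ambient R d).
Variable rho : R.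
Implicit Types (E : set space) (f : RT -> \bar R).
Local Open Scope ereal_scope.

Lemma slice_measureE E t : slice_measure rho E t =
  (d%:R * Num.sqrt ((t : R) ^+ 2 - rho ^+ 2) ^+ d.-1)%:E *
  lebesgue_tuple R d
    (to_sphere (Num.sqrt ((t : R) ^+ 2 - rho ^+ 2)) @^-1` ysection E t `&` unit_ball).
Proof. by []. Qed.

Lemma lebesgue_unit_ball_fin : lebesgue_tuple R d unit_ball \is a fin_num.
Proof.
rewrite ge0_fin_numE//; pose o : d.-tuple RT := [tuple (0%R : R) | _ < d].
apply: (@le_lt_trans _ _ (lebesgue_tuple R d (cube o 1))).
  apply: le_measure; rewrite ?inE//; first exact: measurable_unit_ball.
    exact: measurable_cube.
  move=> y y1; apply/sub_cube => i; rewrite tnth_mktuple subr0.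
  rewrite -(@expr_le1 _ 2)// real_normK ?num_real// (le_trans (tnth_sqr_le _ _))//.
  by rewrite -enorm_sqr expr_le1// enorm_ge0.
by rewrite lebesgue_cube// ltry.
Qed.

Lemma slice_measure_fin E t : measurable E -> slice_measure rho E t \is a fin_num.
Proof.
move=> mE; rewrite slice_measureE fin_numM// ge0_fin_numE//.
apply: (le_lt_trans (y := lebesgue_tuple R d unit_ball)).
  apply: le_measure; rewrite ?inE//; last exact: measurable_unit_ball.
  apply: measurableI; last exact: measurable_unit_ball.
  rewrite -[X in measurable X]setTI; apply: measurable_to_sphere => //.
  exact: measurable_ysection.
by rewrite -ge0_fin_numE// lebesgue_unit_ball_fin.
Qed.

Lemma slice_measure_snd E (B : set RT) t :
  slice_measure rho (E `&` snd @^-1` B) t = (\1_B t)%:E * slice_measure rho E t.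
Proof.
rewrite indicE; case: (boolP (t \in B)) => tB.
  rewrite mul1e /slice_measure; congr (sphere_measure _ _).
  apply/seteqP; split => x; rewrite /ysection/= !inE; first by case.
  by move=> Ex; split => //; rewrite inE in tB.
rewrite mul0e /slice_measure (_ : ysection _ _ = set0) ?measure0//.
apply/seteqP; split => x //; rewrite /ysection/= inE => -[_] /= tB'.
by rewrite notin_setE in tB.
Qed.

Let H := @height_range R rho.
Let mH : measurable H := measurable_height_range rho.
Let sigma : {measure set space -> \bar R} := @hyperboloid_measure R d rho.

Let measurable_slice E : measurable E -> measurable_fun H (slice_measure rho E).
Proof. by move=> mE; apply: measurable_funTS; exact: measurable_slice_measure. Qed.

Let integral_slice_indic E (B : set RT) : measurable E -> measurable B ->
  \int[sigma]_(z in E) (\1_B (z.2 : RT))%:E =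
  \int[lebesgue_measure]_(t in H) ((\1_B t)%:E * slice_measure rho E t).
Proof.
move=> mE mB; have mS : measurable (snd @^-1` B : set space).
  rewrite -[X in measurable X]setTI; exact: measurable_snd.
rewrite (_ : (fun z : space => _) = fun z => (\1_(snd @^-1` B : set space) z)%:E)//.
rewrite integral_indic//= setIC /hyperboloid_measure.
by apply: eq_integral => t _; exact: slice_measure_snd.
Qed.

Import HBNNSimple.

Let integral_slice_nnsfun E (h : {nnsfun RT >-> R}) : measurable E ->
  \int[sigma]_(z in E) (h z.2)%:E =
  \int[lebesgue_measure]_(t in H) ((h t)%:E * slice_measure rho E t).
Proof.
move=> mE.
under [LHS]eq_integral do rewrite fimfunE -fsumEFin//.
rewrite ge0_integral_fsum//; last 2 first.
  - move=> r; apply/measurable_EFinP; apply: measurable_funM => //.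
    by apply: measurable_funTS; apply: (measurableT_comp _ measurable_snd).
  - by move=> n x _; rewrite EFinM nnfun_muleindic_ge0.
under [RHS]eq_integral.
  move=> t tH; rewrite fimfunE -fsumEFin// muleC ge0_mule_fsumr; last first.
    by move=> r; rewrite EFinM nnfun_muleindic_ge0.
  over.
rewrite ge0_integral_fsum//; last 2 first.
  - move=> r; apply: emeasurable_funM; first exact: measurable_slice.
    by apply/measurable_EFinP; apply: measurable_funM.
  - move=> n x _; rewrite mule_ge0 ?slice_measure_ge0//.
    by rewrite EFinM nnfun_muleindic_ge0.
apply: eq_fsbigr => r _.
(* The sum over values runs formally over all reals; a negative value has an empty fibre. *)
have [r0|r0] := ltP r 0%R.
  have -> : h @^-1` [set r] = set0.
    by apply/seteqP; split => // x /= hx; have : (0 <= h x)%R by []; rewrite hx leNgt r0.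
  rewrite !integral0_eq// => x _; rewrite indicE in_set0 mulr0 ?mule0//.
under [LHS]eq_integral do rewrite EFinM.
rewrite ge0_integralZl//; last first.
  by apply/measurable_EFinP; apply: measurable_funTS; apply: (measurableT_comp _ measurable_snd).
rewrite integral_slice_indic// -ge0_integralZl//.
- by apply: eq_integral => t _; rewrite EFinM [RHS]muleC muleA.
- by apply: emeasurable_funM => //; [apply/measurable_EFinP|exact: measurable_slice].
- by move=> t _; rewrite mule_ge0 ?slice_measure_ge0.
Qed.

(** The measure is defined on sets by integrating slices. For functions of the height this extends
    through indicators, simple functions and monotone convergence; [weight0] is such a function. *)
Lemma integral_slice E f : measurable E ->
  measurable_fun [set: RT] f -> (forall t, 0 <= f t) ->
  \int[sigma]_(z in E) f z.2 =
  \int[lebesgue_measure]_(t in H) (f t * slice_measure rho E t).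
Proof.
move=> mE mf f0; pose f_ := nnsfun_approx measurableT mf.
have mf_ n : measurable_fun E (fun z : space => (f_ n z.2)%:E).
  apply/measurable_EFinP; apply: measurable_funTS.
  exact: (measurableT_comp _ measurable_snd).
transitivity (limn (fun n => \int[sigma]_(z in E) (f_ n z.2)%:E)).
  rewrite -monotone_convergence//=.
  - apply: eq_integral => z zE; apply/esym/cvg_lim => //=.
    exact: cvg_nnsfun_approx.
  - by move=> n z _; rewrite lee_fin.
  - by move=> z _ m n mn; rewrite lee_fin; exact/lefP/nd_nnsfun_approx.
transitivity (limn (fun n =>
    \int[lebesgue_measure]_(t in H) ((f_ n t)%:E * slice_measure rho E t))).
  by apply: congr_lim; apply/funext => n; exact: integral_slice_nnsfun.
rewrite -monotone_convergence//=.
- apply: eq_integral => t _; apply/cvg_lim => //=.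
  apply: cvgeZr; first exact: slice_measure_fin.
  exact: cvg_nnsfun_approx.
- move=> n; apply: emeasurable_funM; last exact: measurable_slice.
  by apply/measurable_EFinP; exact: measurable_funTS.
- by move=> n z _; rewrite mule_ge0 ?lee_fin ?slice_measure_ge0.
- move=> z _ m n mn; rewrite lee_wpmul2r ?slice_measure_ge0// lee_fin.
  exact/lefP/nd_nnsfun_approx.
Qed.

End slices.

(** * Heights, latitudes and the density of the latitude *)

Section height.
Context {R : realType}.
Local Notation RT := (measurableTypeR R).
Local Notation mu := (@lebesgue_measure R).
Variable rho : R.
Hypothesis rho0 : 0 <= rho.
Implicit Types (t a b : R).

Definition hrad t : R := Num.sqrt (t ^+ 2 - rho ^+ 2).

Definition hcos t : R := Num.sqrt (1 + rho ^+ 2 - t ^+ 2).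

(* The latitude on the unit hemisphere, measured from the pole, of the points
   at height t. *)
Definition hangle t : R := acos (hcos t).

Definition height a : R := Num.sqrt (rho ^+ 2 + sin a ^+ 2).

(** The derivative of [hangle] at positive heights strictly inside the range, extended evenly:
    integrating against it measures latitude. *)
Definition hdensity t : R := `|t| / (hrad t * hcos t).

Lemma hcos_height a : 0 <= a <= pi / 2 -> hcos (height a) = cos a.
Proof.
move=> a0; have pi0 := pi_gt0 R.
rewrite /hcos /height sqr_sqrtr ?addr_ge0 ?sqr_ge0//.
rewrite (_ : _ - _ = cos a ^+ 2); last by have := cos2Dsin2 a; lra.
by rewrite sqrtr_sqr ger0_norm// cos_ge0_pihalf//; lra.
Qed.

Lemma hangle_height a : 0 <= a <= pi / 2 -> hangle (height a) = a.
Proof.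
move=> a0; have pi0 := pi_gt0 R.
by rewrite /hangle hcos_height// cosK// in_itv/=; lra.
Qed.

Lemma height_ge0 a : 0 <= height a. Proof. exact: sqrtr_ge0. Qed.

Lemma height_lt a b : 0 <= a -> a < b -> b <= pi / 2 -> height a < height b.
Proof.
move=> a0 ab b2; have pi0 := pi_gt0 R.
rewrite /height ltr_sqrt; last first.
  by rewrite ltr_wpDl ?sqr_ge0// exprn_gt0// sin_gt0_pi//; lra.
rewrite ltrD2l ltrXn2r// ?nnegrE ?sin_ge0_pi//; try lra.
by rewrite ltr_sin// in_itv/=; lra.
Qed.

Lemma height0 : height 0 = rho.
Proof. by rewrite /height sin0 expr0n addr0 sqrtr_sqr ger0_norm. Qed.

Lemma height_pihalf : height (pi / 2) = Num.sqrt (rho ^+ 2 + 1).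
Proof. by rewrite /height sin_pihalf expr1n. Qed.

Lemma hrad_gt0 t : rho < t -> 0 < hrad t.
Proof. by move=> h; have r0 := rho0; rewrite sqrtr_gt0 subr_gt0 ltrXn2r ?nnegrE//; lra. Qed.

Lemma hcos_gt0 t : 0 <= t -> t < Num.sqrt (rho ^+ 2 + 1) -> 0 < hcos t.
Proof.
move=> t0 h; rewrite sqrtr_gt0 subr_gt0 addrC -[ltRHS]sqr_sqrtr ?addr_ge0 ?sqr_ge0//.
by rewrite ltrXn2r ?nnegrE ?sqrtr_ge0.
Qed.

Lemma is_derive_hangle t : rho < t -> t < Num.sqrt (rho ^+ 2 + 1) ->
  is_derive t 1 hangle (hdensity t).
Proof.
move=> h1 h2; have r0 := rho0; have t0 : 0 < t by lra.
have s0 := hrad_gt0 h1; have v0 := hcos_gt0 (ltW t0) h2.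
have s2 : hrad t ^+ 2 = t ^+ 2 - rho ^+ 2.
  by rewrite sqr_sqrtr// subr_ge0 lerXn2r ?nnegrE//; lra.
have v2p : 0 < 1 + rho ^+ 2 - t ^+ 2 by rewrite -sqrtr_gt0.
have v2 : hcos t ^+ 2 = 1 + rho ^+ 2 - t ^+ 2 by rewrite sqr_sqrtr// ltW.
have D1 : is_derive t 1 (fun u : R => 1 + rho ^+ 2 - u ^+ 2) (- (2 * t)).
  by apply: is_derive_eq; rewrite /GRing.scale/=; ring.
have D2 : is_derive t 1 hcos ((2 * hcos t)^-1 * - (2 * t)).
  rewrite (_ : hcos = Num.sqrt \o (fun u : R => 1 + rho ^+ 2 - u ^+ 2))//.
  by apply: is_derive1_comp; exact: is_derive1_sqrt.
have v1 : -1 < hcos t < 1.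
  apply/andP; split; first lra.
  rewrite -(@expr_lt1 _ 2)// ?v2 ?ltW//; have : 0 < hrad t ^+ 2 by rewrite exprn_gt0.
  by rewrite s2; lra.
have D3 := @is_derive1_comp _ _ hcos _ _ _ (is_derive1_acos v1) D2.
apply: (is_derive_eq D3); rewrite /hdensity gtr0_norm//.
rewrite (_ : Num.sqrt (1 - _) = hrad t); last first.
  by congr Num.sqrt; rewrite v2; ring.
by field; rewrite !gt_eqF.
Qed.

Lemma continuous_hdensity t : rho < t -> t < Num.sqrt (rho ^+ 2 + 1) ->
  {for t, continuous hdensity}.
Proof.
move=> h1 h2; have r0 := rho0; have t0 : 0 < t by lra.
have s0 := hrad_gt0 h1; have v0 := hcos_gt0 (ltW t0) h2.
have cs : {for t, continuous hrad}.
  apply: continuous_comp; last exact: sqrt_continuous.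
  by apply: continuousB; [exact: exprn_continuous|exact: cst_continuous].
have cv : {for t, continuous hcos}.
  apply: continuous_comp; last exact: sqrt_continuous.
  by apply: continuousB; [exact: cst_continuous|exact: exprn_continuous].
apply: continuousM; first exact: norm_continuous.
by apply: continuousV; [rewrite mulf_neq0// gt_eqF|exact: continuousM].
Qed.

Lemma integral_hdensity a b : 0 < a -> a < b -> b < pi / 2 ->
  (\int[mu]_(t in `[height a, height b]) (hdensity t)%:E = (b - a)%:E)%E.
Proof.
move=> a0 ab b2.
have ha : rho < height a by rewrite -[ltLHS]height0; apply: height_lt; lra.
have hb : height b < Num.sqrt (rho ^+ 2 + 1).
  by rewrite -height_pihalf; apply: height_lt; lra.
have hab : height a < height b by apply: height_lt; lra.
have D t : height a <= t <= height b -> is_derive t 1 hangle (hdensity t).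
  by move=> tab; apply: is_derive_hangle; lra.
rewrite (@continuous_FTC2 _ hdensity hangle _ _ hab).
- by rewrite !hangle_height//; lra.
- apply: continuous_in_subspaceT => t; rewrite inE/= in_itv/= => tab.
  by apply: continuous_hdensity; lra.
- split.
  + by move=> t; rewrite in_itv/= => tab; case: (D t ltac:(lra)).
  + apply: cvg_at_right_filter; apply: differentiable_continuous.
    by apply/derivable1_diffP; case: (D (height a) ltac:(lra)).
  + apply: cvg_at_left_filter; apply: differentiable_continuous.
    by apply/derivable1_diffP; case: (D (height b) ltac:(lra)).
- move=> t; rewrite in_itv/= => tab; rewrite derive1E.
  by apply: derive_val; apply: D; lra.
Qed.

Lemma hcos_itv t : rho <= `|t| -> 0 <= hcos t <= 1.
Proof.
move=> tr; have r0 := rho0; rewrite sqrtr_ge0/= -sqrtr1 ler_wsqrtr//.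
rewrite -[t ^+ 2]real_normK ?num_real//.
have : rho ^+ 2 <= `|t| ^+ 2 by rewrite lerXn2r ?nnegrE.
by lra.
Qed.

Lemma sin_hangle t : rho <= `|t| <= Num.sqrt (rho ^+ 2 + 1) ->
  sin (hangle t) = hrad t.
Proof.
move=> /andP[t1 t2]; have v01 := hcos_itv t1.
rewrite /hangle sin_acos; last lra.
congr Num.sqrt; rewrite sqr_sqrtr; first ring.
rewrite -[t ^+ 2]real_normK ?num_real// subr_ge0 addrC -[leRHS]sqr_sqrtr ?addr_ge0 ?sqr_ge0//.
by rewrite lerXn2r ?nnegrE ?sqrtr_ge0.
Qed.

Lemma cos_hangle t : rho <= `|t| -> cos (hangle t) = hcos t.
Proof. by move=> t1; rewrite acosK// in_itv/=; have := hcos_itv t1; lra. Qed.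

Lemma hangle_itv t : rho <= `|t| -> 0 <= hangle t <= pi / 2.
Proof.
move=> t1; have v01 := hcos_itv t1; have pi0 := pi_gt0 R.
rewrite acos_ge0/=; last lra.
rewrite leNgt; apply/negP => h.
have h2 : hangle t <= pi by apply: acos_lepi; lra.
have : cos (hangle t) < cos (pi / 2) by rewrite ltr_cos ?in_itv/=; lra.
by rewrite cos_pihalf cos_hangle//; lra.
Qed.

Lemma height_hangle t : rho <= `|t| <= Num.sqrt (rho ^+ 2 + 1) ->
  height (hangle t) = `|t|.
Proof.
move=> t1; have r0 := rho0; rewrite /height sin_hangle// sqr_sqrtr.
  by rewrite addrC subrK sqrtr_sqr.
by rewrite subr_ge0 -[t ^+ 2]real_normK ?num_real// lerXn2r ?nnegrE//; case/andP: t1.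
Qed.

Lemma height_le a b : 0 <= a -> a <= b -> b <= pi / 2 -> height a <= height b.
Proof.
by move=> a0; rewrite le_eqVlt => /orP[/eqP->//|ab b2]; exact/ltW/height_lt.
Qed.

Lemma measurable_hrad : measurable_fun [set: RT] hrad.
Proof.
apply: (@measurableT_comp _ _ _ _ _ _ (@Num.sqrt R)).
  exact: (continuous_measurable_fun (@sqrt_continuous R)).
by apply: measurable_funB => //; exact: measurable_funX.
Qed.

Lemma measurable_hcos : measurable_fun [set: RT] hcos.
Proof.
apply: (@measurableT_comp _ _ _ _ _ _ (@Num.sqrt R)).
  exact: (continuous_measurable_fun (@sqrt_continuous R)).
by apply: measurable_funB => //; exact: measurable_funX.
Qed.

Lemma measurable_hdensity : measurable_fun [set: RT] hdensity.
Proof.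
rewrite (_ : hdensity = fun t => `|t| * (hrad t * hcos t) `^ (-1)).
  apply: measurable_funM; first exact: (@normr_measurable R setT).
  apply: (@measurableT_comp _ _ _ _ _ _ (@powR R ^~ (-1))).
    exact: measurable_powR.
  by apply: measurable_funM; [exact: measurable_hrad|exact: measurable_hcos].
by apply/funext => t; rewrite powR_inv1// mulr_ge0 ?sqrtr_ge0.
Qed.

Lemma hdensity_ge0 t : 0 <= hdensity t.
Proof. by rewrite divr_ge0// mulr_ge0 ?sqrtr_ge0. Qed.

(** The density may be singular at the ends of the range, where the latitude is 0 or pi / 2. The
    open interval is therefore exhausted by closed ones on which [integral_hdensity] applies, and
    monotone convergence passes to the limit. *)
Lemma integral_hdensity_le a b : 0 <= a -> a < b -> b <= pi / 2 ->
  (\int[mu]_(t in `]height a, height b[) (hdensity t)%:E <= (b - a)%:E)%E.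
Proof.
move=> a0 ab b2; have pi0 := pi_gt0 R.
(* The shift by 3 makes e i strictly smaller than (b - a) / 2 already for i = 0, so every closed
   interval is nondegenerate. *)
pose e (i : nat) := (b - a) / i.+3%:R.
have e0 i : 0 < e i by rewrite divr_gt0 ?subr_gt0.
have e2 i : a + e i < b - e i.
  suff : e i < (b - a) / 2 by lra.
  by rewrite ltr_pM2l ?subr_gt0// ltf_pV2 ?posrE// ltr_nat.
have em i j : (i <= j)%N -> e j <= e i.
  by move=> ij; rewrite ler_pM2l ?subr_gt0// lef_pV2 ?posrE// ler_nat.
pose F i : set RT := `[height (a + e i), height (b - e i)]%classic.
have FE : `]height a, height b[%classic = \bigcup_i F i.
  apply/seteqP; split => t /=; last first.
    move=> [i _]; rewrite /F /= !in_itv/= => /andP[t1 t2]; have := e0 i; have := e2 i.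
    move=> ? ?; rewrite (lt_le_trans _ t1)/= ?(le_lt_trans t2)//; apply: height_lt; lra.
  rewrite in_itv/= => /andP[t1 t2].
  have t0 : 0 <= t by rewrite (le_trans (height_ge0 a))// ltW.
  have tH : rho <= `|t| <= Num.sqrt (rho ^+ 2 + 1).
    have := @height_le 0 a ltac:(lra) ltac:(lra) ltac:(lra).
    have := @height_le b (pi / 2) ltac:(lra) ltac:(lra) ltac:(lra).
    by rewrite ger0_norm// height0 height_pihalf; lra.
  have /andP[tH1 tH2] := tH; have := hangle_itv tH1 => tpi.
  have tE : t = height (hangle t) by rewrite height_hangle// ger0_norm.
  have at1 : a < hangle t.
    by rewrite ltNge; apply/negP => h; move: t1; rewrite ltNge tE height_le//; lra.
  have at2 : hangle t < b.
    by rewrite ltNge; apply/negP => h; move: t2; rewrite ltNge tE height_le//; lra.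
  pose m := Num.min (hangle t - a) (b - hangle t).
  have m0 : 0 < m by rewrite lt_min; apply/andP; split; lra.
  pose i := Num.truncn ((b - a) / m).
  have em' : e i <= m.
    rewrite /e ler_pdivrMr// mulrC -ler_pdivrMr//.
    by apply: le_trans (ltW (truncnS_gt _)) _; rewrite ler_nat !ltnS !leqW.
  have [ma mb] : m <= hangle t - a /\ m <= b - hangle t.
    by rewrite /m !ge_min !lexx ?orbT.
  exists i => //; rewrite /F/= in_itv/= tE; have := e0 i => ei0.
  by apply/andP; split; apply: height_le; lra.
rewrite FE.
have ndF : {homo F : n m / (n <= m)%N >-> (n <= m)%O}.
  move=> i j ij; apply/subsetPset => t; rewrite /F/= !in_itv/= => /andP[t1 t2].
  have := em i j ij; have := e0 j; have := e2 i => ? ? ?.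
  by apply/andP; split; [apply: le_trans t1|apply: le_trans t2 _]; apply: height_le; lra.
have mF i : measurable (F i) by exact: measurable_itv.
have mh i : measurable_fun (F i) (EFin \o hdensity).
  by apply/measurable_EFinP; apply: measurable_funTS; exact: measurable_hdensity.
have h0 i t : F i t -> (0 <= (EFin \o hdensity) t)%E.
  by move=> _; rewrite lee_fin hdensity_ge0.
have C := ge0_nondecreasing_set_cvg_integral (mu := mu) ndF mF mh h0.
rewrite -(cvg_lim _ C)//; apply: lime_le; first by apply/cvg_ex; eexists; exact: C.
near=> i; have := e0 i; have := e2 i => ? ?.
by rewrite integral_hdensity ?lee_fin; lra.
Unshelve. all: by end_near. Qed.

End height.

(** * Geometry of balls *)

Section hyperboloid_geometry.
Context {R : realType} {d : nat}.
Local Notation RT := (measurableTypeR R).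
Local Notation space := (ambient R d).
Variable rho : R.
Hypothesis rho0 : 0 <= rho.
Implicit Types (z : space) (t r : R).

Definition harg z z' : R :=
  dotprod z.1 z'.1 + hcos rho z.2 * hcos rho z'.2.

Lemma hdistE z z' : hdist rho z z' = acos (harg z z'). Proof. by []. Qed.

Definition hflip z : space := (z.1, - (z.2 : R)).

Lemma hcosN t : hcos rho (- t) = hcos rho t.
Proof. by rewrite /hcos sqrrN. Qed.

Lemma hradN t : hrad rho (- t) = hrad rho t.
Proof. by rewrite /hrad sqrrN. Qed.

Lemma hyperboloid_hflip z : hyperboloid rho (hflip z) <-> hyperboloid rho z.
Proof. by rewrite /hyperboloid/= sqrrN normrN. Qed.

Lemma harg_hflipl z z' : harg (hflip z) z' = harg z z'.
Proof. by rewrite /harg/= hcosN. Qed.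

Lemma harg_hflipr z z' : harg z (hflip z') = harg z z'.
Proof. by rewrite /harg/= hcosN. Qed.

Lemma hball_hflip z r : hflip @^-1` (hball rho (hflip z) r) = hball rho z r.
Proof.
have H z' : hball rho (hflip z) r (hflip z') <-> hball rho z r z'.
  have S : same_part (hflip z) (hflip z') <-> same_part z z'.
    by rewrite /same_part/= !oppr_ge0 !oppr_le0; tauto.
  rewrite /hball /mkset !hdistE harg_hflipl harg_hflipr.
  by split => -[/hyperboloid_hflip ? /S].
by apply/seteqP; split => z' /H.
Qed.

Lemma hrad_hcos t : rho <= `|t| <= Num.sqrt (rho ^+ 2 + 1) ->
  hrad rho t ^+ 2 + hcos rho t ^+ 2 = 1.
Proof.
move=> tr; rewrite -(sin_hangle rho0 tr) -cos_hangle//; last by case/andP: tr.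
by rewrite addrC cos2Dsin2.
Qed.

Lemma enorm_hyperboloid z : hyperboloid rho z -> enorm z.1 = hrad rho z.2.
Proof. by move=> [h _]; rewrite /hrad -h sqrtr_sqr ger0_norm// enorm_ge0. Qed.

Lemma cos_hangleB t t' : rho <= `|t| <= Num.sqrt (rho ^+ 2 + 1) ->
  rho <= `|t'| <= Num.sqrt (rho ^+ 2 + 1) ->
  cos (hangle rho t - hangle rho t') =
  hrad rho t * hrad rho t' + hcos rho t * hcos rho t'.
Proof.
move=> tr tr'; rewrite cosB !sin_hangle// !cos_hangle//; first by rewrite addrC.
- by case/andP: tr'.
- by case/andP: tr.
Qed.

(** Cauchy-Schwarz in x: at given heights the cosine is largest when both points lie on one
    meridian, where the distance is the difference of latitudes. *)
Lemma harg_le_cos z z' : hyperboloid rho z -> hyperboloid rho z' ->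
  `|harg z z'| <= cos (hangle rho z.2 - hangle rho z'.2).
Proof.
move=> zh zh'; rewrite cos_hangleB; [|by case: zh|by case: zh'].
apply: le_trans (ler_normD _ _) _; rewrite lerD//.
  by rewrite -!enorm_hyperboloid//; exact: cauchy_schwarz.
by rewrite ger0_norm// mulr_ge0// sqrtr_ge0.
Qed.

Lemma harg_itv z z' : hyperboloid rho z -> hyperboloid rho z' ->
  -1 <= harg z z' <= 1.
Proof.
move=> zh zh'; rewrite -ler_norml (le_trans (harg_le_cos zh zh'))// cos_le1//.
Qed.

Lemma harg_self z : hyperboloid rho z -> harg z z = 1.
Proof.
move=> zh; rewrite /harg -enorm_sqr -expr2 enorm_hyperboloid// hrad_hcos//.
by case: zh.
Qed.

Lemma hdist_itv z z' : hyperboloid rho z -> hyperboloid rho z' ->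
  0 <= hdist rho z z' <= pi.
Proof.
by move=> zh zh'; rewrite hdistE acos_ge0 ?acos_lepi// harg_itv.
Qed.

Lemma cos_hdist z z' : hyperboloid rho z -> hyperboloid rho z' ->
  cos (hdist rho z z') = harg z z'.
Proof. by move=> zh zh'; rewrite hdistE acosK// in_itv/= harg_itv. Qed.

Lemma hdist_leE z z' r : hyperboloid rho z -> hyperboloid rho z' ->
  0 <= r <= pi -> (hdist rho z z' <= r) = (cos r <= harg z z').
Proof.
move=> zh zh' r0; rewrite -cos_hdist// ler_cos//; exact: hdist_itv.
Qed.

Lemma measurable_harg z : measurable_fun [set: space] (harg z : space -> R).
Proof.
apply: measurable_funD.
  rewrite (_ : (fun z' : space => _) = (dotprod ^~ z.1 \o fst)); last first.
    by apply/funext => z' /=; rewrite dotprodC.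
  by apply: measurableT_comp measurable_fst; exact: measurable_dotprod.
apply: measurable_funM => //.
by apply: measurableT_comp measurable_snd; exact: measurable_hcos.
Qed.

Lemma measurable_hyperboloid : measurable (hyperboloid rho : set space).
Proof.
have -> : (hyperboloid rho : set space) =
    (fun z => enorm z.1 ^+ 2 - ((z.2 : R) ^+ 2 - rho ^+ 2)) @^-1` [set 0] `&`
    (snd : space -> RT) @^-1` (height_range rho).
  apply/seteqP; split => z /=; rewrite /hyperboloid /height_range/=.
    by move=> [-> ?]; rewrite subrr.
  by move=> [/eqP]; rewrite subr_eq0 => /eqP.
apply: measurableI.
  rewrite -[X in measurable X]setTI.
  suff : measurable_fun [set: space] (fun z : space =>
      enorm z.1 ^+ 2 - ((z.2 : R) ^+ 2 - rho ^+ 2) : R) by apply.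
  apply: measurable_funB.
    apply: measurable_funX; apply: measurableT_comp measurable_fst.
    exact: measurable_enorm.
  by apply: measurable_funB => //; apply: measurable_funX; exact: measurable_snd.
rewrite -[X in measurable X]setTI; apply: measurable_snd => //.
exact: measurable_height_range.
Qed.

Lemma measurable_same_part z : measurable (same_part z : set space).
Proof.
have m2 : measurable_fun [set: space] (snd : space -> R) by exact: measurable_snd.
have -> : (same_part z : set space) =
    ([set _ | 0 <= (z.2 : R)] `&` (snd : space -> R) @^-1` `[0, +oo[) `|`
    ([set _ | (z.2 : R) <= 0] `&` (snd : space -> R) @^-1` `]-oo, 0]).
  by apply/seteqP; split => z'; rewrite /same_part/= !in_itv/= !andbT.
have mc (P : Prop) : measurable ([set _ : space | P]).
  have [p|p] := pselect P.
    by rewrite (_ : [set _ | P] = setT)//; apply/seteqP; split.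
  by rewrite (_ : [set _ | P] = set0)//; apply/seteqP; split.
apply: measurableU; apply: measurableI => //; rewrite -[X in measurable X]setTI; exact: m2.
Qed.

Lemma measurable_hball z r : hyperboloid rho z -> measurable (hball rho z r).
Proof.
move=> zh.
have [r0|r0] := ltP r 0.
  rewrite (_ : hball rho z r = set0)//; apply/seteqP; split => // z' [zh' _].
  by have /andP[? _] := hdist_itv zh zh'; lra.
(* Cosine is decreasing only up to pi; cutting the radius there changes nothing, because no distance
   exceeds pi. *)
have -> : hball rho z r = hyperboloid rho `&` same_part z `&`
    harg z @^-1` `[cos (Num.min r pi), +oo[.
  apply/seteqP; split => z' /=; rewrite in_itv/= andbT.
    move=> [zh' zz' zr]; split => //; rewrite -hdist_leE//.
      by have := hdist_itv zh zh'; rewrite le_min zr => /andP[].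
    by rewrite le_min r0 pi_ge0 ge_min lexx orbT.
  move=> [[zh' zz']]; rewrite -hdist_leE//.
    by rewrite le_min => /andP[].
  by rewrite le_min r0 pi_ge0 ge_min lexx orbT.
apply: measurableI.
  by apply: measurableI; [exact: measurable_hyperboloid|exact: measurable_same_part].
by rewrite -[X in measurable X]setTI; exact: measurable_harg.
Qed.

End hyperboloid_geometry.

(** * Invariance under the reflection of the height *)

Section reflection.
Context {R : realType} {d : nat}.
Local Notation RT := (measurableTypeR R).
Local Notation space := (ambient R d).
Variable rho : R.
Implicit Types (z : space) (w : space -> R) (t r : R) (A : set space).
Local Open Scope ereal_scope.

Lemma measurable_hflip : measurable_fun [set: space] (@hflip R d).
Proof.
apply: measurable_fun_pair; first exact: measurable_fst.
by apply: measurableT_comp measurable_snd; exact: oppr_measurable.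
Qed.

Lemma slice_measure_hflip A t :
  slice_measure rho (@hflip R d @^-1` A) t = slice_measure rho A (- t)%R.
Proof.
by rewrite !slice_measureE sqrrN; congr (_ * lebesgue_tuple R d (_ @^-1` _ `&` _)).
Qed.

Lemma integral_oppr (f : RT -> \bar R) (D : set RT) :
  measurable D -> measurable_fun D f -> (forall t, D t -> 0 <= f t) ->
  \int[lebesgue_measure]_(t in D) f t =
  \int[lebesgue_measure]_(t in -%R @^-1` D) f (- t)%R.
Proof.
move=> mD mf f0.
rewrite -(@ge0_integral_pushforward _ _ RT RT R -%R)//=; last first.
  by move=> t /set_mem; exact: f0.
by apply: eq_measure_integral => //= A mA AS; exact/esym/lebesgue_measureN.
Qed.

Lemma hyperboloid_measure_hflip A : measurable A ->
  hyperboloid_measure rho (@hflip R d @^-1` A) = hyperboloid_measure rho A.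
Proof.
move=> mA; rewrite /hyperboloid_measure.
under eq_integral do rewrite slice_measure_hflip.
rewrite [RHS]integral_oppr.
- congr (integral _ _ _); apply/seteqP; split => t; rewrite /height_range/= normrN//.
- exact: measurable_height_range.
- by apply: measurable_funTS; exact: measurable_slice_measure.
- by move=> t _; exact: slice_measure_ge0.
Qed.

(** The measure and the family of balls are invariant under t -> -t. This reduces ball estimates to
    centres of nonnegative height and identifies the two balls that occur in the upper bound. *)
Lemma weighted_hflip w z r : (0 <= rho)%R -> hyperboloid rho z ->
  measurable_fun (hyperboloid rho) w -> (forall z, hyperboloid rho z -> (0 <= w z)%R) ->
  (forall z, hyperboloid rho z -> w (hflip z) = w z) ->
  weighted rho w (hball rho (hflip z) r) = weighted rho w (hball rho z r).
Proof.
move=> rho0 zh mw w0 wE; rewrite /weighted.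
have zh' : hyperboloid rho (hflip z) by exact/hyperboloid_hflip.
pose sigma : {measure set space -> \bar R} := @hyperboloid_measure R d rho.
have sub z' : hball rho z' r `<=` hyperboloid rho by move=> y [].
transitivity (\int[pushforward sigma (@hflip R d)]_(y in hball rho (hflip z) r) (w y)%:E).
  apply: eq_measure_integral; first exact: measurable_hflip.
  by move=> mf A mA _; exact/esym/hyperboloid_measure_hflip.
rewrite (ge0_integral_pushforward measurable_hflip)//.
- rewrite hball_hflip; apply: eq_integral => y /set_mem/sub yh /=.
  by rewrite wE.
- exact: measurable_hball.
- apply/measurable_EFinP; apply: measurable_funS mw => //; exact: measurable_hyperboloid.
- by move=> y /set_mem/sub/w0; rewrite lee_fin.
Qed.

End reflection.

(** * Sections of a ball at a fixed height *)

Section ball_slices.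
Context {R : realType} {d : nat}.
Local Notation RT := (measurableTypeR R).
Local Notation space := (ambient R d).
Variable rho : R.
Hypothesis rho0 : 0 <= rho.
Hypothesis d0 : (0 < d)%N.
Implicit Types (z : space) (t r delta gamma : R) (e y : d.-tuple RT).

(** The second term serves radii up to 1. The first serves larger ones: a cap of radius 2 is the
    whole unit ball and is covered by 2 cubes of side 6. *)
Definition cap_const : R := 2 * 6 ^+ d + 3 * 4 ^+ d.

Lemma lebesgue_cap_le_all e r : enorm e = 1 -> 0 < r ->
  (lebesgue_tuple R d (cap e r) <= (cap_const * r ^+ d.-1)%:E)%E.
Proof.
move=> e1 r0; have [r1|r1] := leP r 1.
  apply: le_trans (lebesgue_cap_le d0 e1 r0 r1) _.
  rewrite lee_fin; apply: ler_wpM2r; first by rewrite exprn_ge0// ltW.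
  by rewrite lerDr mulr_ge0// exprn_ge0.
apply: (@le_trans _ _ (lebesgue_tuple R d (cap e 2))).
  apply: le_measure; rewrite ?inE; [exact: measurable_cap|exact: measurable_cap|].
  move=> y [y1 _]; split => //; have := cauchy_schwarz y e; rewrite e1 mulr1.
  by rewrite ler_norml => /andP[h _]; have := enorm_ge0 y; lra.
apply: le_trans (lebesgue_cap_le_cubes e1 _ (ltn0Sn 0)) _ => //.
rewrite lee_fin (_ : 2 * (2 + 1%:R^-1) = 6); last by rewrite invr1; ring.
apply: (@le_trans _ _ (cap_const * 1)).
  by rewrite mulr1 lerDl mulr_ge0// exprn_ge0.
rewrite ler_wpM2l//; last by rewrite exprn_ege1// ltW.
by rewrite addr_ge0// mulr_ge0// exprn_ge0.
Qed.

Lemma dotprod_to_sphere (x y : d.-tuple RT) r :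
  dotprod x (to_sphere r y) = r * (dotprod x y / enorm y).
Proof.
rewrite /dotprod big_distrl big_distrr/=; apply: eq_bigr => i _.
by rewrite tnth_mktuple; ring.
Qed.

Lemma enorm_to_sphere y r : 0 <= r -> enorm y != 0 -> enorm (to_sphere r y) = r.
Proof.
move=> r0 y0; rewrite {1}/enorm dotprod_to_sphere dotprodC dotprod_to_sphere.
rewrite (_ : r * _ = r ^+ 2); first by rewrite sqrtr_sqr ger0_norm.
by rewrite -enorm_sqr; field.
Qed.

Lemma direction_exists z : exists2 e : d.-tuple RT, enorm e = 1 &
  forall y, dotprod z.1 y = enorm z.1 * dotprod y e.
Proof.
have [e e1 eE] := unit_vector_exists z.1 d0; exists e => // y.
by rewrite /dotprod big_distrr/=; apply: eq_bigr => i _; rewrite eE; ring.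
Qed.

Definition open_range : set RT := [set t : R | rho < `|t| < Num.sqrt (rho ^+ 2 + 1)].

Lemma open_range_sub t : open_range t -> rho <= `|t| <= Num.sqrt (rho ^+ 2 + 1).
Proof. by move=> /andP[/ltW -> /ltW ->]. Qed.

Lemma hrad_norm t : hrad rho `|t| = hrad rho t.
Proof. by rewrite /hrad real_normK ?num_real. Qed.

Lemma hcos_norm t : hcos rho `|t| = hcos rho t.
Proof. by rewrite /hcos real_normK ?num_real. Qed.

Lemma open_range_pos t : open_range t -> 0 < hrad rho t /\ 0 < hcos rho t.
Proof.
move=> /andP[t1 t2]; rewrite -hrad_norm -hcos_norm; split.
  exact: hrad_gt0.
exact: hcos_gt0.
Qed.

(** The points ([hrad], [hcos]) lie on the unit circle, so their squared distance is 2 minus twice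
    the given sum, hence at most 2 (1 - cos delta) <= delta^2. *)
Lemma close_coords t t' delta : rho <= `|t| <= Num.sqrt (rho ^+ 2 + 1) ->
  rho <= `|t'| <= Num.sqrt (rho ^+ 2 + 1) -> 0 < delta <= 1 ->
  cos delta <= hrad rho t * hrad rho t' + hcos rho t * hcos rho t' ->
  [/\ `|hangle rho t - hangle rho t'| <= delta,
      `|hrad rho t - hrad rho t'| <= delta & `|hcos rho t - hcos rho t'| <= delta].
Proof.
move=> tr tr' /andP[dl0 dl1] h; have pi2 := pi_ge2 R.
have E := hrad_hcos rho0 tr; have E' := hrad_hcos rho0 tr'.
have C := one_sub_cos_le delta.
have D : (hrad rho t - hrad rho t') ^+ 2 + (hcos rho t - hcos rho t') ^+ 2 <= delta ^+ 2.
  by lra.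
split.
- have /andP[tr1 _] := tr; have /andP[tr1' _] := tr'.
  have := hangle_itv rho0 tr1; have := hangle_itv rho0 tr1' => i1 i2.
  have A : `|hangle rho t - hangle rho t'| <= pi by rewrite ler_norml; lra.
  move: h; rewrite -cos_hangleB// -[cos (_ - _)]cos_norm ler_cos ?normr_ge0//; lra.
- rewrite -ler_sqr ?nnegrE//; last lra.
  by rewrite real_normK ?num_real//; have := sqr_ge0 (hcos rho t - hcos rho t'); lra.
- rewrite -ler_sqr ?nnegrE//; last lra.
  by rewrite real_normK ?num_real//; have := sqr_ge0 (hrad rho t - hrad rho t'); lra.
Qed.

(** With s and s' the radii of the slices of y and z, s s' (1 - cos of the angle between the
    directions) <= delta^2 / 2. If s' >= delta, then s <= 2 s' and the angle is of order delta / s.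
    If s' < delta, then s < 2 delta, the radius 4 delta / s exceeds 2, and the cap condition is
    void. *)
Lemma hball_slice_sub z e delta t y : hyperboloid rho z -> enorm e = 1 ->
  (forall y, dotprod z.1 y = enorm z.1 * dotprod y e) ->
  0 < delta <= 1 -> open_range t -> enorm y <= 1 ->
  hball rho z delta (to_sphere (hrad rho t) y, t) ->
  `|hangle rho t - hangle rho z.2| <= delta /\ cap e (4 * delta / hrad rho t) y.
Proof.
move=> zh e1 eE dl tO y1 [zh' _]; have := dl => /andP[dl0 dl1]; have pi2 := pi_ge2 R.
rewrite hdist_leE//; last lra.
have tr := open_range_sub tO; have [_ zr] := zh.
have [s0 v0] := open_range_pos tO.
rewrite /harg/= dotprod_to_sphere eE (enorm_hyperboloid zh) => h.
set s := hrad rho t in h s0 *; set s' := hrad rho z.2 in h.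
set v := hcos rho t in h v0; set v' := hcos rho z.2 in h.
set N := enorm y in y1 h *; set p := dotprod y e in h.
have N0 : 0 <= N by exact: enorm_ge0.
have s'0 : 0 <= s' by exact: sqrtr_ge0.
have pN : p <= N.
  by apply: le_trans (ler_norm _) _; rewrite (le_trans (cauchy_schwarz _ _))// e1 mulr1.
have pN' : - N <= p.
  by have := cauchy_schwarz y e; rewrite e1 mulr1 ler_norml => /andP[].
have pN1 : p / N <= 1.
  have [->|n0] := eqVneq N 0; first by rewrite invr0 mulr0.
  by rewrite ler_pdivrMr ?mul1r// lt_def n0.
have h2 : cos delta <= s * s' + v * v'.
  have : s' * s * (p / N) <= s' * s * 1 by rewrite ler_wpM2l// mulr_ge0// ltW.
  by lra.
have [ha hs hv] := close_coords tr zr dl h2.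
split => //; split => //; rewrite -/N -/p.
have D : s' * s * (N - p) <= delta ^+ 2 / 2 * N.
  have [n0|n0] := eqVneq N 0.
    have E0 : N - p = 0. lra.
    rewrite E0. rewrite n0. rewrite !mulr0. by [].  
  have n0' : 0 < N by rewrite lt_def n0.
  have C := one_sub_cos_le delta.
  have E := hrad_hcos rho0 tr; have E' := hrad_hcos rho0 zr.
  have V : s * s' + v * v' <= 1.
    by have := sqr_ge0 (s - s'); have := sqr_ge0 (v - v'); rewrite -/s -/v -/s' -/v' in E E' *; nra.
  have -> : s' * s * (N - p) = (s * s' - s * (s' * p / N)) * N by field.
  rewrite ler_wpM2r//; lra.
have u0 : 0 < delta / s by rewrite divr_gt0.
have -> : 4 * delta / s = 4 * (delta / s) by rewrite mulrA.
set u := delta / s in u0 *.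
have dE : delta = u * s by rewrite /u divfK// gt_eqF.
move: hs; rewrite -/s -/s' ler_norml => /andP[hs1 hs2].
have [sd|sd] := leP delta s'.
  have : s * s * (N - p) <= 2 * (s' * s * (N - p)).
    have h0 : s * s <= 2 * s' * s by apply: ler_wpM2r; [exact: ltW|lra].
    have Np0 : 0 <= N - p by lra.
    by have := ler_wpM2r Np0 h0; lra.
  rewrite dE in D; move=> h3.
  have : (s * s) * (N - p) <= (s * s) * (u ^+ 2 * N) by lra.
  rewrite ler_pM2l ?mulr_gt0// => h4.
  have : 0 <= u ^+ 2 * N by rewrite mulr_ge0// sqr_ge0.
  lra.
have hsu : s <= 2 * (u * s) by rewrite -dE; lra.
have u2 : 1 <= 2 * u by rewrite -(ler_pM2r s0); lra.
have : 0 <= (2 * u - 1) * N by rewrite mulr_ge0//; lra.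
have : 0 <= u * N by rewrite mulr_ge0// ltW.
move=> h6 h7.
have : 0 <= (2 * u - 1) * (u * N) by rewrite mulr_ge0//; lra.
lra.
Qed.

(** The factor [hrad] to the power d - 1 of the sphere cancels the same power in the denominator of
    the cap radius, which leaves a bound independent of the height. *)
Lemma slice_measure_le z delta t : hyperboloid rho z -> 0 < delta <= 1 -> open_range t ->
  (slice_measure rho (hball rho z delta) t <=
   if (`|hangle rho t - hangle rho z.2| <= delta)%R
   then (d%:R * cap_const * (4 * delta) ^+ d.-1)%:E else 0)%E.
Proof.
move=> zh dl tO; have [e e1 eE] := direction_exists z.
have [s0 v0] := open_range_pos tO; have /andP[dl0 dl1] := dl.
rewrite slice_measureE -/(hrad rho t).
set A := (X in lebesgue_tuple R d X).
have sub y : A y -> `|hangle rho t - hangle rho z.2| <= delta /\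
    cap e (4 * delta / hrad rho t) y.
  move=> [+ yB]; rewrite /ysection/= inE => yA.
  exact: (hball_slice_sub zh e1 eE dl tO yB yA).
case: ifPn => h; last first.
  rewrite (_ : A = set0) ?measure0 ?mule0//; apply/seteqP; split => // y /sub[].
  by rewrite (negbTE h).
have mA : measurable A.
  apply: measurableI; last exact: measurable_unit_ball.
  rewrite -[X in measurable X]setTI; apply: measurable_to_sphere => //.
  by apply: measurable_ysection; exact: measurable_hball.
have r0 : 0 < 4 * delta / hrad rho t by rewrite divr_gt0// mulr_gt0.
have LA : (lebesgue_tuple R d A <= (cap_const * (4 * delta / hrad rho t) ^+ d.-1)%:E)%E.
  apply: le_trans (lebesgue_cap_le_all e1 r0).
  apply: le_measure; rewrite ?inE//; first exact: measurable_cap.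
  by move=> y /sub[].
apply: le_trans (lee_wpmul2l _ LA) _; first by rewrite lee_fin mulr_ge0// exprn_ge0// ltW.
rewrite -EFinM lee_fin le_eqVlt; apply/orP; left; apply/eqP.
rewrite expr_div_n; have : hrad rho t ^+ d.-1 != 0 by rewrite gt_eqF// exprn_gt0.
by move: (hrad rho t ^+ d.-1) ((4 * delta) ^+ d.-1) => a b a0; field.
Qed.

(** The budget is 1 - cos delta >= delta^2 / 8. The latitudes use (delta / 8)^2 / 2 of it. A cap of
    radius r = delta / (32 s) uses s s' r^2 / 2 <= 16 (r s)^2 = delta^2 / 64, because the last
    hypothesis gives s' <= 32 s; the same hypothesis gives r <= 1. *)
Lemma slice_measure_ge z delta t : hyperboloid rho z -> 0 < delta <= 1 -> open_range t ->
  0 <= (z.2 : R) -> 0 <= t ->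
  `|hangle rho t - hangle rho z.2| <= delta / 8 ->
  (hrad rho z.2 + delta) / 32 <= hrad rho t ->
  ((d%:R * (2 * (4 * d%:R) ^+ d)^-1 * (delta / 32) ^+ d.-1)%:E <=
    slice_measure rho (hball rho z delta) t)%E.
Proof.
move=> zh dl tO z0 t0 ha hs; have [e e1 eE] := direction_exists z.
have [s0 v0] := open_range_pos tO; have /andP[dl0 dl1] := dl.
have tr := open_range_sub tO; have [_ zr] := zh.
have pi2 := pi_ge2 R.
rewrite slice_measureE -/(hrad rho t).
set A := (X in lebesgue_tuple R d X).
set s := hrad rho t in s0 hs A *; set s' := hrad rho z.2 in hs.
have s'0 : 0 <= s' by exact: sqrtr_ge0.
pose r := delta / 32 / s.
have r0 : 0 < r by rewrite divr_gt0// divr_gt0.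
have r1 : r <= 1 by rewrite ler_pdivrMr// mul1r; lra.
have rs : r * s = delta / 32 by rewrite /r divfK// gt_eqF.
have mA : measurable A.
  apply: measurableI; last exact: measurable_unit_ball.
  rewrite -[X in measurable X]setTI; apply: measurable_to_sphere => //.
  by apply: measurable_ysection; exact: measurable_hball.
(* The origin belongs to the cap, but [to_sphere] sends it to 0, which is not on a sphere of
   positive radius. The cube of side 0 takes care of it; it is null because d > 0. *)
have sub : cap e r `<=` A `|` cube [tuple 0 | _ < d] 0.
  move=> y [y1 yr]; have [y0|y0] := eqVneq (enorm y) 0.
    by right; apply/sub_cube => i; rewrite tnth_mktuple (enorm_eq0 _ y0) subr0 normr0.
  left; split => //; rewrite /ysection/= inE.
  have zh' : hyperboloid rho (to_sphere s y, t).
    split => //=; rewrite enorm_to_sphere//; last exact: ltW.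
    rewrite sqr_sqrtr// subr_ge0 -[t ^+ 2]real_normK ?num_real//.
    by rewrite lerXn2r ?nnegrE//; case/andP: tr.
  split => //; first by left.
  rewrite hdist_leE//; last lra.
  rewrite /harg/= dotprod_to_sphere eE (enorm_hyperboloid zh) -/s'.
  have : cos (hangle rho t - hangle rho z.2) >= 1 - (delta / 8) ^+ 2 / 2.
    have := one_sub_cos_le (hangle rho t - hangle rho z.2).
    have : (hangle rho t - hangle rho z.2) ^+ 2 <= (delta / 8) ^+ 2.
      by rewrite -real_normK ?num_real// lerXn2r ?nnegrE//; lra.
    lra.
  rewrite cos_hangleB// -/s -/s' => h1.
  have h2 := @one_sub_cos_ge _ delta ltac:(lra).
  have y0' : 0 < enorm y by rewrite lt_def y0 enorm_ge0.
  have h3 : 1 - dotprod y e / enorm y <= r ^+ 2 / 2.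
    rewrite -(ler_pM2r y0') mulrBl mul1r divfK//; lra.
  have h4 : s * s' * (1 - dotprod y e / enorm y) <= delta ^+ 2 / 16.
    have h5 : s * s' * (1 - dotprod y e / enorm y) <= s * s' * (r ^+ 2 / 2).
      by rewrite ler_wpM2l// mulr_ge0// ltW.
    have h6 : s' <= 32 * s by lra.
    have h7 : s * s' * (r ^+ 2 / 2) <= s * (32 * s) * (r ^+ 2 / 2).
      rewrite ler_wpM2r ?divr_ge0 ?sqr_ge0//.
      by rewrite ler_wpM2l// ltW.
    have h8 : s * (32 * s) * (r ^+ 2 / 2) = 16 * (r * s) ^+ 2 by field.
    rewrite h8 rs in h7; have := sqr_ge0 delta; lra.
  rewrite -[s' * _ / _]mulrA; move: h4; set q := _ / enorm y => h4.
  have := sqr_ge0 delta; lra.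
have m0 : lebesgue_tuple R d (cube [tuple 0 | _ < d] 0) = 0%E.
  by rewrite lebesgue_cube// mulr0 expr0n gtn_eqF.
have LA : (((2 * (4 * d%:R) ^+ d)^-1 * r ^+ d.-1)%:E <= lebesgue_tuple R d A)%E.
  apply: le_trans (lebesgue_cap_ge d0 e1 r0 r1) _.
  rewrite -[leRHS]adde0 -m0.
  apply: (le_trans _ (measureU2 (lebesgue_tuple R d) mA (measurable_cube _ _))).
  apply: le_measure => //; rewrite inE; first exact: measurable_cap.
  by apply: measurableU => //; exact: measurable_cube.
apply: le_trans _ (lee_wpmul2l _ LA); last by rewrite lee_fin mulr_ge0// exprn_ge0// ltW.
rewrite -EFinM lee_fin -rs [(r * s) ^+ _]exprMn le_eqVlt; apply/orP; left; apply/eqP.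
by move: (_^-1) (r ^+ _) (s ^+ _) => a b c; ring.
Qed.

End ball_slices.

(** * Weighted measure of balls *)

Section weighted_balls.
Context {R : realType} {d : nat}.
Local Notation RT := (measurableTypeR R).
Local Notation space := (ambient R d).
Local Notation mu := (@lebesgue_measure R).
Variables rho gamma : R.
Hypothesis rho0 : 0 <= rho.
Hypothesis gamma0 : 0 <= gamma.
Hypothesis d0 : (0 < d)%N.
Implicit Types (z : space) (t r delta : R).

Definition height_weight t : R :=
  `|t| * (t ^+ 2 - rho ^+ 2) `^ (- 2^-1) * (rho ^+ 2 + 1 - t ^+ 2) `^ (gamma - 2^-1).

Lemma weight0E z : weight0 rho gamma z = height_weight z.2. Proof. by []. Qed.

Lemma height_weight_ge0 t : 0 <= height_weight t.
Proof. by rewrite !mulr_ge0 ?powR_ge0. Qed.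

Lemma measurable_height_weight : measurable_fun [set: RT] height_weight.
Proof.
apply: measurable_funM.
  apply: measurable_funM; first exact: (@normr_measurable R setT).
  apply: (@measurableT_comp _ _ _ _ _ _ (@powR R ^~ (- 2^-1))).
    exact: measurable_powR.
  by apply: measurable_funB => //; exact: measurable_funX.
apply: (@measurableT_comp _ _ _ _ _ _ (@powR R ^~ (gamma - 2^-1))).
  exact: measurable_powR.
by apply: measurable_funB => //; exact: measurable_funX.
Qed.

Lemma measurable_weight0 : measurable_fun [set: space] (weight0 rho gamma).
Proof. exact: measurableT_comp measurable_height_weight measurable_snd. Qed.

Lemma height_weight_open t : open_range rho t ->
  height_weight t = hdensity rho t * (hcos rho t ^+ 2) `^ gamma.
Proof.
move=> tO; have [s0 v0] := open_range_pos rho0 tO.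
have s2 : 0 <= t ^+ 2 - rho ^+ 2 by move: s0; rewrite sqrtr_gt0 => /ltW.
have v2 : 0 < 1 + rho ^+ 2 - t ^+ 2 by rewrite -sqrtr_gt0.
rewrite /height_weight /hdensity powRN powR12_sqrt// -/(hrad rho t).
rewrite [rho ^+ 2 + 1]addrC powRD; last by rewrite (gt_eqF v2) implybT.
rewrite powRN (powR12_sqrt (ltW v2)) -/(hcos rho t) sqr_sqrtr//; last exact: ltW.
by field; rewrite !gt_eqF.
Qed.

Lemma measurable_open_range : measurable (open_range rho : set RT).
Proof.
have -> : open_range rho = (fun t : R => `|t|) @^-1` `]rho, Num.sqrt (rho ^+ 2 + 1)[%classic.
  by apply/seteqP; split => x /=; rewrite in_itv.
by rewrite -[X in measurable X]setTI; exact: (@normr_measurable R setT).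
Qed.

Lemma weighted0_slices z r : hyperboloid rho z ->
  (weighted rho (weight0 rho gamma) (hball rho z r) =
   \int[mu]_(t in open_range rho)
     ((height_weight t)%:E * slice_measure rho (hball rho z r) t))%E.
Proof.
move=> zh; have mB := measurable_hball rho0 r zh.
rewrite /weighted (@integral_slice _ _ rho _ (EFin \o height_weight))//; last 2 first.
- by apply/measurable_EFinP; exact: measurable_height_weight.
- by move=> t; rewrite lee_fin height_weight_ge0.
pose Nl : set RT := [set t : R | `|t| = rho \/ `|t| = Num.sqrt (rho ^+ 2 + 1)].
have NE : Nl = [set rho] `|` [set - rho] `|`
    ([set Num.sqrt (rho ^+ 2 + 1)] `|` [set - Num.sqrt (rho ^+ 2 + 1)]).
  have E (c x : R) : 0 <= c -> (`|x| = c) <-> (x = c \/ x = - c).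
    move=> c0; split; last by case=> ->; rewrite ?normrN ger0_norm.
    by case: (ler0P x) => _ <-; rewrite ?opprK; [right|left].
  apply/seteqP; split => t; rewrite /Nl/=; rewrite !E// ?sqrtr_ge0//.
have mN : measurable Nl.
  by rewrite NE; do !apply: measurableU.
have N0 : mu Nl = 0%E.
  apply: countable_lebesgue_measure0; apply: finite_set_countable.
  by rewrite NE !finite_setU; do !split; exact: finite_set1.
rewrite (ge0_negligible_integral mN) //.
- congr (integral _ _ _); apply/seteqP; split => t; rewrite /height_range /open_range /Nl/=.
    move=> [/andP[t1 t2] /not_orP[/eqP t3 /eqP t4]].
    by rewrite !lt_def t1 t2 t3 eq_sym t4.
  move=> /andP[t1 t2]; rewrite !ltW//; split => // -[] E; [move: t1|move: t2]; rewrite E ltxx//.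
- exact: measurable_height_range.
- apply: emeasurable_funM.
    by apply/measurable_EFinP; apply: measurable_funTS; exact: measurable_height_weight.
  by apply: measurable_funTS; exact: measurable_slice_measure.
- by move=> t _; rewrite mule_ge0 ?slice_measure_ge0// lee_fin height_weight_ge0.
Qed.

Definition height_band a b : set RT := [set t : R | height rho a < `|t| < height rho b].

Lemma measurable_height_band a b : measurable (height_band a b).
Proof.
have -> : height_band a b = (fun t : R => `|t|) @^-1` `]height rho a, height rho b[%classic.
  by apply/seteqP; split => x /=; rewrite in_itv.
by rewrite -[X in measurable X]setTI; exact: (@normr_measurable R setT).
Qed.

Lemma hdensityN t : hdensity rho (- t) = hdensity rho t.
Proof. by rewrite /hdensity normrN hradN hcosN. Qed.

Let mhd (D : set RT) : measurable_fun D (EFin \o hdensity rho).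
Proof. by apply/measurable_EFinP; apply: measurable_funTS; exact: measurable_hdensity. Qed.

(** The band has one interval in each part of the surface; the reflection exchanges them and
    preserves the density, hence the factor 2. *)
Lemma integral_height_band a b : 0 <= a -> a < b -> b <= pi / 2 ->
  (\int[mu]_(t in height_band a b) (hdensity rho t)%:E <= (2 * (b - a))%:E)%E.
Proof.
move=> a0 ab b2; pose I : set RT := `]height rho a, height rho b[%classic.
have ha := height_ge0 rho a.
have E : height_band a b = I `|` (-%R @^-1` I).
  apply/seteqP; split => t; rewrite /height_band /I/= !in_itv/=.
    by case: (ler0P t) => _ ?; [right|left].
  by case=> /andP[t1 t2]; [rewrite ger0_norm|rewrite -normrN ger0_norm];
    rewrite ?t1//; apply: le_trans ha (ltW t1).
have mI : measurable I by exact: measurable_itv.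
have mNI : measurable (-%R @^-1` I : set RT).
  by rewrite -[X in measurable X]setTI; exact: (@oppr_measurable R setT).
have C := integral_hdensity_le rho0 a0 ab b2.
rewrite E ge0_integral_setU//; last 2 first.
- by move=> t _; rewrite lee_fin hdensity_ge0.
- apply/disj_setPS => t [] /=; rewrite /I/= !in_itv/= => /andP[t1 _] /andP[t2 _]; lra.
have -> : (\int[mu]_(t in -%R @^-1` I) (hdensity rho t)%:E =
    \int[mu]_(t in I) (hdensity rho t)%:E)%E.
  rewrite [RHS]integral_oppr//; last by move=> t _; rewrite lee_fin hdensity_ge0.
  by apply: eq_integral => t _; rewrite hdensityN.
by rewrite mulr_natl mulr2n EFinD; apply: leeD.
Qed.

Lemma hangle_open t : open_range rho t -> 0 < hangle rho t < pi / 2.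
Proof.
move=> tO; have tr := open_range_sub tO; have /andP[tr1 _] := tr.
have [s0 v0] := open_range_pos rho0 tO; have /andP[h0 h2] := hangle_itv rho0 tr1.
rewrite !lt_def h0 h2 !andbT; apply/andP; split; apply/eqP => E.
  by move: s0; rewrite -(sin_hangle rho0 tr) E sin0 ltxx.
by move: v0; rewrite -(cos_hangle rho0 tr1) -E cos_pihalf ltxx.
Qed.

Lemma height_bandP a b t : 0 <= a -> b <= pi / 2 -> open_range rho t ->
  a < hangle rho t -> hangle rho t < b -> height_band a b t.
Proof.
move=> a0 b2 tO at0 tb; have tr := open_range_sub tO.
have /andP[h0 h2] := hangle_open tO.
rewrite /height_band/= -(height_hangle rho0 tr); apply/andP.
by split; apply: height_lt => //; exact: ltW.
Qed.

Lemma hcos_sqr_le t t' delta : rho <= `|t| <= Num.sqrt (rho ^+ 2 + 1) ->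
  rho <= `|t'| <= Num.sqrt (rho ^+ 2 + 1) -> 0 < delta <= 1 ->
  `|hangle rho t - hangle rho t'| <= delta ->
  hcos rho t ^+ 2 <= 2 * (hcos rho t' ^+ 2 + delta ^+ 2).
Proof.
move=> tr tr' dl h; have pi2 := pi_ge2 R.
have [|_ _] := close_coords rho0 tr tr' dl.
  by rewrite -cos_hangleB// -[cos (_ - _)]cos_norm ler_cos ?normr_ge0//; lra.
have v0 : 0 <= hcos rho t by exact: sqrtr_ge0.
have v0' : 0 <= hcos rho t' by exact: sqrtr_ge0.
move: (hcos rho t) (hcos rho t') v0 v0' => v v' v0 v0'; rewrite ler_norml => hv.
have : v ^+ 2 <= (v' + delta) ^+ 2 by rewrite lerXn2r ?nnegrE//; lra.
by have := sqr_ge0 (v' - delta); lra.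
Qed.

Lemma weighted0_le : exists2 C : R, 0 < C &
  forall z delta, hyperboloid rho z -> 0 < delta <= 1 ->
  (weighted rho (weight0 rho gamma) (hball rho z delta) <=
   (C * delta ^+ d * (hcos rho z.2 ^+ 2 + delta ^+ 2) `^ gamma)%:E)%E.
Proof.
have c0 : 0 < @cap_const R d by rewrite ltr_wpDr ?mulr_ge0 ?exprn_ge0// mulr_gt0// exprn_gt0.
pose c1 : R := d%:R * @cap_const R d * 4 ^+ d.-1.
have c10 : 0 < c1 by rewrite !mulr_gt0// ?exprn_gt0// ltr0n.
exists (8 * (2 `^ gamma * c1)); first by rewrite mulr_gt0 ?(mulr_gt0 _ c10)?powR_gt0.
move=> z delta zh dl; have /andP[dl0 dl1] := dl; have pi2 := pi_ge2 R.
have [_ zr] := zh; have /andP[zr1 zr2] := zr.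
have := hangle_itv rho0 zr1; set a0 := hangle rho z.2 => a0i.
set L := (hcos rho z.2 ^+ 2 + delta ^+ 2) `^ gamma.
have L0 : 0 <= L by exact: powR_ge0.
(* Latitudes within delta of a0 lie strictly inside the band of half-width 2 delta, as the open band
   demands; the ends are clipped to [0, pi / 2]. Width at most 4 delta in each of two parts explains
   the constant 8. *)
pose a := Num.max 0 (a0 - 2 * delta); pose b := Num.min (pi / 2) (a0 + 2 * delta).
have [ha1 ha2] : 0 <= a /\ a0 - 2 * delta <= a by rewrite /a !le_max !lexx ?orbT.
have [hb1 hb2] : b <= pi / 2 /\ b <= a0 + 2 * delta by rewrite /b !ge_min !lexx ?orbT.
have ab : a < b by rewrite /a /b lt_min !gt_max; apply/andP; split; apply/andP; split; lra.
pose K := 2 `^ gamma * L * (c1 * delta ^+ d.-1).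
have K0 : 0 <= K by rewrite !mulr_ge0 ?powR_ge0 ?exprn_ge0 ?(ltW c10)// ltW.
have mS := measurable_hball rho0 delta zh.
pose f t := ((height_weight t)%:E * slice_measure rho (hball rho z delta) t)%E.
have mf (D : set RT) : measurable_fun D f.
  apply: emeasurable_funM.
    by apply/measurable_EFinP; apply: measurable_funTS; exact: measurable_height_weight.
  by apply: measurable_funTS; exact: measurable_slice_measure.
have f0 t : (0 <= f t)%E.
  by rewrite mule_ge0 ?slice_measure_ge0// lee_fin height_weight_ge0.
have bandO : height_band a b `<=` open_range rho.
  move=> t /andP[t1 t2]; apply/andP; split.
    by rewrite (le_lt_trans _ t1)// -[leLHS](height0 rho0) height_le//; lra.
  by rewrite (lt_le_trans t2)// -height_pihalf height_le//; lra.
have inband t : open_range rho t -> `|hangle rho t - a0| <= delta -> height_band a b t.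
  move=> tO; rewrite ler_norml => /andP[h1 h2]; have /andP[h3 h4] := hangle_open tO.
  clear - rho0 ha1 hb1 tO h1 h2 h3 h4 dl0; apply: height_bandP => //.
    by rewrite /a gt_max h3/=; lra.
  by rewrite /b lt_min h4/=; lra.
rewrite weighted0_slices// -/f.
have mband := measurable_height_band a b.
have mdiff : measurable (open_range rho `\` height_band a b : set RT).
  by apply: measurableD => //; exact: measurable_open_range.
have disj : [disjoint height_band a b & open_range rho `\` height_band a b].
  by apply/disj_setPS => t [? []].
rewrite -(setDUK bandO) ge0_integral_setU//; last by move=> t _; exact: f0.
rewrite [X in (_ + X)%E]integral0_eq ?adde0; last first.
  move=> t [tO tb]; have := slice_measure_le rho0 d0 zh dl tO.
  rewrite -/a0; case: ifPn => [/(inband t tO)//|_ h].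
  by rewrite /f (_ : slice_measure _ _ _ = 0%E) ?mule0//; apply/le_anti; rewrite h slice_measure_ge0.
apply: (@le_trans _ _ (\int[mu]_(t in height_band a b) (K%:E * (hdensity rho t)%:E))%E).
  apply: ge0_le_integral => //.
  - by move=> t _; exact: f0.
  - by apply: emeasurable_funM => //; exact: mhd.
  move=> t /bandO tO; have h := slice_measure_le rho0 d0 zh dl tO.
  have hd := hdensity_ge0 rho t.
  rewrite /f height_weight_open//; move: h; rewrite -/a0; case: ifPn => [ht h|_ h]; last first.
    rewrite (_ : slice_measure _ _ _ = 0%E) ?mule0; last by apply/le_anti; rewrite h slice_measure_ge0.
    by rewrite -EFinM lee_fin mulr_ge0.
  apply: le_trans (lee_wpmul2l _ h) _; first by rewrite lee_fin mulr_ge0// powR_ge0.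
  rewrite -!EFinM lee_fin.
  have hv : (hcos rho t ^+ 2) `^ gamma <= 2 `^ gamma * L.
    rewrite -powRM ?addr_ge0 ?sqr_ge0//.
    apply: ge0_ler_powR => //; rewrite ?nnegrE ?sqr_ge0 ?mulr_ge0 ?addr_ge0 ?sqr_ge0//.
    exact: (hcos_sqr_le (open_range_sub tO) zr dl ht).
  pose Q := hdensity rho t * (c1 * delta ^+ d.-1).
  have Q0 : 0 <= Q.
    by apply: mulr_ge0 => //; apply: mulr_ge0; [exact: ltW|rewrite exprn_ge0// ltW].
  rewrite [leRHS](_ : _ = 2 `^ gamma * L * Q); last by rewrite /K /Q; ring.
  rewrite exprMn [leLHS](_ : _ = (hcos rho t ^+ 2) `^ gamma * Q); last by rewrite /Q /c1; ring.
  exact: ler_wpM2r.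
have h0 t : height_band a b t -> (0 <= (EFin \o hdensity rho) t)%E.
  by move=> _; rewrite lee_fin hdensity_ge0.
rewrite (ge0_integralZl mu mband (@mhd _) h0)//.
apply: le_trans (lee_wpmul2l _ (integral_height_band ha1 ab hb1)) _ => //.
rewrite -EFinM lee_fin.
apply: (@le_trans _ _ (K * (8 * delta))); first by rewrite ler_wpM2l//; lra.
rewrite -[in X in _ <= X](prednK d0) exprS /K le_eqVlt; apply/orP; left; apply/eqP; ring.
Qed.

End weighted_balls.

(** * Lower bound for the weighted measure of balls *)

Section weighted_balls_lower.
Context {R : realType} {d : nat}.
Local Notation RT := (measurableTypeR R).
Local Notation space := (ambient R d).
Local Notation mu := (@lebesgue_measure R).
Variables rho gamma : R.
Hypothesis rho0 : 0 <= rho.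
Hypothesis gamma0 : 0 <= gamma.
Hypothesis d0 : (0 < d)%N.
Implicit Types (z : space) (t r delta : R).

Lemma half_colatitude_le_cos (a : R) : 0 <= a <= pi / 2 -> (pi / 2 - a) / 2 <= cos a.
Proof.
move=> a0; have := @half_le_sin R (pi / 2 - a) ltac:(lra).
by rewrite sinB sin_pihalf cos_pihalf mul0r subr0 mul1r.
Qed.

Lemma cos_le_colatitude (a : R) : 0 <= a <= pi / 2 -> cos a <= pi / 2 - a.
Proof.
move=> a0; have := @sin_le_id R (pi / 2 - a) ltac:(lra).
by rewrite sinB sin_pihalf cos_pihalf mul0r subr0 mul1r.
Qed.

(** The window is moved towards the equator when a0 is nearer to the pole, and towards the pole
    otherwise. It thus stays at distance of order delta from both, where sine and cosine would
    degenerate. *)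
Lemma good_angles (a0 delta : R) : 0 <= a0 <= pi / 2 -> 0 < delta <= 1 ->
  exists a, [/\ 0 < a, a + delta / 16 < pi / 2 & forall x, a <= x <= a + delta / 16 ->
    [/\ `|x - a0| <= delta / 8, (sin a0 + delta) / 32 <= sin x &
      (cos a0 + delta) / 32 <= cos x]].
Proof.
move=> a0i dl; have pi1 := pihalf_ge1 R; have pi2 := pihalf_lt2 R.
have s1 := sin_le1 a0; have c1 := cos_le1 a0.
have sle := @sin_le_id R a0 ltac:(lra); have cle := cos_le_colatitude a0i.
have [h|h] := leP a0 (pi / 4).
  exists (a0 + delta / 16); split; [lra|lra|] => x xi.
  have sx := @half_le_sin R x ltac:(lra); have cx := @half_colatitude_le_cos x ltac:(lra).
  by split; [rewrite ler_norml; lra|lra|lra].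
exists (a0 - delta / 8); split; [lra|lra|] => x xi.
have sx := @half_le_sin R x ltac:(lra); have cx := @half_colatitude_le_cos x ltac:(lra).
by split; [rewrite ler_norml; lra|lra|lra].
Qed.

Lemma weighted0_hflip z r : hyperboloid rho z ->
  weighted rho (weight0 rho gamma) (hball rho (hflip z) r) =
  weighted rho (weight0 rho gamma) (hball rho z r).
Proof.
move=> zh; apply: weighted_hflip => //.
- by apply: measurable_funTS; exact: measurable_weight0.
- by move=> y _; rewrite weight0E height_weight_ge0.
- by move=> y _; rewrite /weight0/= normrN !sqrrN.
Qed.

Lemma height_itvP (a b t : R) : 0 < a -> a < b -> b < pi / 2 ->
  height rho a <= t <= height rho b ->
  [/\ 0 <= t, open_range rho t & a <= hangle rho t <= b].
Proof.
move=> a0 ab b2 /andP[t1 t2]; have t0 := le_trans (height_ge0 rho a) t1.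
have ha := @height_lt _ rho _ _ (lexx 0) a0 (ltW (lt_trans ab b2)).
have hb := @height_lt _ rho _ _ (ltW (lt_trans a0 ab)) b2 (lexx _).
have tO : open_range rho t.
  rewrite /open_range/= ger0_norm// -height_pihalf (le_lt_trans t2 hb) andbT.
  by rewrite (lt_le_trans _ t1)// -[ltLHS](height0 rho0).
have tr := open_range_sub tO; have /andP[tr1 _] := tr.
have /andP[h0 h2] := hangle_itv rho0 tr1.
have tE : height rho (hangle rho t) = t by rewrite (height_hangle rho0 tr) ger0_norm.
split => //; apply/andP; split; rewrite leNgt; apply/negP => h.
  by have := @height_lt _ rho _ _ h0 h (ltW (lt_trans ab b2)); rewrite tE ltNge t1.
by have := @height_lt _ rho _ _ (ltW (lt_trans a0 ab)) h h2; rewrite tE ltNge t2.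
Qed.

Lemma sqr_ge_of_div (v v0 delta : R) : 0 <= v0 -> 0 <= delta -> (v0 + delta) / 32 <= v ->
  32^-1 ^+ 2 * (v0 ^+ 2 + delta ^+ 2) <= v ^+ 2.
Proof.
move=> v00 dl h; apply: (@le_trans _ _ (((v0 + delta) / 32) ^+ 2)).
  by have := mulr_ge0 v00 dl; lra.
by rewrite lerXn2r ?nnegrE//; lra.
Qed.

(** Every slice in the window of [good_angles] carries order delta^(d-1), and the length delta / 16
    of the window supplies the remaining power. On it [hcos] is at least 1 / 32 of its value at z
    plus delta, so the weight loses only a constant factor. *)
Lemma weighted0_ge : exists2 c : R, 0 < c &
  forall z delta, hyperboloid rho z -> 0 < delta <= 1 ->
  ((c * delta ^+ d * (hcos rho z.2 ^+ 2 + delta ^+ 2) `^ gamma)%:E <=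
   weighted rho (weight0 rho gamma) (hball rho z delta))%E.
Proof.
pose c1 : R := d%:R * (2 * (4 * d%:R) ^+ d)^-1 * (32^-1) ^+ d.-1.
have c10 : 0 < c1.
  by rewrite !mulr_gt0 ?exprn_gt0 ?invr_gt0 ?mulr_gt0 ?exprn_gt0 ?mulr_gt0 ?ltr0n.
pose c2 : R := (32^-1 ^+ 2) `^ gamma.
have c20 : 0 < c2 by rewrite powR_gt0// exprn_gt0// invr_gt0.
exists (c2 * c1 / 16); first by rewrite divr_gt0// mulr_gt0.
move=> z delta; wlog z0 : z / 0 <= (z.2 : R) => [H zh dl|zh dl].
  have [z0|z0] := leP 0 (z.2 : R); first exact: H.
  have zh' : hyperboloid rho (hflip z) by exact/hyperboloid_hflip.
  have := H (hflip z) _ zh' dl; rewrite weighted0_hflip//= hcosN oppr_ge0.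
  by apply; exact: ltW.
have /andP[dl0 dl1] := dl; have pi2 := pi_ge2 R; have r0 := rho0.
have [_ zr] := zh; have /andP[zr1 zr2] := zr.
have := hangle_itv rho0 zr1; set a0 := hangle rho z.2 => a0i.
set L := (hcos rho z.2 ^+ 2 + delta ^+ 2) `^ gamma.
have L0 : 0 <= L by exact: powR_ge0.
have [a [aa0 aa1 good]] := good_angles a0i dl.
pose b := a + delta / 16.
have ab : a < b by rewrite /b; lra.
pose I : set RT := `[height rho a, height rho b]%classic.
have mI : measurable I by exact: measurable_itv.
pose K := c2 * L * (c1 * delta ^+ d.-1).
have K0 : 0 <= K.
  apply: mulr_ge0; first by rewrite mulr_ge0// ltW.
  by apply: mulr_ge0; [exact: ltW|rewrite exprn_ge0// ltW].
have mS := measurable_hball rho0 delta zh.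
pose f t := ((height_weight rho gamma t)%:E * slice_measure rho (hball rho z delta) t)%E.
have mf (D : set RT) : measurable_fun D f.
  apply: emeasurable_funM.
    by apply/measurable_EFinP; apply: measurable_funTS; exact: measurable_height_weight.
  by apply: measurable_funTS; exact: measurable_slice_measure.
have f0 t : (0 <= f t)%E.
  by rewrite mule_ge0 ?slice_measure_ge0// lee_fin height_weight_ge0.
have b2 : b < pi / 2 by [].
have It t : I t -> [/\ 0 <= t, open_range rho t & a <= hangle rho t <= b].
  by rewrite /I/= in_itv/=; exact: height_itvP.
rewrite weighted0_slices//.
apply: (@le_trans _ _ (\int[mu]_(t in I) f t)%E); last first.
  have mO := @measurable_open_range R rho.
  have sub : I `<=` open_range rho by move=> t /It[].
  exact: (ge0_subset_integral mu mI mO (mf _) (fun t _ => f0 t) sub).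
apply: (@le_trans _ _ (\int[mu]_(t in I) (K%:E * (hdensity rho t)%:E))%E); last first.
  have mhd : measurable_fun I (EFin \o hdensity rho).
    by apply/measurable_EFinP; apply: measurable_funTS; exact: measurable_hdensity.
  apply: ge0_le_integral => //.
  - by move=> t _; rewrite -EFinM lee_fin mulr_ge0// hdensity_ge0.
  - by apply: emeasurable_funM.
  move=> t /It[t0 tO ti]; have [xa xs xc] := good _ ti.
  have tr := open_range_sub tO; have /andP[tr1 _] := tr.
  rewrite /a0 !(sin_hangle rho0)// !(cos_hangle rho0)// in xs xc.
  have h := slice_measure_ge rho0 d0 zh dl tO z0 t0 xa xs.
  rewrite /f; apply: le_trans (lee_wpmul2l _ h); last by rewrite lee_fin height_weight_ge0.
  rewrite -!EFinM lee_fin height_weight_open//.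
  have hd := hdensity_ge0 rho t.
  have hv : c2 * L <= (hcos rho t ^+ 2) `^ gamma.
    rewrite -powRM ?addr_ge0 ?sqr_ge0//.
    apply: ge0_ler_powR => //; rewrite ?nnegrE ?sqr_ge0 ?mulr_ge0 ?addr_ge0 ?sqr_ge0//.
    by apply: sqr_ge_of_div => //; [exact: sqrtr_ge0|exact: ltW].
  pose Q := hdensity rho t * (c1 * delta ^+ d.-1).
  have Q0 : 0 <= Q.
    by apply: mulr_ge0 => //; apply: mulr_ge0; [exact: ltW|rewrite exprn_ge0// ltW].
  rewrite [leLHS](_ : _ = c2 * L * Q); last by rewrite /K /Q; ring.
  rewrite [(delta / 32) ^+ _]exprMn [leRHS](_ : _ = (hcos rho t ^+ 2) `^ gamma * Q); last first.
    by rewrite /Q /c1; move: ((2 * _)^-1) => D; ring.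
  exact: ler_wpM2r.
rewrite ge0_integralZl//; last 2 first.
- by apply/measurable_EFinP; apply: measurable_funTS; exact: measurable_hdensity.
- by move=> t _; rewrite lee_fin hdensity_ge0.
rewrite integral_hdensity//.
rewrite -EFinM lee_fin /b.
rewrite -[in X in X <= _](prednK d0) exprS /K le_eqVlt; apply/orP; left; apply/eqP.
by rewrite addrAC subrr add0r; field.
Qed.

End weighted_balls_lower.

(** * Polynomials on the surface *)

Section polynomial_functions.
Context {R : realType} {d : nat}.
Local Notation RT := (measurableTypeR R).
Local Notation space := (ambient R d).
Implicit Types (p : mpoly d.+1 R) (z : space) (n : nat) (g : space -> R).

Definition coords z : 'I_d.+1 -> R := tnth [tuple of rcons z.1 z.2].

Lemma coords_widen z (i : 'I_d) : coords z (widen_ord (leqnSn d) i) = tnth z.1 i.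
Proof. by rewrite /coords !(tnth_nth 0)/= nth_rcons size_tuple ltn_ord. Qed.

Lemma coords_max z : coords z ord_max = z.2.
Proof. by rewrite /coords (tnth_nth 0)/= nth_rcons size_tuple ltnn eqxx. Qed.

Lemma eval_polyE p z : eval_poly p z =
  \sum_(m <- msupp p) mcoeff m p *
    ((\prod_(i < d) tnth z.1 i ^+ m (widen_ord (leqnSn d) i)) * z.2 ^+ m ord_max).
Proof.
rewrite /eval_poly mevalE; apply: eq_bigr => m _; congr (_ * _).
rewrite big_ord_recr/= -[tnth _ _]/(coords z _) coords_max; congr (_ * _).
by apply: eq_bigr => i _; rewrite -[tnth _ _]/(coords z _) coords_widen.
Qed.

Lemma measurable_eval_poly p : measurable_fun [set: space] (eval_poly p).
Proof.
rewrite (_ : eval_poly p = fun z => \sum_(m <- msupp p) mcoeff m p *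
    ((\prod_(i < d) tnth z.1 i ^+ m (widen_ord (leqnSn d) i)) * z.2 ^+ m ord_max)).
  apply: measurable_sum => m; apply: measurable_funM => //; apply: measurable_funM.
    apply: (@measurable_prod _ space R setT 'I_d (index_enum _)
      (fun i z => tnth z.1 i ^+ m (widen_ord (leqnSn d) i))) => i _.
    apply: measurable_funX.
    exact: (measurableT_comp (measurable_coord i) measurable_fst).
  by apply: measurable_funX; exact: measurable_snd.
by apply/funext => z; rewrite eval_polyE.
Qed.

Lemma mdeg_split (m : multinom d.+1) :
  mdeg m = (\sum_(i < d) m (widen_ord (leqnSn d) i) + m ord_max)%N.
Proof. by rewrite mdegE big_ord_recr. Qed.

Lemma eval_poly_bounded p (b : R) : 1 <= b -> exists B : R, forall z,
  (forall i, `|tnth z.1 i| <= b) -> `|z.2 : R| <= b -> `|eval_poly p z| <= B.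
Proof.
move=> b1; exists (\sum_(m <- msupp p) `|mcoeff m p| * b ^+ mdeg m) => z zx zt.
rewrite eval_polyE; apply: le_trans (ler_norm_sum _ _ _) _.
apply: ler_sum => m _; rewrite normrM ler_wpM2l// normrM mdeg_split exprD.
apply: ler_pM => //; last by rewrite normrX lerXn2r ?nnegrE// (le_trans _ b1).
rewrite normr_prod expr_sum; apply: ler_prod => i _; rewrite normr_ge0/= normrX.
by rewrite lerXn2r ?nnegrE// (le_trans _ b1).
Qed.

(** Equality holds on the whole ambient space, so degrees add under products without reference to
    the surface; restriction comes last, in [even_polys]. *)
Definition polyfun n g := exists2 p, (msize p <= n.+1)%N & forall z, g z = eval_poly p z.

Lemma polyfun_ext n g h : g =1 h -> polyfun n g -> polyfun n h.
Proof. by move=> gh [p pn pg]; exists p => // z; rewrite -gh. Qed.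

Lemma polyfun_le m n g : (m <= n)%N -> polyfun m g -> polyfun n g.
Proof. by move=> mn [p pm pg]; exists p => //; rewrite (leq_trans pm). Qed.

Lemma polyfun_cst n (c : R) : polyfun n (fun=> c).
Proof.
exists (mpolyC d.+1 c); last by move=> z; rewrite /eval_poly mevalC.
by rewrite mmeasureC; case: (c == 0).
Qed.

Lemma polyfunD n g h : polyfun n g -> polyfun n h -> polyfun n (fun z => g z + h z).
Proof.
move=> [p pn pg] [q qn qh]; exists (p + q).
  by rewrite (leq_trans (mmeasureD_le _ _ _))// geq_max pn.
by move=> z; rewrite pg qh /eval_poly mevalD.
Qed.

Lemma polyfunM m n g h : polyfun m g -> polyfun n h ->
  polyfun (m + n) (fun z => g z * h z).
Proof.
move=> [p pn pg] [q qn qh]; exists (p * q); last by move=> z; rewrite pg qh /eval_poly mevalM.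
have [->|p0] := eqVneq p 0; first by rewrite mul0r mmeasure0.
have [->|q0] := eqVneq q 0; first by rewrite mulr0 mmeasure0.
rewrite msizeM//; move: pn qn; move: (mmeasure _ p) (mmeasure _ q) => a b; lia.
Qed.

Lemma polyfunZ n (c : R) g : polyfun n g -> polyfun n (fun z => c * g z).
Proof. by rewrite -[n]add0n; apply: polyfunM; exact: polyfun_cst. Qed.

Lemma polyfun_coord n (i : 'I_d) : (0 < n)%N -> polyfun n (fun z => tnth z.1 i).
Proof.
move=> n0; exists (mpolyX R (mnm1 (widen_ord (leqnSn d) i))).
  by rewrite msizeX mdeg1.
by move=> z; rewrite /eval_poly mevalXU; exact/esym/coords_widen.
Qed.

Lemma polyfun_height n : (0 < n)%N -> polyfun n (fun z => z.2 : R).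
Proof.
move=> n0; exists (mpolyX R (mnm1 ord_max)); first by rewrite msizeX mdeg1.
by move=> z; rewrite /eval_poly mevalXU; exact/esym/coords_max.
Qed.

Lemma polyfun_sum (I : eqType) (r : seq I) n (g : I -> space -> R) :
  (forall i, i \in r -> polyfun n (g i)) -> polyfun n (fun z => \sum_(i <- r) g i z).
Proof.
elim: r => [|i r IH] gn.
  by apply: polyfun_ext (polyfun_cst n 0) => z; rewrite big_nil.
apply: (@polyfun_ext _ (fun z => g i z + \sum_(i <- r) g i z)).
  by move=> z; rewrite big_cons.
apply: polyfunD; first by apply: gn; rewrite mem_head.
by apply: IH => j jr; apply: gn; rewrite inE jr orbT.
Qed.

Lemma trigpoly_prod (I : Type) (r : seq I) (m : I -> nat) (T : I -> R -> R) :
  (forall i, trigpoly (m i) (T i)) ->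
  trigpoly (\sum_(i <- r) m i) (fun u => \prod_(i <- r) T i u).
Proof.
move=> Tm; elim: r => [|i r IH].
  by apply: trigpoly_ext (trigpoly_cst _ 1) => u; rewrite big_nil.
rewrite big_cons; apply: trigpoly_ext (trigpolyM (Tm i) IH) => u.
by rewrite big_cons.
Qed.

(* Even powers of the height are polynomials in its square, so the even part
   of p restricts to a trigonometric polynomial of the same degree. *)
Lemma trigpoly_even_part p n (x : R -> d.-tuple RT) (h : R -> R) :
  (msize p <= n.+1)%N ->
  (forall i, trigpoly 1 (fun u => tnth (x u) i)) ->
  trigpoly 2 (fun u => h u ^+ 2) ->
  trigpoly n (fun u => (eval_poly p (x u, h u) + eval_poly p (x u, - h u)) / 2).
Proof.
move=> pn xt ht.
apply: (@trigpoly_ext _ _ (fun u => \sum_(m <- msupp p) mcoeff m p *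
   ((\prod_(i < d) tnth (x u) i ^+ m (widen_ord (leqnSn d) i)) *
    (if odd (m ord_max) then 0 else (h u ^+ 2) ^+ (m ord_max)./2)))).
  move=> u; rewrite !eval_polyE -big_split big_distrl; apply: eq_bigr => m _ /=.
  rewrite exprNn -signr_odd; case: ifPn => om; first by rewrite expr1; field.
  rewrite expr0 -exprM -[in RHS](odd_double_half (m ord_max)) (negbTE om) add0n mul2n.
  by field.
apply: trigpoly_sum => m /msize_mdeg_lt mp.
have mn : (mdeg m <= n)%N by rewrite -ltnS (leq_trans mp).
apply: (trigpoly_le mn); rewrite mdeg_split -[X in trigpoly X]add0n.
apply: trigpolyM; first exact: trigpoly_cst.
apply: trigpolyM.
  apply: trigpoly_prod => i; rewrite -[X in trigpoly X]mul1n; apply: trigpolyX; exact: xt.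
case: (boolP (odd (m ord_max))) => om; first exact: trigpoly_cst.
rewrite -[X in trigpoly X](odd_double_half (m ord_max)) (negbTE om) add0n -mul2n.
exact: trigpolyX.
Qed.

End polynomial_functions.

(** * Even polynomials along great circles *)

Section even_polynomials.
Context {R : realType} {d : nat}.
Local Notation RT := (measurableTypeR R).
Local Notation space := (ambient R d).
Variable rho : R.
Hypothesis rho0 : 0 <= rho.
Implicit Types (z y : space) (g : space -> R) (n K : nat) (u a b t : R).

Lemma even_poly_abs n g z : even_polys rho n g -> hyperboloid rho z ->
  g z = g (z.1, `|z.2 : R|).
Proof.
move=> [_ ge] zh; case: (ler0P (z.2 : R)) => _; last by case: z zh.
by case: z zh => x t zh; exact: ge.
Qed.

(** The height of the point above x in the upper part; an even function on the surface is determined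
    by its values there. *)
Definition lift_height (x : d.-tuple RT) : R := Num.sqrt (enorm x ^+ 2 + rho ^+ 2).

Lemma lift_heightE z : hyperboloid rho z -> lift_height z.1 = `|z.2 : R|.
Proof. by move=> [h _]; rewrite /lift_height h subrK sqrtr_sqr. Qed.

Lemma lift_height_sqr x : lift_height x ^+ 2 = enorm x ^+ 2 + rho ^+ 2.
Proof. by rewrite [LHS]sqr_sqrtr// addr_ge0 ?sqr_ge0. Qed.

Lemma hyperboloid_lift x : enorm x <= 1 -> hyperboloid rho (x, lift_height x).
Proof.
move=> x1; have x0 := enorm_ge0 x.
split => /=; first by rewrite lift_height_sqr addrK.
rewrite ger0_norm ?sqrtr_ge0//; apply/andP; split.
  by rewrite -[leLHS](ger0_norm rho0) -sqrtr_sqr ler_wsqrtr// lerDr sqr_ge0.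
by rewrite ler_wsqrtr// addrC lerD2l expr_le1.
Qed.

Lemma hcos_sqr z : hyperboloid rho z -> hcos rho z.2 ^+ 2 = 1 + rho ^+ 2 - z.2 ^+ 2.
Proof.
move=> zh; have [_ zr] := zh; have := hrad_hcos rho0 zr.
rewrite -(enorm_hyperboloid zh); case: zh => -> _; lra.
Qed.

Section great_circle.
Variables (x y : d.-tuple RT) (a b : R).
Hypothesis x1 : enorm x ^+ 2 + a ^+ 2 = 1.
Hypothesis y1 : enorm y ^+ 2 + b ^+ 2 = 1.
Hypothesis xy : dotprod x y + a * b = 0.

(** By the hypotheses (x, a) and (y, b) are orthonormal in R^(d+1); this is the projection to R^d of
    the great circle they span. The last coordinate may become negative, but only the projection
    enters, so g can be followed around the entire circle. *)
Let X u : d.-tuple RT := comb (cos u) x (sin u) y.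

Lemma great_circle_norm u : enorm (X u) ^+ 2 + (cos u * a + sin u * b) ^+ 2 = 1.
Proof.
rewrite enorm_sqr /X dotprod_comb !dotprod_combr (dotprodC y x) -!enorm_sqr.
have := cos2Dsin2 u => E.
transitivity (cos u ^+ 2 * (enorm x ^+ 2 + a ^+ 2) + sin u ^+ 2 * (enorm y ^+ 2 + b ^+ 2) +
  2 * cos u * sin u * (dotprod x y + a * b)); first by ring.
by rewrite x1 y1 xy; lra.
Qed.

Lemma great_circle_le1 u : enorm (X u) <= 1.
Proof.
rewrite -(@expr_le1 _ 2) ?enorm_ge0//; have := great_circle_norm u.
have := sqr_ge0 (cos u * a + sin u * b); lra.
Qed.

(** The squared chord between arcs 0 and u is 2 - 2 cos u, and the last coordinate accounts for only
    a part of it. *)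
Lemma great_circle_chord u : (a - (cos u * a + sin u * b)) ^+ 2 <= 2 - 2 * cos u.
Proof.
have := great_circle_norm u; set w := cos u * a + sin u * b => E.
have : 0 <= sqdist x (X u) by apply: sumr_ge0 => i _; exact: sqr_ge0.
rewrite sqdistE /X dotprod_combr -enorm_sqr -/(X u) => h.
have : a * w = cos u * a ^+ 2 + sin u * (a * b) by rewrite /w; ring.
have : cos u * (enorm x ^+ 2 + a ^+ 2) = cos u by rewrite x1 mulr1.
have : sin u * (dotprod x y + a * b) = 0 by rewrite xy mulr0.
have := x1; lra.
Qed.

Lemma great_circle_trigpoly g n : even_polys rho n g ->
  trigpoly n (fun u => g (X u, lift_height (X u))).
Proof.
move=> [[p pn pE] ge].
apply: (@trigpoly_ext _ _ (fun u => (eval_poly p (X u, lift_height (X u)) +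
    eval_poly p (X u, - lift_height (X u))) / 2)).
  move=> u; have h := hyperboloid_lift (great_circle_le1 u).
  have h' : hyperboloid rho (X u, - lift_height (X u)).
    by have /hyperboloid_hflip := h.
  by rewrite -!pE// -ge//; field.
have Xt i : trigpoly 1 (fun u => tnth (X u) i).
  apply: trigpoly_ext (trigpoly_linear (tnth x i) (tnth y i) (ltnSn 0)) => u.
  by rewrite tnth_mktuple; ring.
apply: trigpoly_even_part => //.
apply: (@trigpoly_ext _ _ (fun u => \sum_(i < d) tnth (X u) i ^+ 2 + rho ^+ 2)).
  by move=> u; rewrite lift_height_sqr enorm_sqr; congr (_ + _); apply: eq_bigr => i _; rewrite expr2.
apply: trigpolyD; last exact: trigpoly_cst.
by apply: trigpoly_sum => i _; exact: (@trigpolyX _ 1 2).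
Qed.

End great_circle.

(** Gram-Schmidt on the hemisphere: subtract from y its component [harg] along z and divide by the
    sine of the distance, which is the norm of the remainder. *)
Lemma even_poly_great_circle z y : hyperboloid rho z -> hyperboloid rho y ->
  sin (hdist rho z y) != 0 ->
  exists (u : d.-tuple RT) b, [/\ enorm u ^+ 2 + b ^+ 2 = 1,
    dotprod z.1 u + hcos rho z.2 * b = 0 &
    comb (cos (hdist rho z y)) z.1 (sin (hdist rho z y)) u = y.1].
Proof.
move=> zh yh; rewrite cos_hdist//; set s := sin _; set c := harg rho z y => s0.
have E : s ^+ 2 = 1 - c ^+ 2.
  by have := cos2Dsin2 (hdist rho z y); rewrite cos_hdist// -/s -/c; lra.
have zz := harg_self rho0 zh; have yy := harg_self rho0 yh.
rewrite /harg in zz yy.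
exists (comb s^-1 y.1 (- (c / s)) z.1), ((hcos rho y.2 - c * hcos rho z.2) / s); split.
- rewrite enorm_sqr dotprod_comb !dotprod_combr (dotprodC y.1 z.1).
  transitivity (((dotprod y.1 y.1 + hcos rho y.2 * hcos rho y.2) - 2 * c *
    (dotprod z.1 y.1 + hcos rho z.2 * hcos rho y.2) +
    c ^+ 2 * (dotprod z.1 z.1 + hcos rho z.2 * hcos rho z.2)) / s ^+ 2); first by field.
  by rewrite zz yy -[_ + hcos rho z.2 * hcos rho y.2]/c E; field; rewrite -E expf_eq0.
- rewrite dotprod_combr.
  transitivity (((dotprod z.1 y.1 + hcos rho z.2 * hcos rho y.2) -
    c * (dotprod z.1 z.1 + hcos rho z.2 * hcos rho z.2)) / s); first by field.
  by rewrite zz -[_ + hcos rho z.2 * hcos rho y.2]/c mulr1 subrr mul0r.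
- by apply: eq_from_tnth => i; rewrite !tnth_mktuple; field.
Qed.

Lemma sin_hdist_eq0 z y : hyperboloid rho z -> hyperboloid rho y ->
  hdist rho z y < pi -> sin (hdist rho z y) = 0 -> z.1 = y.1.
Proof.
move=> zh yh hpi s0; have /andP[h0 _] := hdist_itv rho0 zh yh.
have hd0 : hdist rho z y = 0.
  apply/eqP; rewrite eq_le h0 andbT leNgt; apply/negP => hgt.
  by have := @sin_gt0_pi R (hdist rho z y); rewrite hgt hpi s0 ltxx => /(_ isT).
have := cos_hdist rho0 zh yh; rewrite hd0 cos0 => c1.
have zz := harg_self rho0 zh; have yy := harg_self rho0 yh.
have sq0 : sqdist z.1 y.1 <= 0.
  rewrite sqdistE !enorm_sqr; rewrite /harg in c1 zz yy.
  have := sqr_ge0 (hcos rho z.2 - hcos rho y.2); lra.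
apply: eq_from_tnth => i; apply/eqP; rewrite -subr_eq0 -sqrf_eq0 eq_le sqr_ge0 andbT.
by rewrite (le_trans (sqdist_ge _ _ _)).
Qed.

Variable gamma : R.
Hypothesis gamma0 : 0 <= gamma.

(* For gamma <= K, |g| can drop by at most a factor 2 within distance
   1 / (local_const K * n) of a near-maximiser. *)
Definition local_const K : nat := (4 * K.+1 * 2 ^ K.+1)%N.

Lemma local_const_gt0 K : (0 < local_const K)%N.
Proof. by rewrite /local_const !muln_gt0 expn_gt0. Qed.

Lemma even_poly_local K n g z y : (0 < n)%N -> gamma <= K%:R -> even_polys rho n g ->
  hyperboloid rho z ->
  (forall y', hyperboloid rho y' ->
    g y' ^+ 2 * weight0n rho gamma n y'.2 <= 2 * (g z ^+ 2 * weight0n rho gamma n z.2)) ->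
  hball rho z (local_const K * n)%:R^-1 y -> g z ^+ 2 <= 4 * g y ^+ 2.
Proof.
move=> n0 gK gn zh gmax [yh _ yr].
have n0' : 0 < n%:R :> R by rewrite ltr0n.
have K0' : 0 < K.+1%:R :> R by rewrite ltr0n.
have P0 : 0 < 2 ^+ K.+1 :> R by rewrite exprn_gt0.
have AE : (local_const K * n)%:R = 4 * K.+1%:R * 2 ^+ K.+1 * n%:R :> R.
  by rewrite /local_const !natrM natrX.
have /andP[h0 hpi] := hdist_itv rho0 zh yh.
have pi2 := pi_ge2 R.
(* A vanishing sine determines no great circle. Since the distance is at most 1 < pi, the two points
   then share x, and the even function g takes the same value at both. *)
have [s0|s0] := eqVneq (sin (hdist rho z y)) 0.
  have hlt : hdist rho z y < pi.
    apply: le_lt_trans yr _; apply: (@le_lt_trans _ _ 1); last lra.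
    by rewrite invf_le1 ?ler1n ?ltr0n muln_gt0 n0 andbT /local_const !muln_gt0 expn_gt0.
  have E := sin_hdist_eq0 zh yh hlt s0.
  rewrite (even_poly_abs gn zh) (even_poly_abs gn yh) -(lift_heightE zh) -(lift_heightE yh) E.
  by have := sqr_ge0 (g (y.1, lift_height y.1)); lra.
have [u [b [u1 ub uy]]] := even_poly_great_circle zh yh s0.
set th := hdist rho z y in yr h0 hpi s0 uy.
set a := hcos rho z.2 in ub.
have x1 : enorm z.1 ^+ 2 + a ^+ 2 = 1.
  by have := harg_self rho0 zh; rewrite /harg -enorm_sqr -expr2.
pose X r := comb (cos r) z.1 (sin r) u.
pose T r := g (X r, lift_height (X r)).
have Tt : trigpoly n T := great_circle_trigpoly x1 u1 ub gn.
have X0 : X 0 = z.1.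
  by apply: eq_from_tnth => i; rewrite tnth_mktuple cos0 sin0 mul1r mul0r addr0.
have T0 : T 0 = g z by rewrite /T X0 (lift_heightE zh) -(even_poly_abs gn zh).
have Tth : T th = g y by rewrite /T [X th]uy (lift_heightE yh) -(even_poly_abs gn yh).
pose q (r : R) : R := (jackson n).[cos r].
have q1 r : q r ^+ 2 <= 1 by apply: jackson_le1; rewrite cos_geN1 cos_le1.
pose Q (r : R) : R := q r ^+ K.
have Qt : trigpoly (n * K) Q by apply: trigpolyX; apply: trigpoly_horner; exact: size_jackson.
have TQt : trigpoly (n + n * K) (fun r => T r * Q r) by exact: trigpolyM.
have bound r : `|T r * Q r| <= 2 ^+ K.+1 * `|T 0|.
  (* [D] is the squared chord. Since a^2 <= 2 w^2 + 2 (a - w)^2 and (a - w)^2 <= D = n^2 D n^-2, the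
     base of the power [weight0n] at z is at most B times its base at arc r. *)
  pose D := 2 - 2 * cos r; pose B := 2 * (1 + n%:R ^+ 2 * D).
  have D0 : 0 <= D by have := cos_le1 r; rewrite /D; lra.
  have n2D : 0 <= n%:R ^+ 2 * D by rewrite mulr_ge0// sqr_ge0.
  have B1 : 1 <= B by rewrite /B; lra.
  have hX := hyperboloid_lift (great_circle_le1 x1 u1 ub r).
  pose w := cos r * a + sin r * b.
  have wE : 1 + rho ^+ 2 - lift_height (X r) ^+ 2 = w ^+ 2.
    have := great_circle_norm x1 u1 ub r.
    by rewrite lift_height_sqr -/w -/(X r); lra.
  have ch := great_circle_chord x1 u1 ub r.
  pose N : R := n%:R ^- 2.
  have N0 : 0 < N by rewrite invr_gt0 exprn_gt0.
  have nN : n%:R ^+ 2 * N = 1 by rewrite mulfV// gt_eqF// exprn_gt0.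
  have L1 : a ^+ 2 + N <= B * (w ^+ 2 + N).
    have : 0 <= n%:R ^+ 2 * D * w ^+ 2 by rewrite mulr_ge0// sqr_ge0.
    have : D = n%:R ^+ 2 * D * N by rewrite mulrAC nN mul1r.
    have : 0 <= (a - 2 * w) ^+ 2 by exact: sqr_ge0.
    rewrite -/w -/D in ch; rewrite /B; lra.
  have w0 : 0 < w ^+ 2 + N by rewrite ltr_wpDl ?sqr_ge0.
  have L2 : weight0n rho gamma n z.2 <= B ^+ K * weight0n rho gamma n (lift_height (X r)).
    rewrite /weight0n wE -(hcos_sqr zh) -/a -/N.
    apply: (@le_trans _ _ ((B * (w ^+ 2 + N)) `^ gamma)).
      apply: ge0_ler_powR; rewrite ?nnegrE//.
        by rewrite addr_ge0 ?sqr_ge0 ?ltW.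
      by rewrite mulr_ge0 ?(le_trans ler01 B1)// ltW.
    rewrite powRM ?(le_trans ler01 B1) ?(ltW w0)//.
    rewrite ler_wpM2r ?powR_ge0// -powR_mulrn ?(le_trans ler01 B1)//.
    exact: ler_powR.
  have T2 : T r ^+ 2 <= 2 * (T 0 ^+ 2 * B ^+ K).
    have Lpos : 0 < weight0n rho gamma n (lift_height (X r)).
      by rewrite /weight0n wE powR_gt0.
    rewrite -(ler_pM2r Lpos); apply: le_trans (gmax _ hX) _.
    by rewrite T0; have := ler_wpM2l (sqr_ge0 (g z)) L2; lra.
  (* Both q^2 and n^2 D q^2 are at most 1, by [jackson_le1] and [jackson_decay]. Hence the K factors
     in [Q] offset the growth B^K that near-maximality allows for T^2. *)
  have Bq : B * q r ^+ 2 <= 4.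
    have := @jackson_decay R n (cos r); rewrite cos_geN1 cos_le1 => /(_ isT).
    rewrite -/(q r) => h.
    have : 0 <= q r ^+ 2 * D * (4 * n%:R + 1).
      by apply: mulr_ge0; [rewrite mulr_ge0// sqr_ge0|rewrite addr_ge0// mulr_ge0].
    have := q1 r; rewrite /B /D in D0 *; lra.
  suff : `|T r * Q r| ^+ 2 <= (2 ^+ K.+1 * `|T 0|) ^+ 2.
    by rewrite ler_sqr// nnegrE mulr_ge0// ltW.
  rewrite real_normK ?num_real// exprMn [leRHS]exprMn real_normK ?num_real//.
  have -> : Q r ^+ 2 = (q r ^+ 2) ^+ K by rewrite /Q -!exprM mulnC.
  apply: (@le_trans _ _ (2 * (T 0 ^+ 2 * B ^+ K) * (q r ^+ 2) ^+ K)).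
    by rewrite ler_wpM2r// exprn_ge0// sqr_ge0.
  have -> : 2 * (T 0 ^+ 2 * B ^+ K) * (q r ^+ 2) ^+ K = 2 * (T 0 ^+ 2 * (B * q r ^+ 2) ^+ K).
    by rewrite [(B * _) ^+ K]exprMn !mulrA.
  have -> : (2 ^+ K.+1) ^+ 2 = 4 ^+ K.+1 :> R.
    by rewrite -exprM mulnC exprM; congr (_ ^+ _); ring.
  have h4 : (B * q r ^+ 2) ^+ K <= 4 ^+ K.
    by rewrite lerXn2r ?nnegrE// mulr_ge0 ?sqr_ge0// (le_trans ler01).
  have T00 := sqr_ge0 (T 0).
  have := ler_wpM2l T00 h4; rewrite [4 ^+ K.+1]exprS => h5.
  have : 0 <= T 0 ^+ 2 * 4 ^+ K by rewrite mulr_ge0// exprn_ge0.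
  lra.
have := bernstein TQt bound th 0; rewrite subr0 (ger0_norm h0).
rewrite (_ : Q 0 = 1); last by rewrite /Q /q cos0 jackson1 expr1n.
rewrite mulr1 => h.
(* Bernstein's inequality at degree n (K + 1) with bound 2^(K+1) |T 0| has constant 2 n (K + 1)
   2^(K+1) |T 0|; [local_const] is chosen so that its inverse leaves one half of |T 0|. *)
have h2 : `|T th * Q th - T 0| <= `|T 0| / 2.
  apply: le_trans h _.
  apply: (@le_trans _ _ (2 * (n + n * K)%:R * (2 ^+ K.+1 * `|T 0|) * (local_const K * n)%:R^-1)).
    by rewrite ler_wpM2l// !mulr_ge0// exprn_ge0.
  rewrite AE -mulnS natrM le_eqVlt; apply/orP; left; apply/eqP.
  by field; rewrite !gt_eqF.
have Q1 : `|Q th| <= 1.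
  rewrite /Q normrX exprn_ile1// -(@expr_le1 _ 2)// real_normK ?num_real//.
have h3 : `|T th * Q th| <= `|T th| by rewrite normrM ler_piMr.
have h4 : `|T 0| <= 2 * `|T th|.
  by have := ler_distD (T th * Q th) (T 0) 0; rewrite !subr0 distrC; lra.
rewrite -T0 -Tth -(real_normK (num_real (T 0))) -(real_normK (num_real (T th))).
have := normr_ge0 (T 0); have := normr_ge0 (T th); move: `|T 0| `|T th| h4 => p r h5 r0 p0.
have : p ^+ 2 <= (2 * r) ^+ 2 by rewrite lerXn2r ?nnegrE// mulr_ge0.
by lra.
Qed.

End even_polynomials.

(** * Lower bound *)

Section christoffel_lower.
Context {R : realType} {d : nat}.
Local Notation RT := (measurableTypeR R).
Local Notation space := (ambient R d).
Variable rho : R.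
Hypothesis rho0 : 0 <= rho.
Hypothesis d0 : (0 < d)%N.
Implicit Types (z y : space) (g w : space -> R) (n K : nat).

Lemma enorm_le1 z : hyperboloid rho z -> enorm z.1 <= 1.
Proof.
move=> zh; have [_ zr] := zh; rewrite (enorm_hyperboloid zh).
rewrite -(@expr_le1 _ 2) ?sqrtr_ge0//; have := hrad_hcos rho0 zr.
have := sqr_ge0 (hcos rho z.2); lra.
Qed.

Lemma even_poly_bounded g n : even_polys rho n g ->
  exists2 B : R, 0 <= B & forall y, hyperboloid rho y -> `|g y| <= B.
Proof.
move=> [[p _ pE] _]; pose b := Num.sqrt (rho ^+ 2 + 1).
have b1 : 1 <= b by rewrite -[leLHS]sqrtr1 ler_wsqrtr// lerDr sqr_ge0.
have [B HB] := eval_poly_bounded p b1.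
exists `|B| => // y yh; rewrite pE//; apply: le_trans (ler_norm B).
apply: HB; last by case: yh => _ /andP[].
move=> i; apply: le_trans b1; have := enorm_le1 yh => y1.
rewrite -(@expr_le1 _ 2)// real_normK ?num_real// (le_trans (tnth_sqr_le _ i))//.
by rewrite -enorm_sqr expr_le1// enorm_ge0.
Qed.

Lemma measurable_even_poly g n : even_polys rho n g ->
  measurable_fun (hyperboloid rho : set space) g.
Proof.
move=> [[p _ pE] _]; apply: (eq_measurable_fun (eval_poly p)).
  by move=> y /set_mem yh; rewrite pE.
by apply: measurable_funTS; exact: measurable_eval_poly.
Qed.

Lemma le_integral_ball g n w z r (a : R) : 0 <= a -> hyperboloid rho z ->
  even_polys rho n g -> measurable_fun (hyperboloid rho) w ->
  (forall y, hyperboloid rho y -> 0 <= w y) ->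
  (forall y, hball rho z r y -> a <= `|g y| ^+ 2) ->
  (a%:E * weighted rho w (hball rho z r) <=
    \int[hyperboloid_measure rho]_(y in hyperboloid rho) (`|g y| ^+ 2 * w y)%:E)%E.
Proof.
move=> a0 zh ge mw w0 ga.
have mB := measurable_hball rho0 r zh; have mX := @measurable_hyperboloid R d rho.
have sub : hball rho z r `<=` hyperboloid rho by move=> y [].
have mg := measurable_even_poly ge.
have mgw : measurable_fun (hyperboloid rho) (fun y => (`|g y| ^+ 2 * w y)%:E).
  apply/measurable_EFinP; apply: measurable_funM => //; apply: measurable_funX.
  exact: (measurableT_comp (@normr_measurable R setT)).
have mwB : measurable_fun (hball rho z r) (EFin \o w).
  by apply/measurable_EFinP; exact: measurable_funS mw.
have gw0 y : hyperboloid rho y -> (0 <= (`|g y| ^+ 2 * w y)%:E)%E.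
  by move=> yh; rewrite lee_fin mulr_ge0 ?exprn_ge0// w0.
apply: le_trans (ge0_subset_integral _ mB mX mgw gw0 sub).
have wB y : hball rho z r y -> (0 <= (EFin \o w) y)%E by move=> /sub/w0; rewrite lee_fin.
rewrite /weighted -(ge0_integralZl _ mB mwB wB) ?lee_fin//.
apply: ge0_le_integral => //.
- by move=> y yB; rewrite mule_ge0 ?lee_fin// w0//; exact: sub.
- by apply: emeasurable_funM.
- exact: measurable_funS mgw.
- by move=> y yB; rewrite -EFinM lee_fin ler_wpM2r ?ga// w0//; exact: sub.
Qed.

Variable gamma : R.
Hypothesis gamma0 : 0 <= gamma.

Lemma weight0nE z n : hyperboloid rho z ->
  weight0n rho gamma n z.2 = (hcos rho z.2 ^+ 2 + n%:R^-1 ^+ 2) `^ gamma.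
Proof. by move=> zh; rewrite /weight0n (hcos_sqr rho0 zh) exprVn. Qed.

(** Boundedness replaces attainment of the maximum: the supremum is positive, so some value exceeds
    half of it. *)
Lemma near_maximum (T : Type) (X : set T) (f : T -> R) (B : R) (x : T) :
  X x -> 0 < f x -> (forall y : T, X y -> f y <= B) ->
  exists2 y : T, X y & forall y' : T, X y' -> f y' <= 2 * f y.
Proof.
move=> Xx fx fB; pose E := f @` X.
have hE : has_sup E.
  split; first by exists (f x); exists x.
  by exists B; move=> _ [y Xy <-]; exact: fB.
have s0 : 0 < sup E by apply: lt_le_trans fx _; apply: ub_le_sup; [case: hE|exists x].
have [_ [y Xy <-] ys] := sup_adherent (divr_gt0 s0 (ltr0n R 2)) hE.
exists y => // y' Xy'.
have : f y' <= sup E by apply: ub_le_sup; [case: hE|exists y'].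
lra.
Qed.

(** On the ball of radius 1 / (A n) at the near-maximiser y, g^2 is at least a quarter of its value
    at y, and the ball has weighted measure of order n^-d [weight0n] at y. Near-maximality compares
    the product of both with the one at z, where g = 1. *)
Lemma even_poly_integral_ge : exists2 c : R, 0 < c & forall n z g, (0 < n)%N ->
  hyperboloid rho z -> even_polys rho n g -> g z = 1 ->
  ((c * (n%:R ^- d * weight0n rho gamma n z.2))%:E <=
   \int[hyperboloid_measure rho]_(y in hyperboloid rho)
     (`|g y| ^+ 2 * weight0 rho gamma y)%:E)%E.
Proof.
pose K := (Num.truncn gamma).+1.
have gK : gamma <= K%:R by rewrite ltW// truncnS_gt.
pose A := local_const K; have A0 : (0 < A)%N by exact: local_const_gt0.
have AR : 0 < A%:R :> R by rewrite ltr0n.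
have [c c0 cw] := weighted0_ge rho0 gamma0 d0.
(* The factor lost in the weight when the radius shrinks from 1 / n to 1 / (A n). *)
pose D := (A%:R^-1 ^+ 2) `^ gamma : R.
have D0 : 0 < D by rewrite powR_gt0// exprn_gt0// invr_gt0.
(* Here 8 = 4 * 2: the drop of g^2 on the ball and the factor of near-maximality. *)
exists (c * A%:R^-1 ^+ d * D / 8).
  by rewrite divr_gt0// !mulr_gt0// exprn_gt0// invr_gt0.
move=> n z g n0 zh ge gz.
have nR : 0 < n%:R :> R by rewrite ltr0n.
have L0 y : hyperboloid rho y -> 0 < weight0n rho gamma n y.2.
  by move=> yh; rewrite weight0nE// powR_gt0// ltr_wpDl ?sqr_ge0// exprn_gt0// invr_gt0.
have [B B0 gB] := even_poly_bounded ge.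
have [y yh ymax] : exists2 y, hyperboloid rho y & forall y', hyperboloid rho y' ->
    g y' ^+ 2 * weight0n rho gamma n y'.2 <= 2 * (g y ^+ 2 * weight0n rho gamma n y.2).
  apply: (@near_maximum _ (hyperboloid rho) (fun y => g y ^+ 2 * weight0n rho gamma n y.2)
    (B ^+ 2 * (1 + n%:R^-1 ^+ 2) `^ gamma) z) => //.
    by rewrite gz expr1n mul1r L0.
  move=> y' yh'; apply: ler_pM; first exact: sqr_ge0.
  - exact/ltW/L0.
  - by rewrite -(real_normK (num_real (g y'))) lerXn2r ?nnegrE ?gB.
  rewrite weight0nE//; apply: ge0_ler_powR => //; rewrite ?nnegrE ?addr_ge0 ?sqr_ge0//.
  rewrite lerD2r; have [_ yr] := yh'; have := hrad_hcos rho0 yr.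
  by have := sqr_ge0 (hrad rho y'.2); lra.
have dl : 0 < ((A * n)%:R^-1 : R) <= 1.
  by rewrite invr_gt0 ltr0n muln_gt0 A0 n0/= invf_le1 ?ler1n ?ltr0n muln_gt0 A0 n0.
have a0 : 0 <= g y ^+ 2 / 4 by rewrite divr_ge0// sqr_ge0.
apply: le_trans (le_integral_ball (r := (A * n)%:R^-1) a0 yh ge _ _ _).
- apply: le_trans (lee_wpmul2l _ (cw y _ yh dl)); last by rewrite lee_fin.
  rewrite -EFinM lee_fin natrM invfM exprMn.
  have LL : D * weight0n rho gamma n y.2 <=
      (hcos rho y.2 ^+ 2 + (A%:R^-1 * n%:R^-1) ^+ 2) `^ gamma.
    rewrite weight0nE// -powRM ?addr_ge0 ?sqr_ge0//.
    apply: ge0_ler_powR => //; rewrite ?nnegrE ?sqr_ge0 ?mulr_ge0 ?addr_ge0 ?sqr_ge0//.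
    rewrite mulrDr [(_ * n%:R^-1) ^+ 2]exprMn lerD2r ler_piMl ?sqr_ge0//.
    by rewrite expr_le1 ?invr_ge0// invf_le1// ler1n.
  have h := ymax z zh; rewrite gz expr1n mul1r in h.
  pose U := c * A%:R^-1 ^+ d * n%:R^-1 ^+ d.
  have U0 : 0 <= U.
    by apply: mulr_ge0; [apply: mulr_ge0; first exact: ltW|]; rewrite exprn_ge0// invr_ge0.
  rewrite [leLHS](_ : _ = U * D / 8 * weight0n rho gamma n z.2); last first.
    by rewrite /U -[n%:R ^- d]exprVn; ring.
  rewrite [leRHS](_ : _ = U * (g y ^+ 2 / 4) *
    (hcos rho y.2 ^+ 2 + (A%:R^-1 * n%:R^-1) ^+ 2) `^ gamma); last by rewrite /U exprMn; ring.
  apply: (@le_trans _ _ (U * (g y ^+ 2 / 4) * (D * weight0n rho gamma n y.2))).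
    have UD : 0 <= U * D by rewrite mulr_ge0// ltW.
    by have := ler_wpM2l UD h; lra.
  by rewrite ler_wpM2l// mulr_ge0.
- by apply: measurable_funTS; exact: measurable_weight0.
- by move=> y' _; rewrite weight0E height_weight_ge0.
move=> y' yB; rewrite real_normK ?num_real//.
have := even_poly_local rho0 gamma0 n0 gK ge yh ymax yB; lra.
Qed.

Lemma weighted0_equiv : exists c1 c2 : R, [/\ 0 < c1, 0 < c2 &
  forall n z, (0 < n)%N -> hyperboloid rho z ->
  (c1%:E * weighted rho (weight0 rho gamma) (hball rho z n%:R^-1) <=
     (n%:R ^- d * weight0n rho gamma n z.2)%:E <=
     c2%:E * weighted rho (weight0 rho gamma) (hball rho z n%:R^-1))%E].
Proof.
have [c c0 cw] := weighted0_ge rho0 gamma0 d0.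
have [C C0 Cw] := weighted0_le rho0 gamma0 d0.
exists C^-1, c^-1; rewrite !invr_gt0; split => // n z n0 zh.
have dl : 0 < (n%:R^-1 : R) <= 1 by rewrite invr_gt0 ltr0n n0/= invf_le1 ?ler1n ?ltr0n.
rewrite weight0nE// -[n%:R ^- d]exprVn; apply/andP; split.
  apply: le_trans (lee_wpmul2l _ (Cw z _ zh dl)) _; first by rewrite lee_fin invr_ge0 ltW.
  by rewrite -EFinM lee_fin -!mulrA mulKf ?gt_eqF.
apply: le_trans (lee_wpmul2l _ (cw z _ zh dl)); last by rewrite lee_fin invr_ge0 ltW.
by rewrite -EFinM lee_fin -!mulrA mulKf ?gt_eqF.
Qed.

Lemma christoffel0_ge : exists2 c : R, 0 < c & forall n z, (0 < n)%N ->
  hyperboloid rho z ->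
  (c%:E * weighted rho (weight0 rho gamma) (hball rho z n%:R^-1) <=
    christoffel rho (weight0 rho gamma) n z)%E.
Proof.
have [c c0 cw] := even_poly_integral_ge.
have [c1 [c2 [c10 c20 c12]]] := weighted0_equiv.
exists (c * c1); first exact: mulr_gt0.
move=> n z n0 zh; apply: le_ereal_inf_tmp => _ [g [ge gz] <-].
apply: le_trans (cw n z g n0 zh ge gz).
rewrite EFinM -muleA EFinM; apply: lee_wpmul2l; first by rewrite lee_fin ltW.
by have /andP[] := c12 n z n0 zh.
Qed.

End christoffel_lower.

(** * Upper bound *)

Section test_functions.
Context {R : realType} {d : nat}.
Local Notation RT := (measurableTypeR R).
Local Notation space := (ambient R d).
Variable rho : R.
Hypothesis rho0 : 0 <= rho.
Implicit Types (z y : space) (g w : space -> R) (n k m : nat) (P : {poly R}).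

(** The cosine of the distance from y to the reflection of z in the equator of the unit sphere. *)
Definition harg_opp z y : R := dotprod z.1 y.1 - hcos rho z.2 * hcos rho y.2.

Lemma polyfun_dotprod z : polyfun 1 (fun y => dotprod z.1 y.1).
Proof.
apply: polyfun_sum => i _; apply: polyfunZ; exact: polyfun_coord.
Qed.

(* Newton's recursion: the sum 2<x,y> of the two arguments and their product, in
   which hcos occurs squared, are polynomials. *)
Lemma polyfun_sym_power z i : exists2 h, polyfun i h & forall y, hyperboloid rho y ->
  h y = harg rho z y ^+ i + harg_opp z y ^+ i.
Proof.
elim/dirichlet_ind: i => [||i [h0 ph0 h0E] [h1 ph1 h1E]].
- by exists (fun=> 2); [exact: polyfun_cst|move=> y _; rewrite !expr0].
- exists (fun y => 2 * dotprod z.1 y.1); first exact: polyfunZ (polyfun_dotprod z).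
  by move=> y _; rewrite !expr1 /harg /harg_opp; ring.
exists (fun y => 2 * dotprod z.1 y.1 * h1 y + - 1 * ((dotprod z.1 y.1 ^+ 2 +
    (- hcos rho z.2 ^+ 2) * (1 + rho ^+ 2 + -1 * (y.2 * y.2))) * h0 y)).
  apply: polyfunD; first by rewrite -add1n; apply: polyfunM => //; exact: polyfunZ (polyfun_dotprod z).
  apply: polyfunZ; rewrite -add2n; apply: polyfunM => //; apply: polyfunD.
    apply: polyfun_ext (polyfunM (polyfun_dotprod z) (polyfun_dotprod z)) => y.
    by rewrite expr2.
  apply: polyfunZ; apply: polyfunD; first exact: polyfun_cst.
  by apply: polyfunZ; apply: (@polyfunM _ _ 1 1); exact: polyfun_height.
move=> y yh; rewrite h1E// h0E//.
have E : 1 + rho ^+ 2 + -1 * (y.2 * y.2) = hcos rho y.2 ^+ 2 by rewrite hcos_sqr// expr2; ring.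
rewrite E !exprS /harg /harg_opp; ring.
Qed.

Lemma polyfun_sym_horner z P n : (size P <= n.+1)%N -> exists2 h, polyfun n h &
  forall y, hyperboloid rho y -> h y = P.[harg rho z y] + P.[harg_opp z y].
Proof.
(* The existence statements are repackaged as conjunctions, so that [choice] yields one function for
   each power. *)
move=> Pn; have [e eP] := choice (fun i => let: ex_intro2 h ph hE := polyfun_sym_power z i in
  ex_intro (fun h => polyfun i h /\ forall y, hyperboloid rho y ->
    h y = harg rho z y ^+ i + harg_opp z y ^+ i) h (conj ph hE)).
exists (fun y => \sum_(i < n.+1) P`_i * e i y).
  apply: polyfun_sum => i _; apply: polyfunZ.
  by apply: polyfun_le (eP i).1; rewrite -ltnS.
move=> y yh; rewrite !(horner_coef_wide _ Pn) -big_split; apply: eq_bigr => i _ /=.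
by rewrite (eP i).2// mulrDr.
Qed.

Lemma harg_opp_itv z y : hyperboloid rho z -> hyperboloid rho y -> -1 <= harg_opp z y <= 1.
Proof.
move=> zh yh; rewrite -ler_norml; have [_ zr] := zh; have [_ yr] := yh.
apply: (@le_trans _ _ (cos (hangle rho z.2 - hangle rho y.2))); last exact: cos_le1.
rewrite cos_hangleB//; apply: le_trans (ler_normB _ _) _; rewrite lerD//.
  by rewrite -(enorm_hyperboloid zh) -(enorm_hyperboloid yh); exact: cauchy_schwarz.
by rewrite ger0_norm// mulr_ge0// sqrtr_ge0.
Qed.

Lemma harg_opp_le z y : harg_opp z y <= harg rho z y.
Proof.
rewrite /harg_opp /harg; have : 0 <= hcos rho z.2 * hcos rho y.2 by rewrite mulr_ge0 ?sqrtr_ge0.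
lra.
Qed.

(** Since n r = 2^k, the left-hand side is (n r)^2 <= 8 n^2 (1 - x), and n <= 2 kappa (2 m + 1)
    trades n for m; the constant is 8 * 4 * 2. *)
Lemma pow4_le_sqr_decay (kappa : nat) n k m r (x : R) : (0 < kappa)%N -> (0 < n)%N ->
  n%:R <= 2 * kappa%:R * (2 * m%:R + 1) :> R -> r = 2 ^+ k * n%:R^-1 :> R ->
  r ^+ 2 / 8 <= 1 - x -> 
  4 ^+ k <= 64 * kappa%:R ^+ 2 * ((2 * m%:R + 1) ^+ 2 * (1 - x) / 2).
Proof.
move=> k0 n0 nm rE rx; have nR : 0 < n%:R :> R by rewrite ltr0n.
have m0 : 0 < 2 * m%:R + 1 :> R by exact: odd_natr_gt0.
have E : 4 ^+ k = (r * n%:R) ^+ 2.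
  rewrite rE divfK ?gt_eqF// -exprM mulnC exprM; congr (_ ^+ _); ring.
rewrite E exprMn.
have x0 : 0 <= 1 - x by apply: le_trans rx; rewrite divr_ge0 ?sqr_ge0.
apply: (@le_trans _ _ (8 * (1 - x) * n%:R ^+ 2)).
  by rewrite ler_wpM2r ?sqr_ge0//; lra.
apply: (@le_trans _ _ (8 * (1 - x) * (2 * kappa%:R * (2 * m%:R + 1)) ^+ 2)).
  by rewrite ler_wpM2l ?mulr_ge0// lerXn2r ?nnegrE// mulr_ge0// ltW.
by rewrite le_eqVlt; apply/orP; left; apply/eqP; field.
Qed.

(** The kernel to the power 2 kappa decays like (n distance)^(-2 kappa), so [|g| ^ 2] gains
    16^-kappa whenever the distance doubles. The exponent is even, so the symmetrised kernel [h] is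
    nonnegative with h z >= 1, and dividing by h z keeps all bounds. *)
Lemma test_function (kappa n : nat) z : (0 < kappa)%N -> (0 < n)%N -> hyperboloid rho z ->
  exists g, [/\ even_polys rho n g, g z = 1,
    forall y, hyperboloid rho y -> `|g y| ^+ 2 <= 4 &
    forall k y, hyperboloid rho y -> 2 ^+ k * n%:R^-1 < hdist rho z y ->
      `|g y| ^+ 2 <= 4 * (64 * kappa%:R ^+ 2) ^+ (2 * kappa) * (16 ^- kappa) ^+ k].
Proof.
move=> k0 n0 zh; pose m := (n %/ (2 * kappa))%N.
pose P : {poly R} := jackson m ^+ (2 * kappa).
have mn : (m * (2 * kappa) <= n)%N by exact: leq_trunc_div.
have nm : n%:R <= 2 * kappa%:R * (2 * m%:R + 1) :> R.
  have : (n < m.+1 * (2 * kappa))%N by rewrite /m ltn_ceil// muln_gt0.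
  rewrite -(ltr_nat R) !natrM -natr1 => h; have : 0 <= kappa%:R * m%:R :> R by rewrite mulr_ge0.
  lra.
have sP : (size P <= n.+1)%N.
  apply: leq_trans (size_poly_exp_leq _ _) _; rewrite ltnS.
  apply: leq_trans mn; rewrite leq_mul2r; apply/orP; right.
  have := @size_jackson R m; lia.
have PE x : P.[x] = ((jackson m).[x] ^+ 2) ^+ kappa by rewrite horner_exp exprM.
have P0 x : 0 <= P.[x] by rewrite PE exprn_ge0 ?sqr_ge0.
have Ple1 x : -1 <= x <= 1 -> P.[x] <= 1.
  by move=> xi; rewrite PE exprn_ile1 ?sqr_ge0// jackson_le1.
have [h ph hE] := polyfun_sym_horner z sP.
have [p pn pE] := ph.
have hz1 : 1 <= h z.
  by rewrite hE// harg_self// horner_exp jackson1 expr1n lerDl.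
have hz0 : 0 < h z by exact: lt_le_trans ltr01 hz1.
have h0 y : hyperboloid rho y -> 0 <= h y by move=> yh; rewrite hE// addr_ge0.
have hle y : hyperboloid rho y -> `|h y / h z| <= h y.
  move=> yh; rewrite ger0_norm ?divr_ge0 ?h0// ?(ltW hz0)// ler_pdivrMr//.
  by rewrite ler_peMr// h0.
exists (fun y => h y / h z); split.
- split.
    have [p' p'n p'E] := polyfunZ (h z)^-1 ph.
    by exists p' => // y yh; rewrite -p'E mulrC.
  move=> x t xh; have xh' : hyperboloid rho (x, - t) by have /hyperboloid_hflip := xh.
  by rewrite !hE// /harg /harg_opp/= hcosN.
- by rewrite divff// gt_eqF.
- move=> y yh; have := hle y yh => hy.
  have h2 : h y <= 2.
    rewrite hE// (_ : 2 = 1 + 1)//; apply: lerD; apply: Ple1.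
      exact: harg_itv.
    exact: harg_opp_itv.
  rewrite (_ : 4 = 2 ^+ 2); last by ring.
  by rewrite lerXn2r ?nnegrE//; apply: le_trans h2.
move=> k y yh hd; have := hle y yh => hy.
have ci := harg_itv rho0 zh yh; have ci' := harg_opp_itv zh yh; have cc := harg_opp_le z y.
have /andP[dpi0 dpi] := hdist_itv rho0 zh yh.
set r := 2 ^+ k * n%:R^-1 in hd.
have r0 : 0 <= r by rewrite mulr_ge0 ?exprn_ge0// invr_ge0.
have cr : r ^+ 2 / 8 <= 1 - harg rho z y.
  have h1 := @one_sub_cos_ge R r ltac:(lra).
  apply: le_trans h1 _; rewrite lerD2l lerN2 -(cos_hdist rho0 zh yh) ler_cos; lra.
pose D := 64 * kappa%:R ^+ 2 : R.
have D0 : 0 < D by rewrite mulr_gt0// exprn_gt0// ltr0n.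
have key x : -1 <= x <= 1 -> x <= harg rho z y -> P.[x] * (4 ^+ k) ^+ kappa <= D ^+ kappa.
  move=> xi xh.
  have h1 := @pow4_le_sqr_decay kappa n k m r x k0 n0 nm erefl ltac:(lra).
  have h2 := @jackson_decay R m x xi.
  apply: (@le_trans _ _ (P.[x] * (D * ((2 * m%:R + 1) ^+ 2 * (1 - x) / 2)) ^+ kappa)).
    rewrite ler_wpM2l// lerXn2r ?nnegrE ?exprn_ge0// (le_trans _ h1)// exprn_ge0//.
  rewrite PE -exprMn lerXn2r ?nnegrE ?(ltW D0)//.
    rewrite mulr_ge0 ?sqr_ge0// (le_trans _ h1)// exprn_ge0//.
  have := ler_wpM2l (ltW D0) h2; lra.
have hk : h y * (4 ^+ k) ^+ kappa <= 2 * D ^+ kappa.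
  rewrite hE// mulrDl; have := key _ ci (lexx _); have := key _ ci' cc; lra.
have F0 : 0 < (4 ^+ k) ^+ kappa :> R by rewrite !exprn_gt0.
have hk2 : h y <= 2 * D ^+ kappa / (4 ^+ k) ^+ kappa by rewrite ler_pdivlMr.
apply: (@le_trans _ _ ((2 * D ^+ kappa / (4 ^+ k) ^+ kappa) ^+ 2)).
  by rewrite lerXn2r ?nnegrE// ?(le_trans hy)// (le_trans (h0 _ yh)).
rewrite le_eqVlt; apply/orP; left; apply/eqP.
rewrite -/D expr_div_n exprMn -!exprM (_ : 2 ^+ 2 = 4); last by ring.
rewrite [(kappa * 2)%N]mulnC exprVn -exprM; congr (_ * _ / _).
rewrite (_ : 16 = 4 ^+ 2); last by ring.
by rewrite -exprM [(2 * _)%N]mulnC [(kappa * k)%N]mulnC.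
Qed.

End test_functions.

Section doubling.
Context {R : realType} {d : nat}.
Local Notation RT := (measurableTypeR R).
Local Notation space := (ambient R d).
Variable rho : R.
Hypothesis rho0 : 0 <= rho.
Variables (w : space -> R) (L : R).
Hypothesis w0 : forall z, hyperboloid rho z -> 0 <= w z.
Hypothesis mw : measurable_fun (hyperboloid rho) w.
Hypothesis L0 : 0 < L.
Hypothesis doubling : forall z r, hyperboloid rho z -> 0 < r ->
  (weighted rho w (hball rho z (2 * r)) <= L%:E * weighted rho w (hball rho z r))%E.
Implicit Types (z y : space) (g : space -> R) (n k N : nat) (A : set space).
Local Open Scope ereal_scope.

Let sigma : {measure set space -> \bar R} := @hyperboloid_measure R d rho.

Lemma weighted_ge0 A : A `<=` hyperboloid rho -> 0 <= weighted rho w A.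
Proof. by move=> AX; apply: integral_ge0 => y /AX/w0; rewrite lee_fin. Qed.

Lemma weighted_dyadic z k r : hyperboloid rho z -> (0 < r)%R ->
  weighted rho w (hball rho z (2 ^+ k * r)) <= (L ^+ k)%:E * weighted rho w (hball rho z r).
Proof.
move=> zh r0; elim: k => [|k IH]; first by rewrite !expr0 mul1r mul1e.
rewrite !exprS -mulrA; apply: le_trans (doubling zh _) _.
  by rewrite mulr_gt0// exprn_gt0.
by rewrite EFinM -muleA lee_wpmul2l// lee_fin ltW.
Qed.

Lemma hball_le z (r s : R) : (r <= s)%R -> hball rho z r `<=` hball rho z s.
Proof. by move=> rs y [yh zy yr]; split => //; exact: le_trans rs. Qed.

Lemma weighted_le A B : measurable A -> measurable B -> A `<=` B ->
  B `<=` hyperboloid rho -> weighted rho w A <= weighted rho w B.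
Proof.
move=> mA mB AB BX; apply: ge0_subset_integral => //.
- by apply/measurable_EFinP; apply: measurable_funS mw => //; exact: measurable_hyperboloid.
- by move=> y /BX/w0; rewrite lee_fin.
Qed.

Section test.
Variables (g : space -> R) (n : nat) (C x : R).
Hypothesis gn : even_polys rho n g.
Hypothesis C0 : (0 <= C)%R.
Hypothesis x0 : (0 <= x)%R.
Hypothesis xL : (2 * (x * L) <= 1)%R.

Let f y : \bar R := (`|g y| ^+ 2 * w y)%:E.

Let mf A : measurable A -> A `<=` hyperboloid rho -> measurable_fun A f.
Proof.
move=> mA AX; apply/measurable_EFinP; apply: measurable_funS AX _.
  exact: measurable_hyperboloid.
apply: measurable_funM => //; apply: measurable_funX.
exact: (measurableT_comp (@normr_measurable R setT) (measurable_even_poly gn)).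
Qed.

Let f0 y : hyperboloid rho y -> 0 <= f y.
Proof. by move=> yh; rewrite lee_fin mulr_ge0 ?exprn_ge0// w0. Qed.

Lemma integral_test_le A (a : R) : measurable A -> A `<=` hyperboloid rho -> (0 <= a)%R ->
  (forall y, A y -> `|g y| ^+ 2 <= a)%R ->
  \int[sigma]_(y in A) f y <= a%:E * weighted rho w A.
Proof.
move=> mA AX a0 ga.
have mwA : measurable_fun A (EFin \o w).
  apply/measurable_EFinP; apply: measurable_funS mw => //; exact: measurable_hyperboloid.
have wA y : A y -> 0 <= (EFin \o w) y by move=> /AX/w0; rewrite lee_fin.
rewrite /weighted -(ge0_integralZl _ mA mwA wA) ?lee_fin//.
apply: ge0_le_integral => //.
- by move=> y /AX; exact: f0.
- exact: mf.
- by apply: emeasurable_funM.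
- by move=> y Ay; rewrite -EFinM lee_fin ler_wpM2r ?ga// w0//; exact: AX.
Qed.

Lemma integral_dyadic z r N : hyperboloid rho z -> (0 < r)%R ->
  (forall y, hyperboloid rho y -> `|g y| ^+ 2 <= 4)%R ->
  (forall k y, hyperboloid rho y -> 2 ^+ k * r < hdist rho z y ->
     `|g y| ^+ 2 <= C * x ^+ k)%R ->
  \int[sigma]_(y in hball rho z (2 ^+ N * r)) f y <=
  (4 + 2 * C * L * (1 - (x * L) ^+ N))%:E * weighted rho w (hball rho z r).
Proof.
move=> zh r0 g4 gC.
have mB s : measurable (hball rho z s) by exact: measurable_hball.
have BX s : hball rho z s `<=` hyperboloid rho by move=> y [].
have W0 : 0 <= weighted rho w (hball rho z r) by exact: weighted_ge0.
have xL0 : (0 <= x * L)%R by rewrite mulr_ge0// ltW.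
elim: N => [|N IH].
  rewrite !expr0 subrr mulr0 addr0 mul1r; apply: integral_test_le => //.
  by move=> y /BX/g4.
set B := hball rho z (2 ^+ N * r) in IH *; set B' := hball rho z (2 ^+ N.+1 * r).
have sBB : B `<=` B'.
  apply: hball_le; rewrite exprS -mulrA; apply: ler_peMl; last by rewrite ler1n.
  by rewrite mulr_ge0 ?exprn_ge0// ltW.
have mD : measurable (B' `\` B) by apply: measurableD; exact: mB.
have DX : B' `\` B `<=` hyperboloid rho by move=> y [/BX].
rewrite -(setDUK sBB) ge0_integral_setU; [|exact: mB|exact: mD| | |]; last 3 first.
- by rewrite setDUK//; apply: mf; [exact: mB|exact: BX].
- by rewrite setDUK// => y /BX; exact: f0.
- by apply/disj_setPS => y [? []].
have xN : (0 <= (x * L) ^+ N <= 1)%R.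
  by rewrite exprn_ge0//= exprn_ile1//; have := xL; lra.
have D2 : \int[sigma]_(y in B' `\` B) f y <=
    (C * L * (x * L) ^+ N)%:E * weighted rho w (hball rho z r).
  apply: le_trans (integral_test_le mD DX (_ : 0 <= C * x ^+ N)%R _) _.
  - by rewrite mulr_ge0// exprn_ge0.
  - move=> y [[yh zy yr] yB]; apply: gC => //; rewrite ltNge; apply/negP => h.
    exact: yB.
  apply: le_trans (lee_wpmul2l _ (weighted_le mD (mB _) (@subDsetl _ _ _) (BX _))) _.
    by rewrite lee_fin mulr_ge0// exprn_ge0.
  apply: le_trans (lee_wpmul2l _ (weighted_dyadic N.+1 zh r0)) _.
    by rewrite lee_fin mulr_ge0// exprn_ge0.
  by rewrite muleA -EFinM exprS exprMn mulrACA [(x ^+ N * _)%R]mulrC mulrA.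
apply: le_trans (leeD IH D2) _.
have CL : (0 <= C * L)%R by rewrite mulr_ge0// ltW.
have CLN : (0 <= C * L * (x * L) ^+ N)%R by rewrite mulr_ge0// exprn_ge0.
rewrite -ge0_muleDl ?lee_fin//; last first.
  rewrite addr_ge0// mulr_ge0 ?subr_ge0//; last by case/andP: xN.
  by rewrite -mulrA mulr_ge0.
rewrite -EFinD lee_wpmul2r// lee_fin exprS.
have := ler_wpM2l CLN xL; lra.
Qed.

End test.

Hypothesis w_even : forall z, hyperboloid rho z -> w (hflip z) = w z.

Lemma christoffel_doubling_le : exists2 c : R, (0 < c)%R &
  forall n z, (0 < n)%N -> hyperboloid rho z ->
  christoffel rho w n z <= c%:E * weighted rho w (hball rho z n%:R^-1).
Proof.
pose kappa := (Num.truncn L).+1.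
have Lk : (L < kappa%:R)%R by exact: truncnS_gt.
pose x : R := (16 ^- kappa)%R.
have x0 : (0 < x)%R by rewrite invr_gt0 exprn_gt0.
have xL : (2 * (x * L) <= 1)%R.
  rewrite mulrCA mulrC ler_pdivrMr ?exprn_gt0// mul1r.
  apply: (@le_trans _ _ (2 * kappa)%:R); first by rewrite natrM; lra.
  rewrite -natrX ler_nat; elim: (kappa) => // k IH.
  by rewrite expnS; lia.
pose C : R := (4 * (64 * kappa%:R ^+ 2) ^+ (2 * kappa))%R.
have C0 : (0 <= C)%R by rewrite mulr_ge0// exprn_ge0// mulr_ge0// exprn_ge0.
pose c1 : R := (4 + 2 * C * L)%R.
have c10 : (0 < c1)%R by rewrite ltr_wpDr// !mulr_ge0// ltW.
exists (2 * c1)%R; first exact: mulr_gt0.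
move=> n z n0 zh.
have [g [gn gz g4 gC]] := test_function rho0 (ltn0Sn _ : (0 < kappa)%N) n0 zh.
pose r : R := (n%:R^-1)%R; have r0 : (0 < r)%R by rewrite invr_gt0 ltr0n.
have zh' : hyperboloid rho (hflip z) by exact/hyperboloid_hflip.
have gC' k y : hyperboloid rho y -> (2 ^+ k * r < hdist rho (hflip z) y)%R ->
    (`|g y| ^+ 2 <= C * x ^+ k)%R by rewrite hdistE harg_hflipl -hdistE; exact: gC.
have D1 := integral_dyadic gn C0 (ltW x0) xL n.+2 zh r0 g4 gC.
have D2 := integral_dyadic gn C0 (ltW x0) xL n.+2 zh' r0 g4 gC'.
rewrite (weighted_hflip _ rho0 zh mw w0 w_even) in D2.
have big : (pi <= 2 ^+ n.+2 * r)%R.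
  rewrite ler_pdivlMr ?ltr0n//; have := pihalf_lt2 R => p2.
  apply: (@le_trans _ _ (4 * n%:R)%R); first by rewrite ler_wpM2r//; lra.
  rewrite !exprS mulrA (_ : (2 * 2 = 4 :> R)%R); last by ring.
  by rewrite ler_wpM2l// -natrX ler_nat ltnW// ltn_expl.
set B := hball rho z (2 ^+ n.+2 * r) in D1; set B' := hball rho (hflip z) (2 ^+ n.+2 * r) in D2.
have mB : measurable B by exact: measurable_hball.
have mB' : measurable B' by exact: measurable_hball.
have mX := @measurable_hyperboloid R d rho.
have BX : B `<=` hyperboloid rho by move=> y [].
have BX' : B' `<=` hyperboloid rho by move=> y [].
have cover y : hyperboloid rho y -> B y \/ B' y.
  move=> yh; have Bd : (hdist rho z y <= 2 ^+ n.+2 * r)%R.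
    by apply: le_trans big; have /andP[] := hdist_itv rho0 zh yh.
  have Bd' : (hdist rho (hflip z) y <= 2 ^+ n.+2 * r)%R by rewrite hdistE harg_hflipl.
  have [yz|yz] : same_part z y \/ same_part (hflip z) y.
    rewrite /same_part/= oppr_ge0 oppr_le0.
    by case/orP: (le_total 0%R (z.2 : R)) => ?; case/orP: (le_total 0%R (y.2 : R)) => ?; tauto.
  - by left.
  - by right.
have mgw : measurable_fun (hyperboloid rho) (fun y => (`|g y| ^+ 2 * w y)%:E).
  apply/measurable_EFinP; apply: measurable_funM => //; apply: measurable_funX.
  exact: (measurableT_comp (@normr_measurable R setT) (measurable_even_poly gn)).
have gw0 y : hyperboloid rho y -> 0 <= (`|g y| ^+ 2 * w y)%:E.
  by move=> yh; rewrite lee_fin mulr_ge0 ?exprn_ge0// w0.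
apply: le_trans (ge_ereal_inf _) _.
  exists (\int[sigma]_(y in hyperboloid rho) (`|g y| ^+ 2 * w y)%:E); last exact: lexx.
  by exists g.
have mD : measurable (hyperboloid rho `\` B) by exact: measurableD.
have W0 : 0 <= weighted rho w (hball rho z r) by apply: weighted_ge0 => y [].
have last_step : (4 + 2 * C * L * (1 - (x * L) ^+ n.+2))%:E * weighted rho w (hball rho z r)
    <= c1%:E * weighted rho w (hball rho z r).
  rewrite lee_wpmul2r// lee_fin lerD2l ler_piMr ?mulr_ge0// ?(ltW L0)//.
  by rewrite gerBl exprn_ge0// mulr_ge0// ltW.
rewrite -(setDUK BX) ge0_integral_setU; [|exact: mB|exact: mD| | |]; last 3 first.
- by rewrite setDUK.
- by rewrite setDUK.
- by apply/disj_setPS => y [? []].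
rewrite mulr_natl mulr2n EFinD ge0_muleDl ?lee_fin ?(ltW c10)//.
apply: leeD; first exact: le_trans D1 last_step.
apply: le_trans last_step; apply: le_trans D2; apply: ge0_subset_integral => //.
- exact: measurable_funS mgw.
- by move=> y /BX'; exact: gw0.
- by move=> y [yh yB]; case: (cover y yh).
Qed.

End doubling.

Theorem corollary3p19 (R : realType) (d : nat) (rho : R)
    (hd : (2 <= d)%N) (hrho : 0 <= rho) :
  (forall w : ambient R d -> R, doubling_weight rho w ->
     (forall (x : d.-tuple R) (t : R),
        hyperboloid rho (x, t) -> w (x, t) = w (x, - t)) ->
     exists2 c : R, 0 < c & forall (n : nat) (z : ambient R d),
       (1 <= n)%N -> hyperboloid rho z ->
       (christoffel rho w n z <= c%:E * weighted rho w (hball rho z n%:R^-1))%E)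
  /\
  (forall gamma : R, 0 <= gamma ->
     (exists2 c' : R, 0 < c' & forall (n : nat) (z : ambient R d),
        (1 <= n)%N -> hyperboloid rho z ->
        (c'%:E * weighted rho (weight0 rho gamma) (hball rho z n%:R^-1) <=
           christoffel rho (weight0 rho gamma) n z)%E) /\
     (exists c1 c2 : R, [/\ 0 < c1, 0 < c2 &
        forall (n : nat) (z : ambient R d), (1 <= n)%N -> hyperboloid rho z ->
        (c1%:E * weighted rho (weight0 rho gamma) (hball rho z n%:R^-1) <=
           (n%:R ^- d * weight0n rho gamma n z.2)%:E <=
           c2%:E * weighted rho (weight0 rho gamma) (hball rho z n%:R^-1))%E])).
Proof.
have d0 : (0 < d)%N by exact: leq_trans hd.
split=> [w [w0 wi _ [L L0 wL]] we|gamma gamma0].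
  have mw : measurable_fun (hyperboloid rho) w.
    by apply/measurable_EFinP; exact: measurable_int wi.
  by apply: (christoffel_doubling_le hrho w0 mw L0 wL) => -[x t] zh; rewrite -we.
by split; [exact: christoffel0_ge|exact: weighted0_equiv].
Qed.
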